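(* Let $\mu$ be any complex number. Let $z\in\mathbb{C}$ be arbitrary if $\mu\in\mathbb{Z}$, and let $z\in\mathbb{C}\setminus(-\infty,0]$ otherwise. Then the Bessel function of the first kind satisfies $$J_{\mu}(z)= \frac{\mathrm{i}^{\mu}}{\pi}\int_{0}^{\pi} e^{-\mathrm{i} z\cos\theta}\, P\big(\{\mu\},-\mathrm{i} z(1+\cos\theta)\big)\cos(\mu\theta)\,\mathrm{d}\theta+\frac{\mathrm{i}^{\mu}}{\sqrt{\pi}}\,e^{\mathrm{i} z}\sum_{j=1}^{-\langle\mathrm{Re}\,\mu\rangle}\frac{\Gamma(j+\mu-\frac12)}{\Gamma(j)\,\Gamma(j+2\mu)}\,(-2\mathrm{i} z)^{j+\mu-1},$$ where the sum is understood as zero if $\langle\mathrm{Re}\,\mu\rangle\geq 0$, i.e. if $\mathrm{Re}\,\mu>-\frac12$.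
   Context: Integral and fractional parts: for $\mu\in\mathbb{C}$, $\langle\mathrm{Re}\,\mu\rangle$ is the nearest integer to $\mathrm{Re}\,\mu$, with the convention $\langle n+\frac12\rangle=n$ for $n\in\mathbb{Z}$; and $\{\mu\}:=\mu-\langle\mathrm{Re}\,\mu\rangle\in\mathbb{C}$, so $-\frac12<\mathrm{Re}\{\mu\}\leq\frac12$. $J_\mu(z)=(z/2)^\mu\sum_{k\ge0}\frac{(-1)^k(z/2)^{2k}}{k!\,\Gamma(\mu+k+1)}$ (with $1/\Gamma=0$ at the poles of $\Gamma$). Normalised incomplete gamma function: $P(a,w)=\gamma(a,w)/\Gamma(a)=w^a\gamma^*(a,w)$, where $\gamma^*(a,w)=e^{-w}\sum_{k\ge 0}\frac{w^k}{\Gamma(a+k+1)}$ is entire in both $a$ and $w$; in particular $P(0,w)=1$. Powers: $z^a$ is the principal power on $\mathbb{C}\setminus(-\infty,0]$, $\mathrm{i}^a=e^{\mathrm{i}\pi a/2}$, and for $c>0$ the power $(-\mathrm{i}cz)^a$ (including the one in $P(a,-\mathrm{i}cz)$) means $e^{-\mathrm{i}\pi a/2}c^a z^a$. In the finite sum, $1/\Gamma(j+2\mu)=0$ at poles of $\Gamma$ (so the sum is zero for all $\mu\in\mathbb{Z}$); when $\mu=m+\frac12$ with $m$ a negative integer, the ratio $\Gamma(j+\mu-\frac12)/\Gamma(j+2\mu)$ is understood as its limit, namely $2(-1)^{m+1}\Gamma(-j-2m)/\Gamma(-j-m+1)$. *)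

(* Defs.v *)
From Stdlib Require Export Reals ZArith Factorial.
From Coquelicot Require Export Coquelicot.

Open Scope R_scope.
Open Scope C_scope.

(* Totalised limit and sum in C, built on iota like Coquelicot's RInt_gen. *)
Definition CLim_seq (u : nat -> C) : C :=
  @iota C_CompleteNormedModule (fun l => filterlim u eventually (locally l)).

Definition CSeries (a : nat -> C) : C :=
  @iota C_CompleteNormedModule
    (@is_series C_AbsRing C_NormedModule a).

Definition Cexp (z : C) : C :=
  RtoC (exp (Re z)) * (cos (Im z), sin (Im z)).

Definition Ccos (z : C) : C := (Cexp (Ci * z) + Cexp (- (Ci * z))) / 2.

(* Principal argument, in (-PI, PI] for z <> 0. *)
Definition Carg (z : C) : R :=
  if Rle_dec 0 (Im z) then acos (Re z / Cmod z) else (- acos (Re z / Cmod z))%R.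

Definition Clog (z : C) : C := (ln (Cmod z), Carg z).

(* z^a. Off (-oo, 0] this is the principal power; for a an integer and z <> 0
   it is the ordinary integer power, also on the negative axis. At z = 0 it is
   1 for a = 0 and 0 otherwise; the value 0 for negative integers a only ever
   multiplies a vanishing factor in the formulas below. *)
Definition Cpower (z a : C) : C :=
  if Ceq_dec z 0 then (if Ceq_dec a 0 then 1 else 0) else Cexp (a * Clog z).

(* The reciprocal Gamma function, entire with zeros exactly at 0, -1, -2, ...,
   by Gauss's formula
     1 / Gamma(z) = lim_n  z (z + 1) ... (z + n) / (n! n^z).  *)
Fixpoint rising (z : C) (n : nat) : C :=
  match n with
  | O => 1
  | S p => rising z p * (z + RtoC (INR p))
  end.

Definition rGamma (z : C) : C :=
  CLim_seq (fun n =>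
    rising z (S n) / (RtoC (INR (fact n)) * Cpower (RtoC (INR n)) z)).

(* Meaningful away from 0, -1, -2, ... *)
Definition CGamma (z : C) : C := / rGamma z.

(* Nearest integer, with n + 1/2 sent to n. *)
Definition nearest (x : R) : Z := Zceil (x - 1 / 2).

Definition fracpart (mu : C) : C := mu - RtoC (IZR (nearest (Re mu))).

(* For mu a nonpositive integer and z = 0, the convention 0^mu in Cpower
   yields the value J_mu(0) of the entire function J_mu. *)
Definition BesselJ (mu z : C) : C :=
  Cpower (z / 2) mu *
  CSeries (fun k =>
    Cpow (- 1) k * Cpow (z / 2) (2 * k)
    * (/ RtoC (INR (fact k)) * rGamma (mu + RtoC (INR k) + 1))).

(* gamma^*(a, w), entire in both variables. *)
Definition gammastar (a w : C) : C :=
  Cexp (- w) *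
  CSeries (fun k => Cpow w k * rGamma (a + RtoC (INR k) + 1)).

(* The power (-i c z)^a := e^(-i pi a / 2) c^a z^a, for c > 0; it is not always
   the principal power of the number -i c z. *)
Definition power_mi (c : R) (z a : C) : C :=
  Cexp (- (Ci * RtoC PI * a / 2)) * Cpower (RtoC c) a * Cpower z a.

(* P(a, - i c z) = (- i c z)^a gamma^*(a, - i c z), with the above power. *)
Definition Pgamma_mi (a : C) (c : R) (z : C) : C :=
  power_mi c z a * gammastar a (- Ci * RtoC c * z).

(* Gamma(j + mu - 1/2) / Gamma(j + 2 mu). If mu = m + 1/2 with m a negative
   integer (necessarily m = nearest (Re mu)), both Gammas have a pole for
   1 <= j <= - m, and the ratio is replaced by its limit. *)
Definition Gamma_ratio (mu : C) (j : nat) : C :=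
  let m := nearest (Re mu) in
  let limit_value :=
    2 * RtoC (powerRZ (-1) (m + 1))
    * CGamma (RtoC (IZR (- Z.of_nat j - 2 * m)))
    / CGamma (RtoC (IZR (- Z.of_nat j - m + 1))) in
  let plain_ratio :=
    CGamma (RtoC (INR j) + mu - 1 / 2) * rGamma (RtoC (INR j) + 2 * mu) in
  if Ceq_dec mu (RtoC (IZR m) + 1 / 2) then
    if Z_lt_dec m 0 then limit_value else plain_ratio
  else plain_ratio.

Definition is_integer (mu : C) : Prop := exists n : Z, mu = RtoC (IZR n).

(* z lies on the cut (-oo, 0]. *)
Definition on_cut (z : C) : Prop := Im z = 0%R /\ (Re z <= 0)%R.

Definition integrand (mu z : C) (theta : R) : C :=
  Cexp (- (Ci * z * RtoC (cos theta)))
  * Pgamma_mi (fracpart mu) (1 + cos theta) z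
  * Ccos (mu * RtoC theta).

(* Main.v *)
Require Import Defs.
From Stdlib Require Import Lra Lia Classical.

(* Expanding gammastar, the integrand is a multiple of
     sum_k (- i z)^k (1 + cos t)^(a + k) cos (mu t) / Gamma(a + k + 1),   a = fracpart mu,
   and with s = a + k and d = s - mu, an integer, Cauchy's formula reads
     int_0^PI (1 + cos t)^s cos ((s - d) t) dt = PI 2^(-s) binom(2 s, d),
   which is 0 for d < 0. Integrating by parts gives the recurrence in d and the
   vanishing for d < 0, hence also the invariance of 2^s times the integral for
   d = 0 under s -> s + 1. The constant PI is found from (1 + cos t)^(s + n)
   cos (s t), whose mass concentrates at t = 0 as n grows.
   Termwise integration produces the series of e^(iz) times a confluent
   hypergeometric function of - 2 i z from the power z^(a + max(0, nearest (Re mu))) on;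
   the finite sum supplies the powers missing when nearest (Re mu) < 0. By Kummer's
   second formula the complete series is J_mu(z). All coefficients are written
   as entire functions of mu, so no value of mu has to be obtained as a limit. *)

(** * Limits, finite sums and series in C *)

(** The limits, series and improper integrals of the statement are total functions that carry
    meaning only once convergence is shown, so every value is reached through an explicit
    convergence statement. The end point PI is handled by cutting the integrals off at b < PI, where
    the identities hold exactly up to a boundary term, and letting b -> PI. The boundary term is of
    size (1 + cos b)^(Re s + 1/2), hence the condition Re s > -1/2 throughout; the rounding
    convention guarantees it for s = a. Since Re (a + k) > 0 for k >= 1, only the term k = 0 can be
    unbounded, and it is kept apart when sum and integral are exchanged. Gamma is accessible only
    through Gauss's product; its recurrence, the nonvanishing of 1 / Gamma off the poles and
    Legendre's duplication formula are derived from it, with Wallis' product supplying sqrt PI. The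
    recurrence of the coefficients in l is kept multiplied out because its leading factor vanishes
    for some mu. *)

Notation Cis_series := (@is_series C_AbsRing C_NormedModule).
Notation Cis_RInt := (@is_RInt C_R_NormedModule).
Notation Cis_derive := (@is_derive R_AbsRing C_R_NormedModule).
(** Series use [C] as a module over itself, derivatives and integrals use it as a real module. Both
    carry the same neighbourhoods, so one notion of limit serves for all of them. *)
Notation Cconv F f l := (filterlim f F (@locally C_R_NormedModule l)).

Lemma C_ext (x y : C) : Re x = Re y -> Im x = Im y -> x = y.
Proof. destruct x, y; simpl; intros; subst; reflexivity. Qed.

Lemma Cconv_Cmod {T : Type} {F : (T -> Prop) -> Prop} {FF : Filter F} (f : T -> C) (l : C) :
  Cconv F f l <-> filterlim (fun x => Cmod (f x - l)) F (locally 0%R).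
Proof.
  rewrite (filterlim_locally_ball_norm (U := C_NormedModule) f l).
  rewrite (filterlim_locally_ball_norm (K := R_AbsRing) (fun x => Cmod (f x - l)) 0%R).
  split; intros H eps; generalize (H eps); apply filter_imp; intros x; unfold ball_norm;
    change (norm (minus (f x) l)) with (Cmod (f x - l));
    change (norm (minus (Cmod (f x - l)) 0%R)) with (Rabs (Cmod (f x - l) - 0));
    rewrite Rminus_0_r, (Rabs_pos_eq _ (Cmod_ge_0 _)); auto.
Qed.

Lemma Cconv_squeeze {T : Type} {F : (T -> Prop) -> Prop} {FF : Filter F} (f : T -> C) (l : C) (g : T -> R) :
  F (fun x => Cmod (f x - l) <= g x)%R -> filterlim g F (locally 0%R) -> Cconv F f l.
Proof.
  intros H1 H2. apply Cconv_Cmod; auto.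
  apply (filterlim_le_le (F := F) (fun _ => 0%R) (fun x => Cmod (f x - l)) g (Finite 0)); auto.
  - generalize H1; apply filter_imp; intros x Hx; split; auto. apply Cmod_ge_0.
  - apply filterlim_const.
Qed.

Lemma Cconv_components {T : Type} {F : (T -> Prop) -> Prop} {FF : Filter F} (f : T -> C) (l : C) :
  Cconv F f l <->
  filterlim (fun x => Re (f x)) F (locally (Re l)) /\ filterlim (fun x => Im (f x)) F (locally (Im l)).
Proof.
  split.
  - intros H; split; (eapply filterlim_comp; [exact H |]).
    + destruct l as [a b]; apply (continuous_fst (U := R_UniformSpace) (V := R_UniformSpace) a b).
    + destruct l as [a b]; apply (continuous_snd (U := R_UniformSpace) (V := R_UniformSpace) a b).
  - intros [H1 H2]. apply filterlim_locally; intros eps.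
    pose proof (proj1 (filterlim_locally _ _) H1 eps) as K1.
    pose proof (proj1 (filterlim_locally _ _) H2 eps) as K2.
    generalize (filter_and _ _ K1 K2); apply filter_imp; intros x [A B]; split; auto.
Qed.

Lemma Cconv_plus {T : Type} {F : (T -> Prop) -> Prop} {FF : Filter F} (f g : T -> C) (l m : C) :
  Cconv F f l -> Cconv F g m -> Cconv F (fun x => f x + g x) (l + m).
Proof.
  intros Hf Hg. eapply (filterlim_comp_2 (F := F) (FF := FF)); [exact Hf | exact Hg |].
  apply (filterlim_plus (V := C_R_NormedModule) l m).
Qed.

Lemma Cconv_mult {T : Type} {F : (T -> Prop) -> Prop} {FF : Filter F} (f g : T -> C) (l m : C) :
  Cconv F f l -> Cconv F g m -> Cconv F (fun x => f x * g x) (l * m).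
Proof.
  rewrite !(Cconv_components (F := F)). intros [A1 A2] [B1 B2].
  assert (P : forall (u v : T -> R) a b, filterlim u F (locally a) -> filterlim v F (locally b) ->
     filterlim (fun x => u x * v x)%R F (locally (a * b)%R)).
  { intros u v a b Hu Hv. eapply (filterlim_comp_2 (F := F) (FF := FF)); [exact Hu | exact Hv |].
    apply (filterlim_mult (K := R_AbsRing) a b). }
  assert (Q : forall (u v : T -> R) a b, filterlim u F (locally a) -> filterlim v F (locally b) ->
     filterlim (fun x => u x + v x)%R F (locally (a + b)%R)).
  { intros u v a b Hu Hv. eapply (filterlim_comp_2 (F := F) (FF := FF)); [exact Hu | exact Hv |].
    apply (filterlim_plus (V := R_NormedModule) a b). }
  assert (O : forall (u : T -> R) a, filterlim u F (locally a) ->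
     filterlim (fun x => - u x)%R F (locally (- a)%R)).
  { intros u a Hu. eapply filterlim_comp; [exact Hu |].
    apply (filterlim_opp (V := R_NormedModule) a). }
  split; [change (Re (l * m)) with (Re l * Re m - Im l * Im m)%R | change (Im (l * m)) with (Re l * Im m + Im l * Re m)%R].
  - apply (Q (fun x => Re (f x) * Re (g x))%R (fun x => - (Im (f x) * Im (g x)))%R); [| apply O]; apply P; auto.
  - apply (Q (fun x => Re (f x) * Im (g x))%R (fun x => Im (f x) * Re (g x))%R); apply P; auto.
Qed.

Lemma Cconv_const {T : Type} {F : (T -> Prop) -> Prop} {FF : Filter F} (l : C) :
  Cconv F (fun _ : T => l) l.
Proof. apply filterlim_const. Qed.

Lemma Cconv_scal {T : Type} {F : (T -> Prop) -> Prop} {FF : Filter F} (f : T -> C) (c l : C) :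
  Cconv F f l -> Cconv F (fun x => c * f x) (c * l).
Proof. intros H. apply Cconv_mult; auto. apply Cconv_const. Qed.

Lemma Cconv_RtoC {T : Type} {F : (T -> Prop) -> Prop} {FF : Filter F} (f : T -> R) (l : R) :
  filterlim f F (locally l) -> Cconv F (fun x => RtoC (f x)) (RtoC l).
Proof.
  intros H. apply Cconv_components. split; simpl; auto. apply filterlim_const.
Qed.

Lemma Cconv_unique {T : Type} {F : (T -> Prop) -> Prop} {FF : ProperFilter' F} (f : T -> C) (l m : C) :
  Cconv F f l -> Cconv F f m -> l = m.
Proof. intros H1 H2. exact (filterlim_locally_unique (V := C_R_NormedModule) f l m H1 H2). Qed.

Lemma Cconv_ext {T : Type} {F : (T -> Prop) -> Prop} {FF : Filter F} (f g : T -> C) (l : C) :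
  (forall x, f x = g x) -> Cconv F f l -> Cconv F g l.
Proof. intros H. apply filterlim_ext; auto. Qed.

Lemma Cconv_ext_loc {T : Type} {F : (T -> Prop) -> Prop} {FF : Filter F} (f g : T -> C) (l : C) :
  F (fun x => f x = g x) -> Cconv F f l -> Cconv F g l.
Proof. intros H. apply filterlim_ext_loc; auto. Qed.

(** The upper index is excluded, unlike in [sum_n], so that empty sums and splittings at n need no
    case distinction. *)
Fixpoint csum (a : nat -> C) (n : nat) : C :=
  match n with O => 0 | S p => csum a p + a p end.

Lemma csum_ext a b n : (forall k, (k < n)%nat -> a k = b k) -> csum a n = csum b n.
Proof.
  induction n; intros H; simpl; auto. rewrite IHn, H; auto.
Qed.

Lemma csum_plus a b n : csum (fun k => a k + b k) n = csum a n + csum b n.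
Proof. induction n; simpl; [ring | rewrite IHn; ring]. Qed.

Lemma csum_scal c a n : csum (fun k => c * a k) n = c * csum a n.
Proof. induction n; simpl; [ring | rewrite IHn; ring]. Qed.

Lemma csum_0 n : csum (fun _ => 0) n = 0.
Proof. induction n; simpl; [ring | rewrite IHn; ring]. Qed.

Lemma csum_shift a n : csum a (S n) = a O + csum (fun k => a (S k)) n.
Proof. induction n; simpl in *; [ring | rewrite IHn; ring]. Qed.

Lemma csum_split a n p : csum a (n + p) = csum a n + csum (fun k => a (n + k)%nat) p.
Proof.
  induction p; simpl.
  - rewrite Nat.add_0_r; ring.
  - rewrite Nat.add_succ_r; simpl. rewrite IHp; ring.
Qed.

Lemma csum_sum_n a n : @sum_n C_NormedModule a n = csum a (S n).
Proof.
  induction n.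
  - rewrite sum_O; simpl; symmetry; apply Cplus_0_l.
  - rewrite sum_Sn, IHn. reflexivity.
Qed.

Lemma csum_sum_n_m a n : @sum_n_m C_AbelianMonoid a 1 n = csum (fun k => a (S k)) n.
Proof.
  induction n.
  - rewrite sum_n_m_zero; auto.
  - rewrite sum_n_Sm, IHn; [reflexivity | lia].
Qed.

Lemma Cis_series_csum a l : Cis_series a l <-> Cconv eventually (csum a) l.
Proof.
  unfold is_series. split; intros H.
  - intros P HP. destruct (H P HP) as [N HN]. exists (S N). intros [|n] Hn; [lia |].
    rewrite <- csum_sum_n. apply HN; lia.
  - eapply filterlim_ext. { intros n; symmetry; apply csum_sum_n. }
    eapply filterlim_comp; [| exact H]. intros P [N HN]. exists N. intros n Hn. apply HN; lia.
Qed.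

Lemma Cis_series_unique a l m : Cis_series a l -> Cis_series a m -> l = m.
Proof. rewrite !Cis_series_csum. apply Cconv_unique. Qed.

Lemma CSeries_unique a l : Cis_series a l -> CSeries a = l.
Proof.
  intros H. unfold CSeries. apply (iota_unique (V := C_CompleteNormedModule)); auto.
  intros y Hy. exact (Cis_series_unique a y l Hy H).
Qed.

Lemma CLim_seq_unique u l : Cconv eventually u l -> CLim_seq u = l.
Proof.
  intros H. unfold CLim_seq.
  apply (iota_filterlim_locally (V := C_CompleteNormedModule) (F := eventually)); auto.
Qed.

Lemma Cis_series_scal c a l : Cis_series a l -> Cis_series (fun n => c * a n) (c * l).
Proof. intros H. exact (is_series_scal (V := C_NormedModule) c a l H). Qed.

Lemma Cis_series_shift a n l :
  Cis_series (fun k => a (n + k)%nat) l <-> Cis_series a (csum a n + l).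
Proof.
  rewrite !Cis_series_csum. split; intros H.
  - assert (K : Cconv eventually (fun k => csum a n + csum (fun k => a (n + k)%nat) k) (csum a n + l)).
    { apply Cconv_plus; auto. apply Cconv_const. }
    intros P HP. destruct (K P HP) as [N HN]. exists (n + N)%nat. intros k Hk.
    replace k with (n + (k - n))%nat by lia. rewrite csum_split. apply HN; lia.
  - assert (K : Cconv eventually (fun k => - csum a n + csum a (n + k)) (- csum a n + (csum a n + l))).
    { apply Cconv_plus; auto. apply Cconv_const.
      eapply filterlim_comp; [| exact H]. intros P [N HN]. exists N. intros k Hk. apply HN; lia. }
    replace l with (- csum a n + (csum a n + l)) by ring.
    eapply Cconv_ext; [| exact K]. intros k; simpl. rewrite csum_split; ring.
Qed.

Lemma Cex_series_abs a : ex_series (fun n => Cmod (a n)) -> exists l, Cis_series a l.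
Proof.
  intros H. apply (ex_series_le (V := C_CompleteNormedModule) a (fun n => Cmod (a n))); auto.
  intros n. apply Rle_refl.
Qed.

(** * The complex exponential *)

Lemma Cexp_plus a b : Cexp (a + b) = Cexp a * Cexp b.
Proof.
  unfold Cexp. destruct a as [a1 a2], b as [b1 b2].
  apply C_ext; simpl; rewrite exp_plus; [rewrite cos_plus | rewrite sin_plus]; ring.
Qed.

Lemma Cexp_RtoC x : Cexp (RtoC x) = RtoC (exp x).
Proof. unfold Cexp. simpl. rewrite cos_0, sin_0. apply C_ext; simpl; ring. Qed.

Lemma Cexp_0 : Cexp 0 = 1.
Proof. rewrite Cexp_RtoC, exp_0. reflexivity. Qed.

Lemma Cexp_opp_r a : Cexp a * Cexp (- a) = 1.
Proof. rewrite <- Cexp_plus, <- Cexp_0. f_equal. ring. Qed.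

Lemma Cexp_neq_0 a : Cexp a <> 0.
Proof.
  intros H. apply C1_nz. rewrite <- (Cexp_opp_r a), H. ring.
Qed.

Lemma Cexp_opp a : Cexp (- a) = / Cexp a.
Proof.
  pose proof (Cexp_neq_0 a). rewrite <- (Cmult_1_l (/ Cexp a)), <- (Cexp_opp_r a). field; auto.
Qed.

Lemma Cexp_INR n a : Cexp (RtoC (INR n) * a) = Cpow (Cexp a) n.
Proof.
  induction n.
  - simpl. rewrite Cmult_0_l. apply Cexp_0.
  - rewrite S_INR, RtoC_plus, Cmult_plus_distr_r, Cexp_plus, IHn, Cmult_1_l, Cpow_S. ring.
Qed.

Lemma Cmod_Cexp a : Cmod (Cexp a) = exp (Re a).
Proof.
  unfold Cexp. rewrite Cmod_mult, Cmod_R, Rabs_pos_eq by (left; apply exp_pos).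
  replace (Cmod (cos (Im a), sin (Im a))) with 1%R; [ring |].
  unfold Cmod; simpl. symmetry.
  replace (cos (Im a) * (cos (Im a) * 1) + sin (Im a) * (sin (Im a) * 1))%R with 1%R; [apply sqrt_1 |].
  pose proof (sin2_cos2 (Im a)) as H; unfold Rsqr in H; lra.
Qed.

Lemma Cmod_Cexp_le a : (Cmod (Cexp a) <= exp (Cmod a))%R.
Proof.
  rewrite Cmod_Cexp. pose proof (re_le_Cmod a). pose proof (Rle_abs (Re a)).
  destruct (Req_dec (Re a) (Cmod a)) as [E | E]; [rewrite E; lra | left; apply exp_increasing; lra].
Qed.

(** * Derivatives and integrals of complex functions of a real variable *)

Lemma Cis_derive_components (f : R -> C) t (l : C) :
  is_derive (fun x => Re (f x)) t (Re l) -> is_derive (fun x => Im (f x)) t (Im l) ->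
  Cis_derive f t l.
Proof.
  intros H1 H2.
  apply (filterdiff_ext (fun x => (Re (f x), Im (f x)) : C_R_NormedModule)).
  { intros x; destruct (f x); reflexivity. }
  eapply filterdiff_ext_lin.
  - apply (filterdiff_comp'_2 (K := R_AbsRing) (W := C_R_NormedModule) (fun x => Re (f x)) (fun x => Im (f x)) (fun x y => (x, y)) t _ _ (fun x y => (x, y)) H1 H2).
    apply (filterdiff_ext_lin _ (fun x => x)); [| intros [x y]; reflexivity].
    apply (filterdiff_ext (fun x => x)); [intros [x y]; reflexivity |].
    apply filterdiff_id.
  - intros y. destruct l; reflexivity.
Qed.

Lemma Cis_derive_Re (f : R -> C) t (l : C) : Cis_derive f t l -> is_derive (fun x => Re (f x)) t (Re l).
Proof.
  intros H. unfold is_derive.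
  eapply filterdiff_ext_lin.
  - apply (filterdiff_comp (K := R_AbsRing) (U := R_NormedModule) (V := C_R_NormedModule) (W := R_NormedModule) f fst _ fst H).
    apply filterdiff_linear, is_linear_fst.
  - intros y; destruct l; reflexivity.
Qed.

Lemma Cis_derive_Im (f : R -> C) t (l : C) : Cis_derive f t l -> is_derive (fun x => Im (f x)) t (Im l).
Proof.
  intros H. unfold is_derive.
  eapply filterdiff_ext_lin.
  - apply (filterdiff_comp (K := R_AbsRing) (U := R_NormedModule) (V := C_R_NormedModule) (W := R_NormedModule) f snd _ snd H).
    apply filterdiff_linear, is_linear_snd.
  - intros y; destruct l; reflexivity.
Qed.

Lemma Cis_derive_const (c : C) (t : R) : Cis_derive (fun _ => c) t (RtoC 0).
Proof. apply (is_derive_const (V := C_R_NormedModule)). Qed.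

Lemma Cis_derive_eq (f : R -> C) (t : R) (d d' : C) : Cis_derive f t d -> d = d' -> Cis_derive f t d'.
Proof. intros H <-; exact H. Qed.

Lemma Cis_derive_ext (f g : R -> C) (t : R) (d : C) :
  (forall x, f x = g x) -> Cis_derive f t d -> Cis_derive g t d.
Proof. intros H. apply (is_derive_ext (V := C_R_NormedModule)). exact H. Qed.

Lemma Cis_derive_plus (f g : R -> C) (t : R) (df dg : C) :
  Cis_derive f t df -> Cis_derive g t dg -> Cis_derive (fun x => f x + g x) t (df + dg).
Proof. intros H1 H2. apply (is_derive_plus (V := C_R_NormedModule) f g t df dg H1 H2). Qed.

Lemma Cis_derive_RtoC (f : R -> R) (t df : R) : is_derive f t df -> Cis_derive (fun x => RtoC (f x)) t (RtoC df).
Proof.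
  intros H. apply Cis_derive_components; simpl; auto. apply (is_derive_const (V := R_NormedModule)).
Qed.

Lemma Cis_derive_mult (f g : R -> C) (t : R) (df dg : C) :
  Cis_derive f t df -> Cis_derive g t dg -> Cis_derive (fun x => f x * g x) t (df * g t + f t * dg).
Proof.
  intros H1 H2.
  pose proof (Cis_derive_Re _ _ _ H1) as A1. pose proof (Cis_derive_Im _ _ _ H1) as A2.
  pose proof (Cis_derive_Re _ _ _ H2) as B1. pose proof (Cis_derive_Im _ _ _ H2) as B2.
  pose proof (fun u v du dv (Hu : is_derive u t du) (Hv : is_derive v t dv) =>
    is_derive_mult (K := R_AbsRing) u v t du dv Hu Hv Rmult_comm) as M.
  apply Cis_derive_components.
  - apply (is_derive_ext (fun x => minus (Re (f x) * Re (g x))%R (Im (f x) * Im (g x))%R)).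
    { intros x; reflexivity. }
    evar_last. { apply (is_derive_minus (V := R_NormedModule)); apply M; eassumption. }
    unfold minus, plus, opp, mult; simpl. unfold Re, Im. ring.
  - apply (is_derive_ext (fun x => plus (Re (f x) * Im (g x))%R (Im (f x) * Re (g x))%R)).
    { intros x; reflexivity. }
    evar_last. { apply (is_derive_plus (V := R_NormedModule)); apply M; eassumption. }
    unfold plus, mult; simpl. unfold Re, Im. ring.
Qed.

Lemma Cis_derive_scal (c : C) (f : R -> C) (t : R) (df : C) : Cis_derive f t df -> Cis_derive (fun x => c * f x) t (c * df).
Proof.
  intros H. eapply Cis_derive_eq. { apply (Cis_derive_mult (fun _ => c) f); [apply Cis_derive_const | exact H]. }
  simpl. ring.
Qed.

Lemma Cis_derive_Cexp (f : R -> C) (t : R) (df : C) : Cis_derive f t df -> Cis_derive (fun x => Cexp (f x)) t (df * Cexp (f t)).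
Proof.
  intros H.
  pose proof (Cis_derive_Re _ _ _ H) as A1. pose proof (Cis_derive_Im _ _ _ H) as A2.
  assert (E : Cis_derive (fun x => RtoC (exp (Re (f x)))) t (RtoC (Re df * exp (Re (f t))))).
  { apply Cis_derive_RtoC. apply (is_derive_comp exp (fun x => Re (f x))); auto. apply is_derive_exp. }
  assert (G : Cis_derive (fun x => (cos (Im (f x)), sin (Im (f x)))) t
      ((- (Im df * sin (Im (f t))))%R, (Im df * cos (Im (f t)))%R)).
  { apply Cis_derive_components; simpl.
    - evar_last. { apply (is_derive_comp cos (fun x => Im (f x))); [apply is_derive_cos | exact A2]. }
      unfold scal; simpl; unfold mult; simpl. ring.
    - apply (is_derive_comp sin (fun x => Im (f x))); auto. apply is_derive_sin. }
  eapply Cis_derive_eq. { apply (Cis_derive_mult _ _ _ _ _ E G). }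
  unfold Cexp. apply C_ext; simpl; unfold Re, Im; ring.
Qed.

Lemma Cis_derive_continuous (f : R -> C) (t : R) (df : C) : Cis_derive f t df -> @continuous R_UniformSpace C_R_NormedModule f t.
Proof. intros H. apply (ex_derive_continuous (V := C_R_NormedModule)). exists df; exact H. Qed.

Lemma Cis_RInt_derive (f df : R -> C) (a b : R) : (a <= b)%R ->
  (forall x, (a <= x <= b)%R -> Cis_derive f x (df x)) ->
  (forall x, (a <= x <= b)%R -> @continuous R_UniformSpace C_R_NormedModule df x) ->
  Cis_RInt df a b (f b - f a).
Proof.
  intros Hab H1 H2. apply (is_RInt_derive (V := C_R_CompleteNormedModule) f df).
  all: intros x; rewrite Rmin_left, Rmax_right by auto; auto.
Qed.

(** * Taylor remainder and power series of the exponential *)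

Definition exp_sum (w : C) (n : nat) : C := csum (fun k => w ^ k / RtoC (INR (fact k))) n.

Lemma RtoC_neq_0 x : x <> 0%R -> RtoC x <> 0.
Proof. intros H E. apply H. apply RtoC_inj. exact E. Qed.

Lemma INR_fact_C_neq_0 k : RtoC (INR (fact k)) <> 0.
Proof. apply RtoC_neq_0, INR_fact_neq_0. Qed.

Lemma INR_S_C_neq_0 k : RtoC (INR (S k)) <> 0.
Proof. apply RtoC_neq_0, not_0_INR. lia. Qed.

Lemma fact_S_C k : RtoC (INR (fact (S k))) = RtoC (INR (S k)) * RtoC (INR (fact k)).
Proof. rewrite <- RtoC_mult, <- mult_INR. reflexivity. Qed.

Lemma exp_sum_derive w n t :
  Cis_derive (fun x => exp_sum (RtoC x * w) (S n)) t (w * exp_sum (RtoC t * w) n).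
Proof.
  assert (D : forall k, Cis_derive (fun x => (RtoC x * w) ^ k) t (RtoC (INR k) * w * (RtoC t * w) ^ (pred k))).
  { induction k.
    - simpl. eapply Cis_derive_eq; [apply Cis_derive_const | simpl; ring].
    - apply (Cis_derive_ext (fun x => (RtoC x * w) * (RtoC x * w) ^ k)). { intros x; symmetry; apply Cpow_S. }
      eapply Cis_derive_eq. { apply (Cis_derive_mult (fun x => RtoC x * w) _ _ (1 * w + RtoC t * 0)); [| exact IHk].
        apply (Cis_derive_mult (fun x => RtoC x) (fun _ => w)).
        - apply Cis_derive_RtoC. apply (is_derive_id (K := R_AbsRing)).
        - apply Cis_derive_const. }
      simpl pred. rewrite S_INR, RtoC_plus. destruct k; [simpl; ring |]. simpl pred. rewrite Cpow_S. ring. }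
  induction n.
  - unfold exp_sum; simpl. apply (Cis_derive_ext (fun _ => 0 + 1 / 1)). { reflexivity. }
    eapply Cis_derive_eq; [apply Cis_derive_const | simpl; ring].
  - apply (Cis_derive_ext (fun x => exp_sum (RtoC x * w) (S n) + / RtoC (INR (fact (S n))) * (RtoC x * w) ^ (S n))).
    { intros x. change (exp_sum (RtoC x * w) (S (S n))) with (exp_sum (RtoC x * w) (S n) + (RtoC x * w) ^ (S n) / RtoC (INR (fact (S n)))).
      unfold Cdiv; ring. }
    eapply Cis_derive_eq. { apply Cis_derive_plus; [exact IHn | apply Cis_derive_scal, D]. }
    change (exp_sum (RtoC t * w) (S n)) with (exp_sum (RtoC t * w) n + (RtoC t * w) ^ n / RtoC (INR (fact n))).
    rewrite fact_S_C. pose proof (INR_fact_C_neq_0 n). pose proof (INR_S_C_neq_0 n).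
    simpl pred. field. auto.
Qed.

Lemma Cexp_scale_derive w t : Cis_derive (fun x => Cexp (RtoC x * w)) t (w * Cexp (RtoC t * w)).
Proof.
  eapply Cis_derive_eq. { apply (Cis_derive_Cexp (fun x => RtoC x * w)).
    apply (Cis_derive_mult (fun x => RtoC x) (fun _ => w)).
    - apply Cis_derive_RtoC. apply (is_derive_id (K := R_AbsRing)).
    - apply Cis_derive_const. }
  simpl. change (RtoC one) with (RtoC 1). ring.
Qed.

(** Along the ray t -> t w the remainder of order n + 1 vanishes at t = 0 and has derivative w times
    the remainder of order n. Integrating the bound gives the next one; the factor t^n is there to
    produce the factorial. *)
Lemma Cexp_taylor_scaled w n t : (0 <= t <= 1)%R ->
  (Cmod (Cexp (RtoC t * w) - exp_sum (RtoC t * w) n) <= exp (Cmod w) * Cmod w ^ n * t ^ n / INR (fact n))%R.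
Proof.
  revert t. induction n; intros t Ht.
  - unfold exp_sum; simpl. replace (Cexp (RtoC t * w) - 0) with (Cexp (RtoC t * w)) by ring.
    eapply Rle_trans; [apply Cmod_Cexp_le |]. rewrite Cmod_mult, Cmod_R, Rabs_pos_eq by lra.
    replace (exp (Cmod w) * 1 * 1 / 1)%R with (exp (Cmod w)) by field.
    pose proof (Cmod_ge_0 w).
    destruct (Req_dec (t * Cmod w) (Cmod w)) as [E | E]; [rewrite E; lra | left; apply exp_increasing; nra].
  - set (f := fun x : R => Cexp (RtoC x * w) - exp_sum (RtoC x * w) (S n)).
    set (df := fun x : R => w * (Cexp (RtoC x * w) - exp_sum (RtoC x * w) n)).
    assert (D : forall x, Cis_derive f x (df x)).
    { intros x. unfold f, df. eapply Cis_derive_eq.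
      - apply (is_derive_minus (V := C_R_NormedModule)); [apply Cexp_scale_derive | apply exp_sum_derive].
      - change (minus (w * Cexp (RtoC x * w)) (w * exp_sum (RtoC x * w) n)) with (w * Cexp (RtoC x * w) - (w * exp_sum (RtoC x * w) n)).
        ring. }
    assert (Cc : forall x, @continuous R_UniformSpace C_R_NormedModule df x).
    { intros x. unfold df. destruct n.
      - eapply Cis_derive_continuous. apply Cis_derive_scal. unfold exp_sum; simpl.
        apply (is_derive_minus (V := C_R_NormedModule)); [apply Cexp_scale_derive | apply Cis_derive_const].
      - eapply Cis_derive_continuous. apply Cis_derive_scal.
        apply (is_derive_minus (V := C_R_NormedModule)); [apply Cexp_scale_derive | apply exp_sum_derive]. }
    pose proof (Cis_RInt_derive f df 0 t (proj1 Ht) (fun x _ => D x) (fun x _ => Cc x)) as I.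
    assert (F0 : f 0%R = 0).
    { unfold f. rewrite Cmult_0_l, Cexp_0. unfold exp_sum. rewrite csum_shift.
      rewrite (csum_ext _ (fun _ => 0)). - rewrite csum_0. simpl. field.
      - intros k _. rewrite Cpow_S. pose proof (INR_fact_C_neq_0 (S k)). field; auto. }
    rewrite F0 in I. replace (f t - 0) with (f t) in I by ring.
    change (Cexp (RtoC t * w) - exp_sum (RtoC t * w) (S n)) with (f t).
    assert (J : is_RInt (fun x => exp (Cmod w) * Cmod w ^ S n / INR (fact n) * x ^ n)%R 0 t
                  (exp (Cmod w) * Cmod w ^ S n / INR (fact n) * (t ^ S n / INR (S n)))%R).
    { apply (is_RInt_scal (V := R_NormedModule)).
      evar_last. { apply (is_RInt_derive (fun x => x ^ S n / INR (S n))%R).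
        - intros x _. auto_derive; auto. simpl pred. pose proof (not_0_INR (S n) ltac:(lia)) as K. field_simplify; [reflexivity | exact K].
        - intros x _. apply (ex_derive_continuous (V := R_NormedModule)). auto_derive; auto. }
      unfold minus, plus, opp; simpl. rewrite Rmult_0_l. unfold Rdiv; ring. }
    assert (B : (Cmod (f t) <= exp (Cmod w) * Cmod w ^ S n / INR (fact n) * (t ^ S n / INR (S n)))%R).
    { rewrite (Cmod_norm (f t)). refine (norm_RInt_le (V := C_R_NormedModule) df _ 0 t (f t) _ (proj1 Ht) _ I J).
      intros x Hx. rewrite <- Cmod_norm. unfold df. rewrite Cmod_mult.
      eapply Rle_trans; [apply Rmult_le_compat_l; [apply Cmod_ge_0 | apply IHn; lra] |].
      apply Req_le. simpl. field. apply INR_fact_neq_0. }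
    eapply Rle_trans; [exact B |].
    apply Req_le. rewrite fact_simpl, mult_INR. pose proof (INR_fact_neq_0 n). pose proof (not_0_INR (S n) ltac:(lia)). field; auto.
Qed.

Lemma Cexp_taylor w n :
  (Cmod (Cexp w - exp_sum w n) <= exp (Cmod w) * Cmod w ^ n / INR (fact n))%R.
Proof.
  pose proof (Cexp_taylor_scaled w n 1 ltac:(lra)) as H.
  rewrite Cmult_1_l, pow1, Rmult_1_r in H. exact H.
Qed.

Lemma ex_series_exp_abs (x : R) : ex_series (fun k => x ^ k / INR (fact k))%R.
Proof.
  exists (exp x). apply (is_series_ext (fun n => scal (x ^ n)%R (/ INR (fact n))%R)).
  - intros n; reflexivity.
  - apply is_exp_Reals.
Qed.

Lemma Cmod_exp_term w k : Cmod (w ^ k / RtoC (INR (fact k))) = (Cmod w ^ k / INR (fact k))%R.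
Proof.
  rewrite Cmod_div by apply INR_fact_C_neq_0. rewrite Cmod_pow, Cmod_R, Rabs_pos_eq; auto. apply pos_INR.
Qed.

Lemma Cexp_series w : Cis_series (fun k => w ^ k / RtoC (INR (fact k))) (Cexp w).
Proof.
  apply Cis_series_csum.
  apply (Cconv_squeeze _ _ (fun n => exp (Cmod w) * (Cmod w ^ n / INR (fact n)))%R).
  - exists O. intros n _. pose proof (Cexp_taylor w n) as H. rewrite <- Cmod_opp.
    replace (- (csum (fun k => w ^ k / RtoC (INR (fact k))) n - Cexp w)) with (Cexp w - exp_sum w n) by (unfold exp_sum; ring).
    unfold Rdiv in *. rewrite <- Rmult_assoc. exact H.
  - pose proof (ex_series_lim_0 _ (ex_series_exp_abs (Cmod w))) as H.
    apply (is_lim_seq_scal_l _ (exp (Cmod w))) in H. simpl in H. rewrite Rmult_0_r in H. exact H.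
Qed.

(** * Powers and products of series *)

(** [acos] yields an angle in [0, PI], whose sine is nonnegative and gives |Im z|; the sign test in
    [Carg] restores the sign. *)
Lemma Cexp_Clog (z : C) : z <> 0 -> Cexp (Clog z) = z.
Proof.
  intros Hz. pose proof (proj1 (Cmod_gt_0 z) Hz) as Hr.
  unfold Cexp, Clog; simpl. rewrite exp_ln by exact Hr.
  pose proof (re_le_Cmod z) as Hre. apply Rabs_le_between in Hre.
  assert (B : (-1 <= Re z / Cmod z <= 1)%R).
  { split.
    - apply Rmult_le_reg_r with (Cmod z); auto. field_simplify; [lra | lra].
    - apply Rmult_le_reg_r with (Cmod z); auto. field_simplify; [lra | lra]. }
  assert (S : (Cmod z * sqrt (1 - (Re z / Cmod z)²) = Rabs (Im z))%R).
  { rewrite <- (Rabs_pos_eq (Cmod z)) at 1 by lra. rewrite <- sqrt_Rsqr_abs.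
    rewrite <- sqrt_mult_alt by apply Rle_0_sqr. rewrite <- sqrt_Rsqr_abs. f_equal.
    pose proof (Cmod2_alt z) as E. unfold Rsqr. field_simplify; [| lra].
    rewrite E. ring. }
  unfold Carg. apply C_ext; simpl.
  - destruct (Rle_dec 0 (Im z)); [| rewrite cos_neg]; rewrite cos_acos by exact B; field; lra.
  - destruct (Rle_dec 0 (Im z)) as [H | H]; [| rewrite sin_neg]; rewrite sin_acos by exact B.
    + rewrite Rabs_pos_eq in S by exact H. unfold Re, Im in *; lra.
    + rewrite Rabs_left in S by lra. unfold Re, Im in *; lra.
Qed.

Lemma Cpower_nonzero (z a : C) : z <> 0 -> Cpower z a = Cexp (a * Clog z).
Proof. intros H. unfold Cpower. destruct (Ceq_dec z 0); [contradiction | reflexivity]. Qed.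

Lemma Cpower_neq_0 (z a : C) : z <> 0 -> Cpower z a <> 0.
Proof. intros H. rewrite Cpower_nonzero by exact H. apply Cexp_neq_0. Qed.

Lemma Cpower_plus (z a b : C) : z <> 0 -> Cpower z (a + b) = Cpower z a * Cpower z b.
Proof. intros H. rewrite !Cpower_nonzero by exact H. rewrite <- Cexp_plus. f_equal. ring. Qed.

Lemma Cpower_0_r z : Cpower z 0 = 1.
Proof.
  unfold Cpower. destruct (Ceq_dec z 0).
  - destruct (Ceq_dec 0 0); [reflexivity | contradiction].
  - rewrite Cmult_0_l. apply Cexp_0.
Qed.

Lemma Cpower_INR (z : C) n : z <> 0 -> Cpower z (RtoC (INR n)) = z ^ n.
Proof. intros H. rewrite Cpower_nonzero, Cexp_INR, Cexp_Clog; auto. Qed.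

(** A positive factor leaves the argument alone, so no branch condition on z arises. The prefactor
    (z/2)^mu is split by this. *)
Lemma Clog_scale c (z : C) : (0 < c)%R -> z <> 0 -> Clog (RtoC c * z) = RtoC (ln c) + Clog z.
Proof.
  intros Hc Hz. pose proof (proj1 (Cmod_gt_0 z) Hz) as Hr.
  unfold Clog. rewrite Cmod_mult, Cmod_R, Rabs_pos_eq, ln_mult by lra.
  assert (E : Carg (RtoC c * z) = Carg z).
  { unfold Carg. rewrite Cmod_mult, Cmod_R, Rabs_pos_eq by lra.
    rewrite re_scal_l, im_scal_l.
    replace (c * Re z / (c * Cmod z))%R with (Re z / Cmod z)%R by (field; lra).
    destruct (Rle_dec 0 (c * Im z)), (Rle_dec 0 (Im z)); auto; exfalso; nra. }
  rewrite E. apply C_ext; simpl; ring.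
Qed.

Lemma Clog_RtoC c : (0 < c)%R -> Clog (RtoC c) = RtoC (ln c).
Proof.
  intros Hc. unfold Clog, Carg. rewrite Cmod_R, Rabs_pos_eq by lra. simpl.
  destruct (Rle_dec 0 0) as [_ | H]; [| lra]. replace (c / c)%R with 1%R by (field; lra). rewrite acos_1. reflexivity.
Qed.

Lemma Cpower_scale c (z a : C) : (0 < c)%R -> z <> 0 -> Cpower (RtoC c * z) a = Cpower (RtoC c) a * Cpower z a.
Proof.
  intros Hc Hz. rewrite !Cpower_nonzero; auto.
  - rewrite Clog_scale, Clog_RtoC by auto. rewrite <- Cexp_plus. f_equal. ring.
  - apply RtoC_neq_0; lra.
  - apply Cmult_neq_0; auto. apply RtoC_neq_0; lra.
Qed.

Lemma Cpower_pos c a : (0 < c)%R -> Cpower (RtoC c) a = Cexp (a * RtoC (ln c)).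
Proof. intros Hc. rewrite Cpower_nonzero by (apply RtoC_neq_0; lra). rewrite Clog_RtoC; auto. Qed.

Lemma Cis_series_components a l :
  Cis_series a l <-> is_series (fun n => Re (a n)) (Re l) /\ is_series (fun n => Im (a n)) (Im l).
Proof.
  assert (S1 : forall n, Re (@sum_n C_NormedModule a n) = sum_n (fun k => Re (a k)) n).
  { induction n; [rewrite !sum_O; reflexivity |]. rewrite !sum_Sn, <- IHn. reflexivity. }
  assert (S2 : forall n, Im (@sum_n C_NormedModule a n) = sum_n (fun k => Im (a k)) n).
  { induction n; [rewrite !sum_O; reflexivity |]. rewrite !sum_Sn, <- IHn. reflexivity. }
  unfold is_series.
  change (filterlim (sum_n a) eventually (locally l)) with (Cconv eventually (@sum_n C_NormedModule a) l).
  rewrite Cconv_components. split; intros [A B]; split.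
  - eapply filterlim_ext; [intros n; apply S1 | exact A].
  - eapply filterlim_ext; [intros n; apply S2 | exact B].
  - eapply filterlim_ext; [intros n; symmetry; apply S1 | exact A].
  - eapply filterlim_ext; [intros n; symmetry; apply S2 | exact B].
Qed.

Lemma im_le_Cmod (z : C) : (Rabs (Im z) <= Cmod z)%R.
Proof. eapply Rle_trans; [| apply (Rmax_Cmod z)]. apply Rmax_r. Qed.

(** The real theorem is applied to the four products of real and imaginary parts, which converge
    absolutely because both parts are dominated by the modulus. *)
Lemma Cauchy_product a b la lb :
  Cis_series a la -> Cis_series b lb ->
  ex_series (fun n => Cmod (a n)) -> ex_series (fun n => Cmod (b n)) ->
  Cis_series (fun n => csum (fun k => a k * b (n - k)%nat) (S n)) (la * lb).
Proof.
  intros Ha Hb Aa Ab.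
  apply Cis_series_components in Ha; destruct Ha as [Ha1 Ha2].
  apply Cis_series_components in Hb; destruct Hb as [Hb1 Hb2].
  assert (AR : forall u : nat -> C, ex_series (fun n => Cmod (u n)) -> ex_series (fun n => Rabs (Re (u n)))).
  { intros u. apply (ex_series_le (V := R_CompleteNormedModule)). intros n.
    change (norm (Rabs (Re (u n)))) with (Rabs (Rabs (Re (u n)))). rewrite Rabs_Rabsolu. apply re_le_Cmod. }
  assert (AI : forall u : nat -> C, ex_series (fun n => Cmod (u n)) -> ex_series (fun n => Rabs (Im (u n)))).
  { intros u. apply (ex_series_le (V := R_CompleteNormedModule)). intros n.
    change (norm (Rabs (Im (u n)))) with (Rabs (Rabs (Im (u n)))). rewrite Rabs_Rabsolu. apply im_le_Cmod. }
  pose proof (is_series_mult _ _ _ _ Ha1 Hb1 (AR _ Aa) (AR _ Ab)) as P11.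
  pose proof (is_series_mult _ _ _ _ Ha1 Hb2 (AR _ Aa) (AI _ Ab)) as P12.
  pose proof (is_series_mult _ _ _ _ Ha2 Hb1 (AI _ Aa) (AR _ Ab)) as P21.
  pose proof (is_series_mult _ _ _ _ Ha2 Hb2 (AI _ Aa) (AI _ Ab)) as P22.
  assert (ER : forall (f g : nat -> C) n, Re (csum (fun k => f k * g k) (S n)) =
     (sum_f_R0 (fun k => Re (f k) * Re (g k)) n - sum_f_R0 (fun k => Im (f k) * Im (g k)) n)%R).
  { intros f g. induction n.
    - simpl csum. rewrite re_plus, re_mult. simpl. ring.
    - change (csum (fun k => f k * g k) (S (S n))) with (csum (fun k => f k * g k) (S n) + f (S n) * g (S n)).
      rewrite re_plus, re_mult, IHn. simpl. ring. }
  assert (EI : forall (f g : nat -> C) n, Im (csum (fun k => f k * g k) (S n)) =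
     (sum_f_R0 (fun k => Re (f k) * Im (g k)) n + sum_f_R0 (fun k => Im (f k) * Re (g k)) n)%R).
  { intros f g. induction n.
    - simpl csum. rewrite im_plus, im_mult. simpl. ring.
    - change (csum (fun k => f k * g k) (S (S n))) with (csum (fun k => f k * g k) (S n) + f (S n) * g (S n)).
      rewrite im_plus, im_mult, IHn. simpl. ring. }
  apply Cis_series_components. split.
  - rewrite re_mult. eapply is_series_ext; [| apply (is_series_minus (V := R_NormedModule) _ _ _ _ P11 P22)].
    intros n. symmetry. exact (ER a (fun k => b (n - k)%nat) n).
  - rewrite im_mult. eapply is_series_ext; [| apply (is_series_plus (V := R_NormedModule) _ _ _ _ P12 P21)].
    intros n. symmetry. exact (EI a (fun k => b (n - k)%nat) n).
Qed.

(** The ratio test in multiplied form: terms containing 1 / Gamma may be zero, so quotients of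
    consecutive terms need not exist. *)
Lemma ex_series_ratio_half (u : nat -> R) (N : nat) :
  (forall n, 0 <= u n)%R -> (forall n, (N <= n)%nat -> u (S n) <= / 2 * u n)%R -> ex_series u.
Proof.
  intros H0 H1. apply (ex_series_incr_n u N).
  apply (ex_series_le (V := R_CompleteNormedModule) _ (fun k => u N * (/ 2) ^ k)%R).
  - intros k. change (norm (u (N + k)%nat)) with (Rabs (u (N + k)%nat)). rewrite Rabs_pos_eq by apply H0.
    induction k.
    + rewrite Nat.add_0_r. simpl; lra.
    + rewrite Nat.add_succ_r. eapply Rle_trans; [apply H1; lia |]. simpl. lra.
  - apply (ex_series_scal (V := R_NormedModule) (u N)). apply ex_series_geom. rewrite Rabs_pos_eq; lra.
Qed.

(** * The reciprocal Gamma function *)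

Lemma ln_one_minus_bound x : (0 < x <= / 2)%R -> (- x - 2 * x ^ 2 <= ln (1 - x) <= - x)%R.
Proof.
  intros Hx. split.
  - assert (E : (ln (1 - x) = - ln (1 + x / (1 - x)))%R).
    { rewrite <- ln_Rinv.
      - f_equal. field. split; lra.
      - assert (0 < x / (1 - x))%R by (apply Rdiv_lt_0_compat; lra). lra. }
    assert (L : (ln (1 + x / (1 - x)) <= x / (1 - x))%R).
    { assert (P : (0 < x / (1 - x))%R) by (apply Rdiv_lt_0_compat; lra).
      rewrite <- (ln_exp (x / (1 - x))) at 2. apply ln_le; [lra |]. left; apply exp_ineq1. lra. }
    assert (Q : (x / (1 - x) <= x + 2 * x ^ 2)%R).
    { apply Rmult_le_reg_r with (1 - x)%R; [lra |]. field_simplify; [nra | lra]. }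
    lra.
  - rewrite <- (ln_exp (- x)). apply ln_le; [lra |].
    left. replace (1 - x)%R with (1 + - x)%R by ring. apply exp_ineq1. lra.
Qed.

(** For x = 1 / (n + 1) the product (1 + z x) (1 - x)^z is the quotient of consecutive terms of
    Gauss's sequence. The first-order terms z x and - z x cancel, which leaves a summable error
    O(x^2). *)
Lemma gauss_ratio_bound (z : C) : exists K : R, (0 <= K)%R /\ forall x, (0 < x <= / 2)%R ->
  (Cmod ((1 + z * RtoC x) * Cexp (z * RtoC (ln (1 - x))) - 1) <= K * x ^ 2)%R.
Proof.
  set (m := Cmod z). assert (Hm : (0 <= m)%R) by apply Cmod_ge_0.
  exists (m ^ 2 + (1 + m) * (2 * m + 2 * exp m * m ^ 2))%R. split.
  { pose proof (exp_pos m). assert (0 <= exp m * m ^ 2)%R by (apply Rmult_le_pos; [lra | apply pow2_ge_0]). nra. }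
  intros x Hx. pose proof (ln_one_minus_bound x Hx) as L.
  set (q := (ln (1 - x) + x)%R). set (w := z * RtoC (ln (1 - x))).
  assert (Hq : (Rabs q <= 2 * x ^ 2)%R) by (unfold q; apply Rabs_le; nra).
  assert (Hw : (Cmod w <= m * (2 * x))%R).
  { unfold w. rewrite Cmod_mult, Cmod_R. apply Rmult_le_compat_l; auto. apply Rabs_le; nra. }
  assert (Hw1 : (Cmod w <= m)%R) by nra.
  set (r := Cexp w - exp_sum w 2).
  assert (Hr : (Cmod r <= exp m * (m ^ 2 * (2 * x ^ 2)))%R).
  { unfold r. eapply Rle_trans; [apply Cexp_taylor |].
    replace (INR (fact 2)) with 2%R by (simpl; ring).
    assert (E : (exp (Cmod w) <= exp m)%R).
    { destruct (Req_dec (Cmod w) m) as [-> | N]; [lra | left; apply exp_increasing; lra]. }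
    assert (S : (Cmod w ^ 2 <= (m * (2 * x)) ^ 2)%R) by (apply pow_incr; split; auto; apply Cmod_ge_0).
    pose proof (exp_pos (Cmod w)). pose proof (pow2_ge_0 (Cmod w)).
    unfold Rdiv. rewrite Rmult_assoc. apply Rmult_le_compat; nra. }
  (* With w = z (q - x) and e^w = 1 + w + r, expanding isolates - z^2 x^2 from the two quadratically
     small errors z q and r. *)
  assert (E : (1 + z * RtoC x) * Cexp w - 1 = - (z * z * RtoC (x ^ 2)) + (1 + z * RtoC x) * (z * RtoC q + r)).
  { unfold r, exp_sum, q, w. simpl csum. simpl fact. rewrite RtoC_plus, RtoC_pow. simpl INR. field. }
  rewrite E. eapply Rle_trans; [apply Cmod_triangle |].
  rewrite Cmod_opp, !Cmod_mult, Cmod_R. fold m.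
  assert (B1 : (Cmod (1 + z * RtoC x) <= 1 + m)%R).
  { eapply Rle_trans; [apply Cmod_triangle |]. rewrite Cmod_1, Cmod_mult, Cmod_R, Rabs_pos_eq by lra. fold m. nra. }
  assert (B2 : (Cmod (z * RtoC q + r) <= m * (2 * x ^ 2) + exp m * (m ^ 2 * (2 * x ^ 2)))%R).
  { eapply Rle_trans; [apply Cmod_triangle |]. rewrite Cmod_mult, Cmod_R. fold m.
    apply Rplus_le_compat; auto. apply Rmult_le_compat_l; auto. }
  assert (B3 : (Cmod (1 + z * RtoC x) * Cmod (z * RtoC q + r) <= (1 + m) * (m * (2 * x ^ 2) + exp m * (m ^ 2 * (2 * x ^ 2))))%R).
  { apply Rmult_le_compat; auto; apply Cmod_ge_0. }
  rewrite Rabs_pos_eq by apply pow2_ge_0. nra.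
Qed.

Lemma Cconv_near (u : nat -> C) (l : C) (eps : R) : (0 < eps)%R ->
  Cconv eventually u l -> exists N, forall n, (N <= n)%nat -> (Cmod (u n - l) < eps)%R.
Proof.
  intros He H. apply Cconv_Cmod in H.
  destruct (proj1 (filterlim_locally _ _) H (mkposreal eps He)) as [N HN].
  exists N. intros n Hn. specialize (HN n Hn). 
  change (Rabs (Cmod (u n - l) - 0) < eps)%R in HN. rewrite Rminus_0_r, Rabs_pos_eq in HN; auto. apply Cmod_ge_0.
Qed.

(* Since 1/n - 1/(n+1) telescopes, u stays within |u N| / 2 of u N once K / N <= 1/4;
   this gives both convergence and a nonzero limit. *)
Lemma small_ratio_converges (u : nat -> C) (K : R) : (0 <= K)%R ->
  (forall n, (1 <= n)%nat -> Cmod (u (S n) - u n) <= K * (/ INR n - / INR (S n)) * Cmod (u n))%R ->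
  exists l : C, Cconv eventually u l /\ ((forall n, (1 <= n)%nat -> u n <> RtoC 0) -> l <> RtoC 0).
Proof.
  intros HK Hu.
  assert (Hpos : forall n, (1 <= n)%nat -> (0 < INR n)%R) by (intros n Hn; apply lt_0_INR; lia).
  assert (Hdec : forall n, (1 <= n)%nat -> (0 <= / INR n - / INR (S n))%R).
  { intros n Hn. pose proof (Hpos n Hn). apply Rge_le, Rge_minus, Rle_ge, Rinv_le_contravar; auto.
    apply le_INR; lia. }
  destruct (nfloor_ex (4 * K) ltac:(lra)) as [N0 [_ HN0]].
  set (N := S N0). assert (HN : (K * / INR N <= / 4)%R).
  { assert (INR N = INR N0 + 1)%R by (unfold N; apply S_INR). pose proof (Hpos N ltac:(unfold N; lia)).
    apply Rmult_le_reg_r with (INR N); auto. field_simplify; lra. }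
  set (B := Cmod (u N)). assert (HB : (0 <= B)%R) by apply Cmod_ge_0.
  assert (HNj : forall j, (0 < / INR (N + j))%R).
  { intros j. apply Rinv_0_lt_compat, Hpos. unfold N; lia. }
  assert (HBK : forall j, (0 <= B * K * / INR (N + j))%R).
  { intros j. pose proof (HNj j). apply Rmult_le_pos; nra. }
  assert (Hb : forall j, (Cmod (u (N + j)%nat - u N) <= 2 * B * K * (/ INR N - / INR (N + j)))%R).
  { induction j.
    - rewrite Nat.add_0_r. replace (u N - u N) with (RtoC 0) by ring. rewrite Cmod_0. lra.
    - rewrite Nat.add_succ_r.
      replace (u (S (N + j)) - u N) with ((u (S (N + j)) - u (N + j)%nat) + (u (N + j)%nat - u N)) by ring.
      eapply Rle_trans; [apply Cmod_triangle |].
      pose proof (Hu (N + j)%nat ltac:(unfold N; lia)) as H1.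
      assert (H2 : (Cmod (u (N + j)%nat) <= 2 * B)%R).
      { replace (u (N + j)%nat) with ((u (N + j)%nat - u N) + u N) by ring.
        eapply Rle_trans; [apply Cmod_triangle |]. fold B. pose proof (HNj j). pose proof (HBK j). nra. }
      pose proof (Hdec (N + j)%nat ltac:(unfold N; lia)) as H3.
      assert (H4 : (K * (/ INR (N + j) - / INR (S (N + j))) * Cmod (u (N + j)%nat) <= K * (/ INR (N + j) - / INR (S (N + j))) * (2 * B))%R).
      { apply Rmult_le_compat_l; auto. apply Rmult_le_pos; auto. }
      nra. }
  assert (Hhalf : forall j, (Cmod (u (N + j)%nat - u N) <= / 2 * B)%R).
  { intros j. pose proof (Hb j). pose proof (HBK j). nra. }
  assert (Hstep : forall m j, (N <= m)%nat -> (Cmod (u (m + j)%nat - u m) <= 2 * B * K * (/ INR m - / INR (m + j)))%R).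
  { intros m j Hm. induction j.
    - rewrite Nat.add_0_r. replace (u m - u m) with (RtoC 0) by ring. rewrite Cmod_0. lra.
    - rewrite Nat.add_succ_r.
      replace (u (S (m + j)) - u m) with ((u (S (m + j)) - u (m + j)%nat) + (u (m + j)%nat - u m)) by ring.
      eapply Rle_trans; [apply Cmod_triangle |].
      pose proof (Hu (m + j)%nat ltac:(unfold N in *; lia)) as H1.
      assert (H2 : (Cmod (u (m + j)%nat) <= 2 * B)%R).
      { replace (m + j)%nat with (N + (m + j - N))%nat by lia. set (p := (m + j - N)%nat).
        replace (u (N + p)%nat) with ((u (N + p)%nat - u N) + u N) by ring.
        eapply Rle_trans; [apply Cmod_triangle |]. fold B. pose proof (Hhalf p). lra. }
      pose proof (Hdec (m + j)%nat ltac:(unfold N in *; lia)) as H3.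
      assert (H4 : (K * (/ INR (m + j) - / INR (S (m + j))) * Cmod (u (m + j)%nat) <= K * (/ INR (m + j) - / INR (S (m + j))) * (2 * B))%R).
      { apply Rmult_le_compat_l; auto. apply Rmult_le_pos; auto. }
      nra. }
  assert (Hex : exists l : C, Cconv eventually u l).
  { apply (filterlim_locally_cauchy (U := C_R_CompleteNormedModule) (F := eventually) u).
    intros eps.
    destruct (nfloor_ex (4 * (B * K) / eps) ltac:(apply Rdiv_le_0_compat; [nra | apply cond_pos])) as [M [_ HM]].
    set (m := (N + S M)%nat).
    assert (Hm : (2 * B * K * / INR m < eps / 2)%R).
    { pose proof (Hpos m ltac:(unfold m; lia)) as P. pose proof (cond_pos eps) as Pe.
      assert (INR M + 1 <= INR m)%R by (rewrite <- S_INR; apply le_INR; unfold m; lia).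
      apply Rmult_lt_reg_r with (INR m); auto.
      assert (4 * (B * K) < eps * INR m)%R.
      { apply Rmult_lt_reg_r with (/ eps)%R; [apply Rinv_0_lt_compat; auto |].
        replace (eps * INR m * / eps)%R with (INR m) by (field; lra). unfold Rdiv in HM. lra. }
      replace (2 * B * K * / INR m * INR m)%R with (2 * (B * K))%R by (field; lra). lra. }
    assert (Hc : forall n, (m <= n)%nat -> (Cmod (u n - u m) < eps / 2)%R).
    { intros n Hn. replace n with (m + (n - m))%nat by lia. set (p := (n - m)%nat).
      pose proof (Hstep m p ltac:(unfold m; lia)).
      assert (0 < / INR (m + p))%R by (apply Rinv_0_lt_compat, Hpos; unfold m; lia). 
      assert (0 <= B * K * / INR (m + p))%R by (apply Rmult_le_pos; nra). nra. }
    exists (fun n => (m <= n)%nat). split; [exists m; auto |].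
    intros n p Hn Hp. apply C_NormedModule_mixin_compat1.
    change (Cmod (u p - u n) < eps)%R. replace (u p - u n) with ((u p - u m) + - (u n - u m)) by ring.
    eapply Rle_lt_trans; [apply Cmod_triangle |]. rewrite Cmod_opp. pose proof (Hc n Hn). pose proof (Hc p Hp). lra. }
  destruct Hex as [l Hl]. exists l. split; auto. intros Hnz ->.
  assert (HB0 : (0 < B)%R) by (apply Cmod_gt_0, Hnz; unfold N; lia).
  destruct (Cconv_near u 0 (B / 4) ltac:(lra) Hl) as [M HM].
  specialize (HM (N + M)%nat ltac:(lia)). pose proof (Hhalf M) as H1.
  replace (u (N + M)%nat - 0) with (u (N + M)%nat) in HM by ring.
  assert (B <= Cmod (u (N + M)%nat) + Cmod (u (N + M)%nat - u N))%R; [| lra].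
  unfold B. replace (u N) with (u (N + M)%nat + - (u (N + M)%nat - u N)) by ring.
  eapply Rle_trans; [apply Cmod_triangle |]. rewrite Cmod_opp.
  replace (u (N + M)%nat + - (u (N + M)%nat - u N)) with (u N) by ring. lra.
Qed.

Lemma rising_shift z n : rising z (S n) = z * rising (z + 1) n.
Proof.
  induction n.
  - simpl. ring.
  - change (rising z (S (S n))) with (rising z (S n) * (z + RtoC (INR (S n)))).
    rewrite IHn, S_INR, RtoC_plus. simpl. ring.
Qed.

Lemma rising_add z n m : rising z (n + m) = rising z n * rising (z + RtoC (INR n)) m.
Proof.
  induction m.
  - rewrite Nat.add_0_r. simpl. ring.
  - rewrite Nat.add_succ_r. simpl. rewrite IHm, plus_INR, RtoC_plus. ring.
Qed.

Lemma rising_neq_0 (z : C) n : (forall k : nat, z + RtoC (INR k) <> RtoC 0) -> rising z n <> RtoC 0.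
Proof. intros H. induction n; simpl; [apply C1_nz | apply Cmult_neq_0; auto]. Qed.

Lemma rising_1 n : rising 1 n = RtoC (INR (fact n)).
Proof.
  induction n; [reflexivity |]. change (rising 1 (S n)) with (rising 1 n * (1 + RtoC (INR n))).
  rewrite IHn, fact_S_C, S_INR, RtoC_plus. ring.
Qed.

(* The sequence whose limit is rGamma; gauss z 0 is a junk value. *)
Definition gauss (z : C) (n : nat) : C :=
  rising z (S n) / (RtoC (INR (fact n)) * Cpower (RtoC (INR n)) z).

Lemma INR_C_neq_0 n : (1 <= n)%nat -> RtoC (INR n) <> RtoC 0.
Proof. intros H. apply RtoC_neq_0, not_0_INR. lia. Qed.

Lemma Cpower_INR_base n z : (1 <= n)%nat -> Cpower (RtoC (INR n)) z = Cexp (z * RtoC (ln (INR n))).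
Proof. intros H. apply Cpower_pos, lt_0_INR. lia. Qed.

Lemma gauss_eq z n : (1 <= n)%nat ->
  gauss z n = rising z (S n) * / RtoC (INR (fact n)) * Cexp (- (z * RtoC (ln (INR n)))).
Proof.
  intros H. unfold gauss. rewrite Cpower_INR_base, Cexp_opp by auto.
  pose proof (INR_fact_C_neq_0 n). pose proof (Cexp_neq_0 (z * RtoC (ln (INR n)))). field. auto.
Qed.

Lemma gauss_succ z n : (1 <= n)%nat ->
  gauss z (S n) = gauss z n * ((1 + z * RtoC (/ INR (S n))) * Cexp (z * RtoC (ln (1 - / INR (S n))))).
Proof.
  intros H. rewrite !gauss_eq by lia.
  assert (P : (0 < INR n)%R) by (apply lt_0_INR; lia). pose proof (S_INR n) as ES.
  replace (1 - / INR (S n))%R with (INR n * / INR (S n))%R by (rewrite ES; field; lra).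
  rewrite ln_mult, ln_Rinv by (try apply Rinv_0_lt_compat; lra).
  rewrite fact_S_C. change (rising z (S (S n))) with (rising z (S n) * (z + RtoC (INR (S n)))).
  replace (- (z * RtoC (ln (INR (S n))))) with (- (z * RtoC (ln (INR n))) + z * RtoC (ln (INR n) + - ln (INR (S n)))).
  2: { rewrite RtoC_plus, RtoC_opp. ring. }
  rewrite Cexp_plus, RtoC_inv by lra.
  pose proof (INR_fact_C_neq_0 n). pose proof (INR_S_C_neq_0 n). field. auto.
Qed.

Lemma gauss_limit (z : C) : exists l : C, Cconv eventually (gauss z) l /\
  ((forall k : nat, z + RtoC (INR k) <> RtoC 0) -> l <> RtoC 0).
Proof.
  destruct (gauss_ratio_bound z) as [K [HK HB]].
  destruct (small_ratio_converges (gauss z) K HK) as [l [H1 H2]].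
  - intros n Hn. rewrite gauss_succ by auto.
    set (q := (1 + z * RtoC (/ INR (S n))) * Cexp (z * RtoC (ln (1 - / INR (S n))))).
    replace (gauss z n * q - gauss z n) with ((q - 1) * gauss z n) by ring.
    rewrite Cmod_mult. apply Rmult_le_compat_r; [apply Cmod_ge_0 |].
    assert (P : (1 <= INR n)%R) by (apply (le_INR 1); lia). pose proof (S_INR n) as ES.
    eapply Rle_trans; [apply HB |].
    + split; [apply Rinv_0_lt_compat; lra | apply Rinv_le_contravar; lra].
    + apply Rmult_le_compat_l; auto. rewrite ES.
      replace (/ INR n - / (INR n + 1))%R with (/ (INR n * (INR n + 1)))%R by (field; lra).
      replace ((/ (INR n + 1)) ^ 2)%R with (/ ((INR n + 1) * (INR n + 1)))%R by (field; lra).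
      apply Rinv_le_contravar; nra.
  - exists l. split; auto. intros Hz. apply H2. intros n Hn. rewrite gauss_eq by auto.
    apply Cmult_neq_0; [apply Cmult_neq_0 | apply Cexp_neq_0].
    + apply rising_neq_0; auto.
    + intros E. apply C1_nz. rewrite <- (Cinv_r _ (INR_fact_C_neq_0 n)), E. ring.
Qed.

Lemma rGamma_limit (z : C) : Cconv eventually (gauss z) (rGamma z).
Proof.
  destruct (gauss_limit z) as [l [H _]]. replace (rGamma z) with l; auto.
  symmetry. apply CLim_seq_unique. exact H.
Qed.

(** Needed where Gamma itself is inverted: in [Gamma_ratio], and when 1 / Gamma(2 s) is cancelled to
    find the constant of the cosine integrals. *)
Lemma rGamma_neq_0 (z : C) : (forall k : nat, z + RtoC (INR k) <> RtoC 0) -> rGamma z <> RtoC 0.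
Proof.
  intros Hz. destruct (gauss_limit z) as [l [H1 H2]].
  rewrite (Cconv_unique _ _ _ (rGamma_limit z) H1). auto.
Qed.

Lemma is_lim_seq_inv_INR : is_lim_seq (fun n => / INR n)%R 0%R.
Proof.
  replace (Finite 0) with (Rbar_inv p_infty) by reflexivity.
  apply is_lim_seq_inv; [apply is_lim_seq_INR | discriminate].
Qed.

(** At level n the two sides of Gauss's sequence differ by the factor (z + 1 + n) / n, which tends
    to 1. *)
Lemma rGamma_rec z : rGamma z = z * rGamma (z + 1).
Proof.
  apply (Cconv_unique (F := eventually) (fun n => gauss z n * (1 + (z + 1) * RtoC (/ INR n)))).
  - replace (rGamma z) with (rGamma z * (1 + (z + 1) * RtoC 0)) by ring.
    apply Cconv_mult; [apply rGamma_limit |]. apply Cconv_plus; [apply Cconv_const |].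
    apply Cconv_scal, Cconv_RtoC, is_lim_seq_inv_INR.
  - eapply Cconv_ext_loc; [| apply (Cconv_scal (gauss (z + 1)) z), rGamma_limit].
    exists 1%nat. intros n Hn. rewrite !gauss_eq by auto.
    assert (P : (0 < INR n)%R) by (apply lt_0_INR; lia).
    replace (- ((z + 1) * RtoC (ln (INR n)))) with (- (z * RtoC (ln (INR n))) + - RtoC (ln (INR n))) by ring.
    rewrite Cexp_plus, <- RtoC_opp, Cexp_RtoC, exp_Ropp, exp_ln by auto.
    rewrite (rising_shift z n). change (rising (z + 1) (S n)) with (rising (z + 1) n * (z + 1 + RtoC (INR n))).
    rewrite RtoC_inv by lra. pose proof (INR_C_neq_0 n Hn). pose proof (INR_fact_C_neq_0 n). field. auto.
Qed.

Lemma rGamma_1 : rGamma 1 = 1.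
Proof.
  apply (Cconv_unique (F := eventually) (gauss 1)); [apply rGamma_limit |].
  eapply Cconv_ext_loc.
  2: { replace (RtoC 1) with (1 + RtoC 0) by ring. apply Cconv_plus; [apply Cconv_const |].
       apply Cconv_RtoC, is_lim_seq_inv_INR. }
  exists 1%nat. intros n Hn. simpl. rewrite gauss_eq by auto.
  assert (P : (0 < INR n)%R) by (apply lt_0_INR; lia).
  rewrite rising_1, fact_S_C, Cmult_1_l, <- RtoC_opp, Cexp_RtoC, exp_Ropp, exp_ln by auto.
  rewrite S_INR, RtoC_plus, RtoC_inv by lra. pose proof (INR_C_neq_0 n Hn). pose proof (INR_fact_C_neq_0 n). field. auto.
Qed.

Lemma rGamma_nat n : rGamma (RtoC (INR (S n))) = / RtoC (INR (fact n)).
Proof.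
  induction n.
  - simpl. rewrite rGamma_1. field.
  - rewrite rGamma_rec in IHn. pose proof (INR_S_C_neq_0 n) as H. pose proof (INR_fact_C_neq_0 n) as H'.
    rewrite (S_INR (S n)), RtoC_plus. rewrite fact_S_C.
    set (G := rGamma (RtoC (INR (S n)) + 1)) in *.
    replace G with (/ RtoC (INR (S n)) * (RtoC (INR (S n)) * G)) by (field; auto).
    rewrite IHn. field. auto.
Qed.

(** * Wallis' product and the duplication formula *)

(** The recurrence and the monotonicity of these integrals take the place of Stirling's formula in
    evaluating the constant of the duplication formula. *)
Definition wallis (k : nat) : R := RInt (fun t => sin t ^ k)%R 0 (PI / 2).

Lemma ex_RInt_sin_pow k a b : ex_RInt (fun t => sin t ^ k)%R a b.
Proof.
  apply (ex_RInt_continuous (V := R_CompleteNormedModule)). intros t _.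
  apply (ex_derive_continuous (V := R_NormedModule)). auto_derive; auto.
Qed.

Lemma wallis_0 : wallis 0 = (PI / 2)%R.
Proof. unfold wallis. simpl. rewrite RInt_const. unfold scal; simpl; unfold mult; simpl. ring. Qed.

Lemma wallis_1 : wallis 1 = 1%R.
Proof.
  unfold wallis. apply is_RInt_unique.
  replace 1%R with (minus (- cos (PI / 2)) (- cos 0))%R.
  2: { unfold minus, plus, opp; simpl. rewrite cos_PI2, cos_0. ring. }
  apply (is_RInt_derive (fun t => - cos t)%R).
  - intros t _. auto_derive; auto. ring.
  - intros t _. apply (ex_derive_continuous (V := R_NormedModule)). auto_derive; auto.
Qed.

(** Integrate the derivative of - cos t (sin t)^(k + 1), which vanishes at both end points. *)
Lemma wallis_rec k : (INR (k + 2) * wallis (k + 2) = INR (k + 1) * wallis k)%R.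
Proof.
  assert (H : is_RInt (fun t => INR (k + 2) * sin t ^ (k + 2) - INR (k + 1) * sin t ^ k)%R 0 (PI / 2)
     (minus (- cos (PI / 2) * sin (PI / 2) ^ (k + 1)) (- cos 0 * sin 0 ^ (k + 1)))%R).
  { apply (is_RInt_derive (fun t => - cos t * sin t ^ (k + 1))%R).
    - intros t _. auto_derive; auto.
      replace (pred (k + 1)) with k by lia. pose proof (sin2_cos2 t) as E. unfold Rsqr in E.
      replace (k + 2)%nat with (S (S k)) by lia. replace (k + 1)%nat with (S k) by lia.
      rewrite (S_INR (S k)). simpl pow. 
      set (c := cos t) in *. set (s := sin t) in *. assert (E2 : (c * c = 1 - s * s)%R) by lra.
      transitivity (s * (s * s ^ k) - INR (S k) * s ^ k * (c * c))%R; [ring | rewrite E2; ring].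
    - intros t _. apply (ex_derive_continuous (V := R_NormedModule)). auto_derive; auto. }
  rewrite cos_PI2, sin_0, pow_i in H by lia.
  apply (is_RInt_unique (V := R_CompleteNormedModule)) in H.
  rewrite (RInt_minus (V := R_CompleteNormedModule) (fun t => INR (k + 2) * sin t ^ (k + 2))%R (fun t => INR (k + 1) * sin t ^ k)%R) in H.
  - rewrite (RInt_scal (V := R_CompleteNormedModule) (fun t => sin t ^ (k + 2))%R) in H by apply ex_RInt_sin_pow.
    rewrite (RInt_scal (V := R_CompleteNormedModule) (fun t => sin t ^ k)%R) in H by apply ex_RInt_sin_pow.
    fold (wallis (k + 2)) in H. fold (wallis k) in H.
    unfold minus, plus, opp, scal, mult in H; simpl in H. unfold mult in H; simpl in H. lra.
  - apply (ex_RInt_scal (V := R_NormedModule)), ex_RInt_sin_pow.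
  - apply (ex_RInt_scal (V := R_NormedModule)), ex_RInt_sin_pow.
Qed.

Lemma wallis_decr k : (wallis (S k) <= wallis k)%R.
Proof.
  apply RInt_le; try apply ex_RInt_sin_pow.
  - pose proof PI_RGT_0; lra.
  - intros t Ht. simpl. pose proof (SIN_bound t). assert (0 <= sin t)%R by (apply sin_ge_0; lra).
    pose proof (pow_le (sin t) k H0). nra.
Qed.

Lemma wallis_prod k : (INR (k + 1) * wallis (S k) * wallis k = PI / 2)%R.
Proof.
  induction k.
  - rewrite wallis_0, wallis_1. simpl. ring.
  - pose proof (wallis_rec k) as H. replace (k + 2)%nat with (S (S k)) in H by lia.
    replace (S k + 1)%nat with (S (S k)) by lia. rewrite H. lra.
Qed.

Lemma wallis_odd n : (wallis (2 * n + 1) * INR (fact (2 * n + 1)) = (2 ^ n * INR (fact n)) ^ 2)%R.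
Proof.
  induction n.
  - simpl. rewrite wallis_1. ring.
  - replace (2 * S n + 1)%nat with (S (S (2 * n + 1))) by lia.
    pose proof (wallis_rec (2 * n + 1)) as H.
    replace (2 * n + 1 + 2)%nat with (S (S (2 * n + 1))) in H by lia.
    replace (2 * n + 1 + 1)%nat with (S (2 * n + 1)) in H by lia.
    rewrite (fact_simpl (S (2 * n + 1))), (fact_simpl (2 * n + 1)), (fact_simpl n), !mult_INR.
    assert (E : INR (S (2 * n + 1)) = (2 * INR (S n))%R).
    { replace (S (2 * n + 1)) with (2 * S n)%nat by lia. rewrite mult_INR. reflexivity. }
    transitivity (INR (S (S (2 * n + 1))) * wallis (S (S (2 * n + 1))) * (INR (S (2 * n + 1)) * INR (fact (2 * n + 1))))%R; [ring |].
    rewrite H. transitivity (INR (S (2 * n + 1)) ^ 2 * (wallis (2 * n + 1) * INR (fact (2 * n + 1))))%R; [ring |].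
    rewrite IHn, E. simpl. ring.
Qed.

(** The quotient of [gauss x n * gauss (x + 1 / 2) n] by [gauss (2 * x) (2 * n + 1)] is this number
    times (2 + 1/n)^(2 x); only the latter factor depends on x. *)
Definition dup_const (n : nat) : R :=
  (INR (fact (2 * n + 1)) / (4 ^ (n + 1) * INR (fact n) ^ 2 * sqrt (INR n)))%R.

(** With W = [wallis (2 * n + 1)] one has 16 n W^2 [dup_const n]^2 = 1. As the integrals decrease
    and (k + 1) W_k W_(k+1) = PI / 2, W^2 lies between PI / 2 divided by 2 n + 2 and by 2 n + 1.
    Squaring removes sqrt n. *)
Lemma dup_const_sqr n : (1 <= n)%nat ->
  (/ (4 * PI) * (1 + / 2 * / INR n) <= dup_const n ^ 2 <= / (4 * PI) * (1 + / INR n))%R.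
Proof.
  intros Hn. pose proof (wallis_odd n) as W. pose proof PI_RGT_0 as Hpi.
  assert (P : (1 <= INR n)%R) by (apply (le_INR 1); lia).
  assert (Hf : (0 < INR (fact n))%R) by apply INR_fact_lt_0.
  assert (Hg : (0 < INR (fact (2 * n + 1)))%R) by apply INR_fact_lt_0.
  set (w := wallis (2 * n + 1)) in *. 
  assert (H2n : (0 < 2 ^ n)%R) by (apply pow_lt; lra).
  assert (Hw : (0 < w)%R).
  { apply Rmult_lt_reg_r with (INR (fact (2 * n + 1))); auto. rewrite W, Rmult_0_l. apply pow_lt. nra. }
  assert (D : (dup_const n ^ 2 = / (16 * INR n * w ^ 2))%R).
  { unfold dup_const.
    replace (INR (fact (2 * n + 1))) with ((2 ^ n * INR (fact n)) ^ 2 / w)%R by (rewrite <- W; field; lra).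
    assert (Q : (4 ^ (n + 1) = 4 * (2 ^ n) ^ 2)%R).
    { rewrite pow_add, <- pow_mult, Nat.mul_comm, pow_mult. replace (2 ^ 2)%R with 4%R by ring. ring. }
    rewrite Q. rewrite <- (sqrt_sqrt (INR n)) at 2 by lra.
    assert (0 < sqrt (INR n))%R by (apply sqrt_lt_R0; lra).
    field. repeat split; lra. }
  assert (U : (w ^ 2 * INR (2 * n + 1) <= PI / 2)%R).
  { pose proof (wallis_prod (2 * n)) as E. pose proof (wallis_decr (2 * n)) as L.
    replace (S (2 * n)) with (2 * n + 1)%nat in * by lia. fold w in E, L.
    rewrite <- E. pose proof (pos_INR (2 * n + 1)). assert (0 <= INR (2 * n + 1) * w)%R by (apply Rmult_le_pos; lra). replace (w ^ 2)%R with (w * w)%R by ring. nra. }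
  assert (L : (PI / 2 <= w ^ 2 * INR (2 * n + 2))%R).
  { pose proof (wallis_prod (2 * n + 1)) as E. pose proof (wallis_decr (2 * n + 1)) as L.
    replace (2 * n + 1 + 1)%nat with (2 * n + 2)%nat in * by lia. fold w in E, L.
    rewrite <- E. pose proof (pos_INR (2 * n + 2)). assert (0 <= INR (2 * n + 2) * w)%R by (apply Rmult_le_pos; lra). replace (w ^ 2)%R with (w * w)%R by ring. nra. }
  rewrite plus_INR, mult_INR in U, L. simpl INR in U, L.
  rewrite D. assert (0 < w ^ 2)%R by (apply pow_lt; auto). set (v := (w ^ 2)%R) in *.
  split.
  - apply Rmult_le_reg_r with (16 * INR n * v * (4 * PI))%R; [apply Rmult_lt_0_compat; [apply Rmult_lt_0_compat |]; lra |].
    replace (/ (4 * PI) * (1 + / 2 * / INR n) * (16 * INR n * v * (4 * PI)))%R with (8 * (v * (2 * INR n + 1)))%R by (field; lra).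
    replace (/ (16 * INR n * v) * (16 * INR n * v * (4 * PI)))%R with (4 * PI)%R by (field; lra). lra.
  - apply Rmult_le_reg_r with (16 * INR n * v * (4 * PI))%R; [apply Rmult_lt_0_compat; [apply Rmult_lt_0_compat |]; lra |].
    replace (/ (4 * PI) * (1 + / INR n) * (16 * INR n * v * (4 * PI)))%R with (8 * (v * (2 * INR n + 2)))%R by (field; lra).
    replace (/ (16 * INR n * v) * (16 * INR n * v * (4 * PI)))%R with (4 * PI)%R by (field; lra). lra.
Qed.

Lemma dup_const_limit : is_lim_seq dup_const (/ (2 * sqrt PI))%R.
Proof.
  pose proof PI_RGT_0 as Hpi.
  assert (S : is_lim_seq (fun n => dup_const n ^ 2)%R (/ (4 * PI))%R).
  { apply is_lim_seq_le_le_loc with (u := (fun n => / (4 * PI) * (1 + / 2 * / INR n))%R) (w := (fun n => / (4 * PI) * (1 + / INR n))%R).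
    - exists 1%nat. intros n Hn. apply dup_const_sqr; auto.
    - replace (Finite (/ (4 * PI))) with (Rbar_mult (/ (4 * PI))%R (1 + / 2 * 0)%R) by (simpl; f_equal; ring).
      apply is_lim_seq_scal_l. apply is_lim_seq_plus'; [apply is_lim_seq_const |].
      apply (is_lim_seq_scal_l _ (/ 2)%R 0%R), is_lim_seq_inv_INR.
    - replace (Finite (/ (4 * PI))) with (Rbar_mult (/ (4 * PI))%R (1 + 0)%R) by (simpl; f_equal; ring).
      apply is_lim_seq_scal_l. apply is_lim_seq_plus'; [apply is_lim_seq_const |]. apply is_lim_seq_inv_INR. }
  apply (is_lim_seq_continuous sqrt) in S.
  2: { apply continuity_pt_sqrt. left; apply Rinv_0_lt_compat; lra. }
  replace (sqrt (/ (4 * PI))) with (/ (2 * sqrt PI))%R in S.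
  2: { rewrite sqrt_inv, sqrt_mult by lra. f_equal. f_equal. replace 4%R with (2 * 2)%R by ring. rewrite sqrt_square; lra. }
  eapply is_lim_seq_ext_loc; [| exact S]. exists 1%nat. intros n Hn. simpl.
  rewrite Rmult_1_r. apply sqrt_square. unfold dup_const. apply Rlt_le, Rdiv_lt_0_compat; [apply INR_fact_lt_0 |].
  assert (0 < INR n)%R by (apply lt_0_INR; lia).
  apply Rmult_lt_0_compat; [apply Rmult_lt_0_compat; apply pow_lt; [lra | apply INR_fact_lt_0] | apply sqrt_lt_R0; lra].
Qed.

Lemma rising_double x n : rising x n * rising (x + 1 / 2) n * 4 ^ n = rising (2 * x) (2 * n).
Proof.
  induction n; [simpl; ring |].
  replace (2 * S n)%nat with (S (S (2 * n))) by lia.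
  simpl rising. simpl (rising (2 * x) (n + (n + 0))). 
  change (n + (n + 0))%nat with (2 * n)%nat. rewrite <- IHn. rewrite Cpow_S.
  change (match (2 * n)%nat with 0%nat => 1%R | S _ => (INR (2 * n) + 1)%R end) with (INR (S (2 * n))).
  rewrite S_INR, mult_INR, RtoC_plus, RtoC_mult. simpl (INR 2). replace (1 + 1)%R with 2%R by ring. field.
Qed.

Lemma Cexp_Rconv (a : C) (u : nat -> R) (t : R) :
  is_lim_seq u t -> Cconv eventually (fun n => Cexp (RtoC (u n) * a)) (Cexp (RtoC t * a)).
Proof.
  intros H. apply (filterlim_comp _ _ _ u (fun t => Cexp (RtoC t * a)) eventually (locally t)); [exact H |].
  apply (Cis_derive_continuous _ _ _ (Cexp_scale_derive a t)).
Qed.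

Lemma rGamma_duplication x :
  rGamma x * rGamma (x + 1 / 2) = RtoC (/ (2 * sqrt PI)) * Cexp (2 * x * RtoC (ln 2)) * rGamma (2 * x).
Proof.
  apply (Cconv_unique (F := eventually) (fun n => gauss x n * gauss (x + 1 / 2) n)).
  { apply Cconv_mult; apply rGamma_limit. }
  eapply Cconv_ext_loc.
  2: { apply Cconv_mult; [apply Cconv_mult |].
    - apply Cconv_RtoC, dup_const_limit.
    - rewrite (Cmult_comm (2 * x)). apply (Cexp_Rconv (2 * x) (fun n => ln (2 + / INR n))).
      apply (is_lim_seq_continuous ln (fun n => 2 + / INR n)%R 2%R).
      + apply continuity_pt_filterlim, (ex_derive_continuous (V := R_NormedModule)). exists (/ 2)%R. apply is_derive_ln. lra.
      + replace 2%R with (2 + 0)%R at 1 by ring. apply is_lim_seq_plus'; [apply is_lim_seq_const | apply is_lim_seq_inv_INR].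
    - eapply filterlim_comp; [| apply (rGamma_limit (2 * x))].
      (* The index 2 n + 1 gives 2 n + 2 factors, which are exactly the interleaved factors of the
         two products of length n + 1 on the left. *)
      instantiate (1 := fun n => (2 * n + 1)%nat). intros P [N HN]. exists N. intros n Hn. apply HN. lia. }
  exists 1%nat. intros n Hn. simpl.
  change (n + (n + 0) + 1)%nat with (2 * n + 1)%nat.
  rewrite !gauss_eq by lia.
  assert (Pn : (0 < INR n)%R) by (apply lt_0_INR; lia).
  assert (E1 : RtoC (ln (2 + / INR n)) = RtoC (ln (INR (2 * n + 1))) - RtoC (ln (INR n))).
  { rewrite <- RtoC_minus. f_equal. rewrite <- ln_div; [f_equal | | auto].
    - rewrite plus_INR, mult_INR. simpl. field. lra.
    - apply lt_0_INR; lia. }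
  rewrite E1.
  assert (E2 : RtoC (dup_const n) = RtoC (INR (fact (2 * n + 1))) * / (4 ^ (n + 1) * RtoC (INR (fact n)) ^ 2) * Cexp (- (1 / 2 * RtoC (ln (INR n))))).
  { unfold dup_const, Rdiv. rewrite Rinv_mult, !RtoC_mult.
    replace (Cexp (- (1 / 2 * RtoC (ln (INR n))))) with (RtoC (/ sqrt (INR n))).
    - rewrite RtoC_inv, RtoC_mult, !RtoC_pow. ring. apply Rmult_integral_contrapositive_currified; apply pow_nonzero; [lra | apply INR_fact_neq_0].
    - replace (- (1 / 2 * RtoC (ln (INR n)))) with (RtoC (- (ln (INR n) / 2))).
      + rewrite Cexp_RtoC, exp_Ropp. f_equal. f_equal. rewrite <- (sqrt_square (exp (ln (INR n) / 2))) by (left; apply exp_pos).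
        rewrite <- exp_plus. replace (ln (INR n) / 2 + ln (INR n) / 2)%R with (ln (INR n)) by field. rewrite exp_ln; auto.
      + rewrite RtoC_opp, RtoC_div by lra. field. }
  rewrite E2.
  replace (S (2 * n + 1)) with (2 * S n)%nat by lia. rewrite <- rising_double.
  replace (n + 1)%nat with (S n) by lia.
  set (l := RtoC (ln (INR n))). set (l' := RtoC (ln (INR (2 * n + 1)))).
  (* The exponent is rewritten so that only the exponentials of the other side and one inverse pair
     occur, which [field] can cancel. *)
  replace (- (x * l)) with ((l' - l) * (2 * x) + (- (1 / 2 * l)) + (- (2 * x * l')) + - (- (1 / 2 * l) - x * l)) by ring.
  replace (- ((x + 1 / 2) * l)) with (- (1 / 2 * l) - x * l) by ring.
  rewrite !Cexp_plus, (Cexp_opp (- (1 / 2 * l) - x * l)).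
  pose proof (INR_fact_C_neq_0 n). pose proof (INR_fact_C_neq_0 (2 * n + 1)).
  assert ((4 : C) ^ S n <> 0) by (apply Cpow_nz, RtoC_neq_0; lra).
  pose proof (Cexp_neq_0 (- (1 / 2 * l) - x * l)).
  field. auto.
Qed.

Lemma rGamma_half : rGamma (1 / 2) = RtoC (/ sqrt PI).
Proof.
  pose proof (rGamma_duplication (1 / 2)) as H.
  replace (1 / 2 + 1 / 2) with (RtoC 1) in H by field. replace (2 * (1 / 2)) with (RtoC 1) in H by field.
  rewrite rGamma_1, !Cmult_1_l, Cmult_1_r, Cexp_RtoC, exp_ln in H by lra. rewrite Cmult_1_r in H. rewrite H, <- RtoC_mult. f_equal.
  field. apply Rgt_not_eq, sqrt_lt_R0, PI_RGT_0.
Qed.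

(** * Kummer's second formula *)

(** This is 2^(-l) times the falling factorial of 2 y of length l, so 2^l [hprod y l] / l! is the
    binomial coefficient binom(2 y, l). *)
Fixpoint hprod (y : C) (l : nat) : C :=
  match l with O => 1 | S p => hprod y p * (y - RtoC (INR p) / 2) end.

(* Equals 2^l (mu + 1/2)_l / ((2 mu + 1)_l Gamma(mu + 1)) wherever that makes sense,
   in a form that is entire in mu. *)
Definition bcoef (mu : C) (l : nat) : C := rGamma (mu + RtoC (INR l) + 1) * hprod (mu + RtoC (INR l)) l.

(** The factors descend in steps of 1/2, so raising y by 1 puts two new factors in front. *)
Lemma hprod_shift y l : hprod (y + 1) (S (S l)) = (y + 1) * (y + 1 / 2) * hprod y l.
Proof.
  induction l.
  - simpl. field.
  - change (hprod (y + 1) (S (S (S l)))) with (hprod (y + 1) (S (S l)) * (y + 1 - RtoC (INR (S (S l))) / 2)).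
    rewrite IHl, !S_INR, !RtoC_plus. simpl. field.
Qed.

Lemma bcoef_0 mu : bcoef mu 0 = rGamma (mu + 1).
Proof. unfold bcoef. simpl. rewrite Cplus_0_r. ring. Qed.

(** Passing from (mu, l + 1) to (mu + 1, l) keeps the sum of both entries, so only the last factor
    of [hprod] is split off. *)
Lemma bcoef_succ mu l : bcoef mu (S l) = (mu + 1 + RtoC (INR l) / 2) * bcoef (mu + 1) l.
Proof.
  unfold bcoef. rewrite S_INR, RtoC_plus.
  replace (mu + (RtoC (INR l) + 1)) with (mu + 1 + RtoC (INR l)) by ring.
  simpl hprod. field.
Qed.

(** Kept in multiplied form: the factor on the left is zero when 2 mu = - (l + 1). *)
Lemma bcoef_rec mu l :
  (mu + (RtoC (INR l) + 1) / 2) * bcoef mu (S l) = (mu + RtoC (INR l) + 1 / 2) * bcoef mu l.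
Proof.
  unfold bcoef. pose proof (hprod_shift (mu + RtoC (INR l)) l) as H.
  change (hprod (mu + RtoC (INR l) + 1) (S (S l))) with (hprod (mu + RtoC (INR l) + 1) (S l) * (mu + RtoC (INR l) + 1 - RtoC (INR (S l)) / 2)) in H.
  rewrite (rGamma_rec (mu + RtoC (INR l) + 1)).
  rewrite S_INR, RtoC_plus in *.
  replace (mu + (RtoC (INR l) + 1)) with (mu + RtoC (INR l) + 1) by ring.
  set (h := hprod (mu + RtoC (INR l) + 1) (S l)) in *. set (G := rGamma (mu + RtoC (INR l) + 1 + 1)).
  transitivity (G * (h * (mu + RtoC (INR l) + 1 - (RtoC (INR l) + 1) / 2))); [field |].
  rewrite H. ring.
Qed.

(** No division occurs: the factor split off by [bcoef_succ] is the left factor of [bcoef_rec] at mu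
    + 1. *)
Lemma bcoef_succ2 mu l : bcoef mu (S (S l)) = (mu + 3 / 2 + RtoC (INR l)) * bcoef (mu + 1) l.
Proof.
  rewrite bcoef_succ, S_INR, RtoC_plus.
  pose proof (bcoef_rec (mu + 1) l) as H.
  rewrite H. field.
Qed.

Definition binv (n l : nat) : C := (- (1)) ^ l / (RtoC (INR (fact l)) * RtoC (INR (fact (n - l)))).

(* The binomial transform of b, divided by n!. *)
Definition btrans (b : nat -> C) (n : nat) : C := csum (fun l => binv n l * b l) (S n).

Lemma btrans_mul_index b n : btrans (fun l => RtoC (INR l) * b l) (S n) = - btrans (fun l => b (S l)) n.
Proof.
  unfold btrans. rewrite csum_shift. simpl (INR 0).
  replace (binv (S n) 0 * (0 * b 0%nat)) with (RtoC 0) by ring. rewrite Cplus_0_l.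
  replace (- csum (fun l => binv n l * b (S l)) (S n)) with (- (1) * csum (fun l => binv n l * b (S l)) (S n)) by ring.
  rewrite <- csum_scal. apply csum_ext. intros l _. unfold binv.
  rewrite fact_S_C, Cpow_S. simpl (S n - S l)%nat.
  pose proof (INR_fact_C_neq_0 l). pose proof (INR_fact_C_neq_0 (n - l)). pose proof (INR_S_C_neq_0 l). field. auto.
Qed.

(** Pascal's rule in disguise: n + 1 is split as l + (n + 1 - l), and each part cancels one factor
    of a factorial. *)
Lemma btrans_succ b n :
  RtoC (INR (S n)) * btrans b (S n) = btrans b n - btrans (fun l => b (S l)) n.
Proof.
  assert (E : RtoC (INR (S n)) * btrans b (S n) =
     btrans (fun l => RtoC (INR l) * b l) (S n) + csum (fun l => binv (S n) l * RtoC (INR (S n - l)) * b l) (S (S n))).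
  { unfold btrans. rewrite <- csum_plus, <- csum_scal. apply csum_ext. intros l Hl.
    replace (INR (S n)) with (INR l + INR (S n - l))%R by (rewrite <- plus_INR; f_equal; lia).
    rewrite RtoC_plus. ring. }
  rewrite E, btrans_mul_index.
  change (csum (fun l => binv (S n) l * RtoC (INR (S n - l)) * b l) (S (S n))) with
    (csum (fun l => binv (S n) l * RtoC (INR (S n - l)) * b l) (S n) + binv (S n) (S n) * RtoC (INR (S n - S n)) * b (S n)).
  rewrite Nat.sub_diag. simpl (INR 0).
  rewrite (csum_ext _ (fun l => binv n l * b l)).
  - unfold btrans at 2. ring.
  - intros l Hl. f_equal. unfold binv. replace (S n - l)%nat with (S (n - l)) by lia. rewrite fact_S_C.
    pose proof (INR_fact_C_neq_0 l). pose proof (INR_fact_C_neq_0 (n - l)). pose proof (INR_S_C_neq_0 (n - l)). field. auto.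
Qed.

Lemma btrans_ext b c n : (forall l, b l = c l) -> btrans b n = btrans c n.
Proof. intros H. apply csum_ext. intros l _. rewrite H. reflexivity. Qed.

Lemma btrans_lin p q b n :
  btrans (fun l => (p + q * RtoC (INR l)) * b l) n = p * btrans b n + q * btrans (fun l => RtoC (INR l) * b l) n.
Proof.
  unfold btrans. rewrite <- !csum_scal, <- csum_plus. apply csum_ext. intros l _. ring.
Qed.

(* This is J_mu' - (mu / z) J_mu = - J_(mu + 1) on coefficients; unlike the three-term
   recurrence from Bessel's equation it never divides by n + 2 mu. *)
Lemma btrans_bcoef_step mu n :
  RtoC (2 * INR (S (S n))) * btrans (bcoef mu) (S (S n)) = btrans (bcoef (mu + 1)) n.
Proof.
  induction n.
  - unfold btrans. simpl csum. rewrite bcoef_succ2, bcoef_succ, !bcoef_0.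
    rewrite (rGamma_rec (mu + 1)). unfold binv. simpl. rewrite RtoC_mult, RtoC_plus. field.
  - set (T := btrans (bcoef mu)) in *. set (T' := btrans (bcoef (mu + 1))) in *.
    set (s := S n).
    pose proof (btrans_succ (bcoef mu) (S s)) as H1. fold T in H1.
    pose proof (btrans_succ (fun l => bcoef mu (S l)) s) as H2.
    (* Shifting the index of [bcoef mu] once or twice multiplies [bcoef (mu + 1)] by a linear
       polynomial in l. All transforms are thus combinations of [T' s] and one further transform,
       [U], which [H5] eliminates. *)
    assert (H3 : btrans (fun l => bcoef mu (S l)) s = (mu + 1) * T' s - 1 / 2 * btrans (fun l => bcoef (mu + 1) (S l)) n).
    { rewrite (btrans_ext _ (fun l => ((mu + 1) + 1 / 2 * RtoC (INR l)) * bcoef (mu + 1) l)).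
      - rewrite btrans_lin. unfold s at 2. rewrite btrans_mul_index. unfold T'. ring.
      - intros l. rewrite bcoef_succ. field. }
    assert (H4 : btrans (fun l => bcoef mu (S (S l))) s = (mu + 3 / 2) * T' s - btrans (fun l => bcoef (mu + 1) (S l)) n).
    { rewrite (btrans_ext _ (fun l => ((mu + 3 / 2) + 1 * RtoC (INR l)) * bcoef (mu + 1) l)).
      - rewrite btrans_lin. unfold s at 2. rewrite btrans_mul_index. unfold T'. ring.
      - intros l. rewrite bcoef_succ2. ring. }
    rewrite H3, H4 in H2.
    pose proof (btrans_succ (bcoef (mu + 1)) n) as H5. fold T' s in H5.
    set (U := btrans (fun l => bcoef (mu + 1) (S l)) n) in *.
    replace U with (T' n - RtoC (INR s) * T' s) in H2 by (rewrite H5; ring).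
    set (V := btrans (fun l => bcoef mu (S l)) (S s)) in *.
    fold s in IHn.
    pose proof (INR_S_C_neq_0 s) as Hs.
    rewrite RtoC_mult in *. 
    assert (H6 : RtoC (INR (S s)) * (2 * RtoC (INR (S (S s))) * T (S (S s))) = RtoC (INR (S s)) * T' s).
    { transitivity (2 * (RtoC (INR (S s)) * (RtoC (INR (S (S s))) * T (S (S s))))); [ring |].
      rewrite H1. transitivity (2 * RtoC (INR (S s)) * T (S s) - 2 * (RtoC (INR (S s)) * V)); [ring |].
      rewrite IHn, H2. rewrite (S_INR s), RtoC_plus. field. }
    transitivity (/ RtoC (INR (S s)) * (RtoC (INR (S s)) * (2 * RtoC (INR (S (S s))) * T (S (S s))))); [field; auto |].
    rewrite H6. field. auto.
Qed.

(** In the product with e^(iz) only even powers of z survive, as in the Bessel series. The base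
    case, equality of the coefficients for l = 0 and l = 1, is the recurrence of 1 / Gamma. *)
Lemma btrans_bcoef_odd n : forall mu, btrans (bcoef mu) (2 * n + 1) = 0.
Proof.
  induction n; intros mu.
  - simpl. unfold btrans. simpl csum. rewrite bcoef_succ, !bcoef_0. rewrite (rGamma_rec (mu + 1)).
    unfold binv. simpl. field.
  - replace (2 * S n + 1)%nat with (S (S (2 * n + 1))) by lia.
    pose proof (btrans_bcoef_step mu (2 * n + 1)) as H. rewrite IHn in H.
    assert (N : RtoC (2 * INR (S (S (2 * n + 1)))) <> RtoC 0).
    { apply RtoC_neq_0. pose proof (lt_0_INR (S (S (2 * n + 1))) ltac:(lia)). lra. }
    set (c := RtoC (2 * INR (S (S (2 * n + 1))))) in *.
    set (t := btrans (bcoef mu) (S (S (2 * n + 1)))) in *.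
    replace t with (/ c * (c * t)) by (field; auto). rewrite H. ring.
Qed.

Lemma btrans_bcoef_even n : forall mu,
  btrans (bcoef mu) (2 * n) = rGamma (mu + RtoC (INR n) + 1) / (4 ^ n * RtoC (INR (fact n))).
Proof.
  induction n; intros mu.
  - simpl. unfold btrans. simpl csum. rewrite bcoef_0. unfold binv. simpl. rewrite Cplus_0_r. field.
  - replace (2 * S n)%nat with (S (S (2 * n))) by lia.
    pose proof (btrans_bcoef_step mu (2 * n)) as H. rewrite IHn in H.
    replace (2 * INR (S (S (2 * n))))%R with (4 * INR (S n))%R in H.
    2: { replace (S (S (2 * n))) with (2 * S n)%nat by lia. rewrite mult_INR. simpl (INR 2). ring. }
    rewrite RtoC_mult in H. pose proof (INR_S_C_neq_0 n) as N1. pose proof (INR_fact_C_neq_0 n) as N2.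
    assert (N3 : (4 : C) ^ n <> RtoC 0) by (apply Cpow_nz, RtoC_neq_0; lra).
    assert (N4 : (4 : C) <> RtoC 0) by (apply RtoC_neq_0; lra).
    set (t := btrans (bcoef mu) (S (S (2 * n)))) in *.
    replace t with (/ (4 * RtoC (INR (S n))) * (4 * RtoC (INR (S n)) * t)) by (field; auto).
    rewrite H, fact_S_C, Cpow_S.
    replace (mu + RtoC (INR (S n)) + 1) with (mu + 1 + RtoC (INR n) + 1) by (rewrite S_INR, RtoC_plus; ring).
    field. auto.
Qed.

Lemma Cmod_sub_le (a b : C) : (Cmod a - Cmod b <= Cmod (a + b))%R.
Proof.
  pose proof (Cmod_triangle (a + b) (- b)) as H. replace (a + b + - b) with a in H by ring. rewrite Cmod_opp in H. lra.
Qed.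

(** Beyond 5 |mu| the coefficients grow by a factor of at most 4 per step, and beyond 8 |w| the
    factor |w| / (n + 1) is at most 1/8, whence the ratio 1/2. *)
Lemma ex_series_bcoef (mu w : C) : ex_series (fun l => Cmod (w ^ l * bcoef mu l / RtoC (INR (fact l)))).
Proof.
  destruct (nfloor_ex (5 * Cmod mu + 8 * Cmod w)) as [N [_ HN]].
  { pose proof (Cmod_ge_0 mu); pose proof (Cmod_ge_0 w); lra. }
  apply (ex_series_ratio_half _ (S N)).
  { intros n. apply Cmod_ge_0. }
  intros n Hn. 
  assert (Hn' : (INR N + 1 <= INR n)%R) by (rewrite <- S_INR; apply le_INR; auto).
  pose proof (Cmod_ge_0 mu) as Pm. pose proof (Cmod_ge_0 w) as Pw. pose proof (pos_INR N).
  assert (B : (Cmod (bcoef mu (S n)) <= 4 * Cmod (bcoef mu n))%R).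
  { pose proof (bcoef_rec mu n) as E. apply (f_equal Cmod) in E. rewrite !Cmod_mult in E.
    set (x := Cmod (bcoef mu (S n))) in *. set (y := Cmod (bcoef mu n)) in *.
    assert (x >= 0)%R by (apply Rle_ge, Cmod_ge_0). assert (y >= 0)%R by (apply Rle_ge, Cmod_ge_0).
    assert (L : (INR n / 2 + / 2 - Cmod mu <= Cmod (mu + (RtoC (INR n) + 1) / 2))%R).
    { pose proof (Cmod_sub_le (RtoC ((INR n + 1) / 2)) mu) as L. rewrite Cmod_R, Rabs_pos_eq in L by lra.
      replace (mu + (RtoC (INR n) + 1) / 2) with (RtoC ((INR n + 1) / 2) + mu); [lra |].
      unfold Rdiv, Cdiv. rewrite RtoC_mult, RtoC_plus, RtoC_inv by lra. ring. }
    assert (U : (Cmod (mu + RtoC (INR n) + 1 / 2) <= Cmod mu + INR n + / 2)%R).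
    { replace (mu + RtoC (INR n) + 1 / 2) with (mu + RtoC (INR n + / 2)) by (rewrite RtoC_plus, RtoC_inv by lra; field).
      eapply Rle_trans; [apply Cmod_triangle |]. rewrite Cmod_R, Rabs_pos_eq; lra. }
    set (p := Cmod (mu + (RtoC (INR n) + 1) / 2)) in *. set (q := Cmod (mu + RtoC (INR n) + 1 / 2)) in *.
    assert (q <= 4 * p)%R by lra. assert (0 < p)%R by lra.
    apply Rmult_le_reg_l with p; auto. rewrite E. nra. }
  rewrite fact_S_C, Cpow_S.
  replace (w * w ^ n * bcoef mu (S n) / (RtoC (INR (S n)) * RtoC (INR (fact n)))) with
    (w / RtoC (INR (S n)) * (w ^ n / RtoC (INR (fact n))) * bcoef mu (S n)).
  2: { pose proof (INR_fact_C_neq_0 n). pose proof (INR_S_C_neq_0 n). field. auto. }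
  replace (w ^ n * bcoef mu n / RtoC (INR (fact n))) with (w ^ n / RtoC (INR (fact n)) * bcoef mu n).
  2: { pose proof (INR_fact_C_neq_0 n). field. auto. }
  rewrite !Cmod_mult.
  assert (D : (Cmod (w / RtoC (INR (S n))) <= / 8)%R).
  { rewrite Cmod_div by apply INR_S_C_neq_0. rewrite Cmod_R, Rabs_pos_eq by apply pos_INR.
    rewrite S_INR. apply Rmult_le_reg_r with (INR n + 1)%R; [lra |]. field_simplify; lra. }
  set (c := Cmod (w ^ n / RtoC (INR (fact n)))). assert (0 <= c)%R by apply Cmod_ge_0.
  pose proof (Cmod_ge_0 (bcoef mu n)). pose proof (Cmod_ge_0 (w / RtoC (INR (S n)))). pose proof (Cmod_ge_0 (bcoef mu (S n))).
  apply Rle_trans with (/ 8 * c * (4 * Cmod (bcoef mu n)))%R; [| lra].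
  apply Rmult_le_compat; auto; [apply Rmult_le_pos; auto | apply Rmult_le_compat_r; auto].
Qed.

Lemma Cis_series_even (c : nat -> C) l :
  (forall n, c (2 * n + 1)%nat = 0) -> Cis_series c l -> Cis_series (fun n => c (2 * n)%nat) l.
Proof.
  intros H. rewrite !Cis_series_csum. intros L.
  assert (E : forall n, csum c (2 * n) = csum (fun n => c (2 * n)%nat) n).
  { induction n; [reflexivity |]. replace (2 * S n)%nat with (S (S (2 * n))) by lia.
    simpl csum at 1. change (n + (n + 0))%nat with (2 * n)%nat. rewrite IHn.
    replace (S (2 * n)) with (2 * n + 1)%nat by lia. rewrite H. simpl. ring. }
  eapply Cconv_ext; [exact E |].
  eapply filterlim_comp; [| exact L]. intros P [N HN]. exists N. intros n Hn. apply HN. lia.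
Qed.

(** In the Cauchy product of the two series the coefficient of (i z)^n is [btrans (bcoef mu) n]; the
    sign in - i z = - (i z) supplies the alternation in [binv]. *)
Lemma Kummer (mu z S : C) :
  Cis_series (fun l => (- Ci * z) ^ l * bcoef mu l / RtoC (INR (fact l))) S ->
  Cis_series (fun k => (- (1)) ^ k * (z / 2) ^ (2 * k) * (/ RtoC (INR (fact k)) * rGamma (mu + RtoC (INR k) + 1)))
    (Cexp (Ci * z) * S).
Proof.
  intros HS. rewrite Cmult_comm.
  pose proof (Cauchy_product _ _ _ _ HS (Cexp_series (Ci * z)) (ex_series_bcoef mu (- Ci * z))) as P.
  specialize (P ltac:(eapply ex_series_ext; [intros n; symmetry; apply Cmod_exp_term | apply ex_series_exp_abs])).
  assert (E : forall n, csum (fun l => (- Ci * z) ^ l * bcoef mu l / RtoC (INR (fact l)) * ((Ci * z) ^ (n - l) / RtoC (INR (fact (n - l))))) (Datatypes.S n)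
     = (Ci * z) ^ n * btrans (bcoef mu) n).
  { intros n. unfold btrans. rewrite <- csum_scal. apply csum_ext. intros l Hl. unfold binv.
    replace (- Ci * z) with (- (1) * (Ci * z)) by ring. rewrite Cpow_mult_l.
    replace ((Ci * z) ^ n) with ((Ci * z) ^ l * (Ci * z) ^ (n - l)) by (rewrite <- Cpow_add_r; f_equal; lia).
    pose proof (INR_fact_C_neq_0 l). pose proof (INR_fact_C_neq_0 (n - l)). field. auto. }
  apply (is_series_ext (V := C_NormedModule) _ (fun n => (Ci * z) ^ n * btrans (bcoef mu) n)) in P; [| exact E].
  apply Cis_series_even in P.
  - revert P. apply (is_series_ext (V := C_NormedModule)). intros n. rewrite btrans_bcoef_even.
    rewrite !Cpow_mult_r.
    replace ((Ci * z) ^ 2) with (- (1) * 4 * (z / 2) ^ 2).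
    2: { replace ((Ci * z) ^ 2) with (Ci * Ci * z ^ 2) by ring. replace (Ci * Ci) with (- (1)). field. apply C_ext; simpl; ring. }
    rewrite !Cpow_mult_l. pose proof (INR_fact_C_neq_0 n).
    assert ((4 : C) ^ n <> RtoC 0) by (apply Cpow_nz, RtoC_neq_0; lra). 
    set (q := ((z / 2) ^ 2) ^ n). match goal with |- ?a = ?b => change (@eq C a b) end. field. auto.
  - intros n. rewrite btrans_bcoef_odd. ring.
Qed.

(** * The integrals of (1 + cos t)^s cos (k t) *)

Lemma one_plus_cos_pos t : (0 <= t < PI)%R -> (0 < 1 + cos t)%R.
Proof.
  intros Ht. pose proof PI_RGT_0. pose proof (cos_decreasing_1 t PI ltac:(lra) ltac:(lra) ltac:(lra) ltac:(lra) ltac:(lra)) as H0.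
  rewrite cos_PI in H0. lra.
Qed.

Definition Csin (z : C) : C := (Cexp (Ci * z) - Cexp (- (Ci * z))) / (2 * Ci).

Definition cos_pow (s : C) (t : R) : C := Cexp (s * RtoC (ln (1 + cos t))).

Definition kern (s k : C) (t : R) : C := cos_pow s t * Ccos (k * RtoC t).

(** For b < PI the kernel is smooth on [0, b] even if Re s < 0; the integral up to PI is the limit
    as b -> PI. *)
Definition kint (s k : C) (b : R) : C := @RInt C_R_CompleteNormedModule (kern s k) 0 b.

Lemma Cexp_Ci t : Cexp (Ci * RtoC t) = RtoC (cos t) + Ci * RtoC (sin t).
Proof.
  unfold Cexp. replace (Re (Ci * RtoC t)) with 0%R by (simpl; ring). replace (Im (Ci * RtoC t)) with t by (simpl; ring).
  rewrite exp_0. apply C_ext; simpl; ring.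
Qed.

Lemma Ccos_shift k t : Ccos ((k + 1) * RtoC t) = RtoC (cos t) * Ccos (k * RtoC t) - RtoC (sin t) * Csin (k * RtoC t).
Proof.
  unfold Ccos, Csin. replace (Ci * ((k + 1) * RtoC t)) with (Ci * (k * RtoC t) + Ci * RtoC t) by ring.
  replace (- (Ci * (k * RtoC t) + Ci * RtoC t)) with (- (Ci * (k * RtoC t)) + Ci * RtoC (- t)) by (rewrite RtoC_opp; ring).
  rewrite !Cexp_plus, !Cexp_Ci, cos_neg, sin_neg, RtoC_opp. pose proof Ci_nz.
  set (x := Cexp (Ci * (k * RtoC t))). set (y := Cexp (- (Ci * (k * RtoC t)))).
  assert (I2 : Ci * Ci = - (1)) by (apply C_ext; simpl; ring).
  field_simplify_eq; [| auto]. ring [I2].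
Qed.

Lemma Csin_shift k t : Csin ((k + 1) * RtoC t) = RtoC (cos t) * Csin (k * RtoC t) + RtoC (sin t) * Ccos (k * RtoC t).
Proof.
  unfold Ccos, Csin. replace (Ci * ((k + 1) * RtoC t)) with (Ci * (k * RtoC t) + Ci * RtoC t) by ring.
  replace (- (Ci * (k * RtoC t) + Ci * RtoC t)) with (- (Ci * (k * RtoC t)) + Ci * RtoC (- t)) by (rewrite RtoC_opp; ring).
  rewrite !Cexp_plus, !Cexp_Ci, cos_neg, sin_neg, RtoC_opp. pose proof Ci_nz.
  set (x := Cexp (Ci * (k * RtoC t))). set (y := Cexp (- (Ci * (k * RtoC t)))).
  assert (I2 : Ci * Ci = - (1)) by (apply C_ext; simpl; ring).
  field_simplify_eq; [| auto]. ring [I2].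
Qed.

Lemma Ccos_0 : Ccos 0 = 1.
Proof. unfold Ccos. rewrite Cmult_0_r. replace (- 0) with (RtoC 0) by ring. rewrite Cexp_0. field. Qed.

Lemma Cmod_Ccos_le z : (Cmod (Ccos z) <= exp (Cmod z))%R.
Proof.
  unfold Ccos. rewrite Cmod_div by (apply RtoC_neq_0; lra). rewrite Cmod_R, Rabs_pos_eq by lra.
  pose proof (Cmod_triangle (Cexp (Ci * z)) (Cexp (- (Ci * z)))) as T.
  pose proof (Cmod_Cexp_le (Ci * z)) as A. pose proof (Cmod_Cexp_le (- (Ci * z))) as B.
  rewrite Cmod_opp in B. rewrite Cmod_mult, Cmod_Ci, Rmult_1_l in A, B. lra.
Qed.

Lemma Cmod_Csin_le z : (Cmod (Csin z) <= exp (Cmod z))%R.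
Proof.
  unfold Csin. rewrite Cmod_div by (apply Cmult_neq_0; [apply RtoC_neq_0; lra | apply Ci_nz]).
  rewrite Cmod_mult, Cmod_Ci, Cmod_R, Rabs_pos_eq by lra.
  pose proof (Cmod_triangle (Cexp (Ci * z)) (- Cexp (- (Ci * z)))) as T. rewrite Cmod_opp in T.
  pose proof (Cmod_Cexp_le (Ci * z)) as A. pose proof (Cmod_Cexp_le (- (Ci * z))) as B.
  rewrite Cmod_opp in B. rewrite Cmod_mult, Cmod_Ci, Rmult_1_l in A, B. unfold Cminus. lra.
Qed.

Lemma Cis_derive_lin k t : Cis_derive (fun x => k * RtoC x) t k.
Proof.
  eapply Cis_derive_eq.
  - apply Cis_derive_scal, Cis_derive_RtoC, (is_derive_id (K := R_AbsRing)).
  - simpl. change (RtoC one) with (RtoC 1). ring.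
Qed.

Lemma Cis_derive_expi k t : Cis_derive (fun x => Cexp (Ci * (k * RtoC x))) t (Ci * k * Cexp (Ci * (k * RtoC t))).
Proof. apply (Cis_derive_Cexp (fun x => Ci * (k * RtoC x))), Cis_derive_scal, Cis_derive_lin. Qed.

Lemma Cis_derive_expi_neg k t : Cis_derive (fun x => Cexp (- (Ci * (k * RtoC x)))) t (- (Ci * k) * Cexp (- (Ci * (k * RtoC t)))).
Proof.
  apply (Cis_derive_Cexp (fun x => - (Ci * (k * RtoC x)))).
  apply (Cis_derive_ext (fun x => - Ci * k * RtoC x)); [intros x; ring |].
  eapply Cis_derive_eq; [apply Cis_derive_lin | ring].
Qed.

Lemma Cis_derive_Ccos k t : Cis_derive (fun x => Ccos (k * RtoC x)) t (- k * Csin (k * RtoC t)).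
Proof.
  apply (Cis_derive_ext (fun x => / 2 * (Cexp (Ci * (k * RtoC x)) + Cexp (- (Ci * (k * RtoC x)))))).
  { intros x. unfold Ccos, Cdiv. ring. }
  eapply Cis_derive_eq.
  { apply Cis_derive_scal, Cis_derive_plus; [apply Cis_derive_expi | apply Cis_derive_expi_neg]. }
  unfold Csin. assert (I2 : Ci * Ci = - (1)) by (apply C_ext; simpl; ring). pose proof Ci_nz.
  field_simplify_eq; [| auto]. ring [I2].
Qed.

Lemma Cis_derive_Csin k t : Cis_derive (fun x => Csin (k * RtoC x)) t (k * Ccos (k * RtoC t)).
Proof.
  apply (Cis_derive_ext (fun x => / (2 * Ci) * (Cexp (Ci * (k * RtoC x)) + - (1) * Cexp (- (Ci * (k * RtoC x)))))).
  { intros x. unfold Csin, Cdiv. ring. }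
  eapply Cis_derive_eq.
  { apply Cis_derive_scal, Cis_derive_plus; [apply Cis_derive_expi | apply Cis_derive_scal, Cis_derive_expi_neg]. }
  unfold Ccos. pose proof Ci_nz. field. auto.
Qed.

Lemma Cis_derive_cos_pow s t : (0 <= t < PI)%R ->
  Cis_derive (cos_pow s) t (- s * RtoC (sin t) / RtoC (1 + cos t) * cos_pow s t).
Proof.
  intros Ht. pose proof (one_plus_cos_pos t Ht) as Hc. eapply Cis_derive_eq.
  - apply (Cis_derive_Cexp (fun x => s * RtoC (ln (1 + cos x)))), Cis_derive_scal, Cis_derive_RtoC.
    auto_derive; [exact Hc | reflexivity].
  - unfold cos_pow. replace (1 * - sin t * / (1 + cos t))%R with (- (sin t / (1 + cos t)))%R by (field; lra).
    rewrite RtoC_opp, RtoC_div by lra. field. apply RtoC_neq_0; lra.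
Qed.

Lemma kern_continuous s k t : (0 <= t < PI)%R -> @continuous R_UniformSpace C_R_NormedModule (kern s k) t.
Proof.
  intros Ht. eapply Cis_derive_continuous. apply Cis_derive_mult; [apply Cis_derive_cos_pow; auto | apply Cis_derive_Ccos].
Qed.

Lemma kint_correct s k b : (0 <= b < PI)%R -> Cis_RInt (kern s k) 0 b (kint s k b).
Proof.
  intros Hb. apply (RInt_correct (V := C_R_CompleteNormedModule)).
  apply (ex_RInt_continuous (V := C_R_CompleteNormedModule)). intros t Ht.
  rewrite Rmin_left, Rmax_right in Ht by lra. apply kern_continuous. lra.
Qed.

Lemma Cis_RInt_unique (f : R -> C) a b (l m : C) : Cis_RInt f a b l -> Cis_RInt f a b m -> l = m.
Proof.
  intros H1 H2. rewrite <- (is_RInt_unique (V := C_R_CompleteNormedModule) f a b l H1).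
  apply (is_RInt_unique (V := C_R_CompleteNormedModule)). exact H2.
Qed.

Lemma Cis_RInt_plus (f g : R -> C) a b (l m : C) : Cis_RInt f a b l -> Cis_RInt g a b m ->
  Cis_RInt (fun t => f t + g t) a b (l + m).
Proof. apply (is_RInt_plus (V := C_R_NormedModule)). Qed.

Lemma Cis_RInt_ext (f g : R -> C) a b (l : C) : (a <= b)%R ->
  (forall t, (a < t < b)%R -> f t = g t) -> Cis_RInt f a b l -> Cis_RInt g a b l.
Proof.
  intros Hab H. apply (is_RInt_ext (V := C_R_NormedModule)).
  intros t Ht. rewrite Rmin_left, Rmax_right in Ht by lra. auto.
Qed.

Lemma Cis_RInt_Re (f : R -> C) a b (l : C) : Cis_RInt f a b l -> is_RInt (fun t => Re (f t)) a b (Re l).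
Proof. apply (is_RInt_fct_extend_fst (U := R_NormedModule) (V := R_NormedModule)). Qed.

Lemma Cis_RInt_Im (f : R -> C) a b (l : C) : Cis_RInt f a b l -> is_RInt (fun t => Im (f t)) a b (Im l).
Proof. apply (is_RInt_fct_extend_snd (U := R_NormedModule) (V := R_NormedModule)). Qed.

Lemma Cis_RInt_scal (c : C) (f : R -> C) a b (l : C) : Cis_RInt f a b l -> Cis_RInt (fun t => c * f t) a b (c * l).
Proof.
  intros H. pose proof (Cis_RInt_Re _ _ _ _ H) as H1. pose proof (Cis_RInt_Im _ _ _ _ H) as H2.
  apply (is_RInt_fct_extend_pair (U := R_NormedModule) (V := R_NormedModule)).
  - apply (is_RInt_minus (V := R_NormedModule) (fun t => Re c * Re (f t))%R (fun t => Im c * Im (f t))%R);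
      apply (is_RInt_scal (V := R_NormedModule)); assumption.
  - apply (is_RInt_plus (V := R_NormedModule) (fun t => Re c * Im (f t))%R (fun t => Im c * Re (f t))%R);
      apply (is_RInt_scal (V := R_NormedModule)); assumption.
Qed.

(** The antiderivative behind the recurrence in k; it vanishes at t = 0. *)
Definition kint_bdry (s k : C) (t : R) : C := cos_pow s t * (Csin ((k + 1) * RtoC t) + Csin (k * RtoC t)).

(** As sin ((k + 1) t) + sin (k t) = (1 + cos t) sin (k t) + sin t cos (k t) and sin^2 t = (1 + cos
    t) (1 - cos t), the denominator 1 + cos t from differentiating the power cancels. What remains
    is a combination of cos ((k + 1) t) and cos (k t). *)
Lemma kint_rec s k b : (0 <= b < PI)%R ->
  (s + 1 + k) * kint s (k + 1) b - (s - k) * kint s k b = kint_bdry s k b.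
Proof.
  intros Hb. symmetry.
  apply (Cis_RInt_unique (fun t => (s + 1 + k) * kern s (k + 1) t + - (s - k) * kern s k t) 0 b).
  - replace (kint_bdry s k b) with (kint_bdry s k b - kint_bdry s k 0).
    2: { unfold kint_bdry, Csin. rewrite !Cmult_0_r. replace (- 0) with (RtoC 0) by ring. rewrite Cexp_0.
         pose proof Ci_nz. field. auto. }
    apply Cis_RInt_derive; [lra | |].
    + intros t Ht. pose proof (one_plus_cos_pos t ltac:(lra)) as Hc. eapply Cis_derive_eq.
      * apply Cis_derive_mult; [apply Cis_derive_cos_pow; lra |].
        apply Cis_derive_plus; apply Cis_derive_Csin.
      * unfold kern. rewrite Csin_shift, Ccos_shift.
        pose proof (RtoC_neq_0 _ (Rgt_not_eq _ _ Hc)) as Hc'. rewrite RtoC_plus in *.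
        assert (T : RtoC (sin t) * RtoC (sin t) = 1 - RtoC (cos t) * RtoC (cos t)).
        { rewrite <- !RtoC_mult, <- RtoC_minus. f_equal. pose proof (sin2_cos2 t) as E; unfold Rsqr in E; lra. }
        field_simplify_eq; [| auto]. ring [T].
    + intros t Ht. eapply Cis_derive_continuous.
      apply Cis_derive_plus; apply Cis_derive_scal; (apply Cis_derive_mult; [apply Cis_derive_cos_pow; lra | apply Cis_derive_Ccos]).
  - replace ((s + 1 + k) * kint s (k + 1) b - (s - k) * kint s k b) with ((s + 1 + k) * kint s (k + 1) b + - (s - k) * kint s k b) by ring.
    apply Cis_RInt_plus; apply Cis_RInt_scal, kint_correct; auto.
Qed.

Lemma cos_pow_succ s t : (0 <= t < PI)%R -> cos_pow (s + 1) t = RtoC (1 + cos t) * cos_pow s t.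
Proof.
  intros Ht. pose proof (one_plus_cos_pos t Ht) as Hc. unfold cos_pow.
  rewrite Cmult_plus_distr_r, Cexp_plus, Cmult_1_l, Cexp_RtoC, exp_ln by auto. ring.
Qed.

(** The extra factor 1 + cos t is absorbed by the product formula for 2 cos t cos ((k + 1) t). This
    is the link between the exponents s and s + 1. *)
Lemma kint_raise s k b : (0 <= b < PI)%R ->
  2 * kint (s + 1) (k + 1) b = 2 * kint s (k + 1) b + kint s (k + 1 + 1) b + kint s k b.
Proof.
  intros Hb.
  apply (Cis_RInt_unique (fun t => 2 * kern (s + 1) (k + 1) t) 0 b).
  - apply Cis_RInt_scal, kint_correct; auto.
  - eapply Cis_RInt_ext; [lra | | apply Cis_RInt_plus; [apply Cis_RInt_plus; [apply Cis_RInt_scal |] |]; apply kint_correct; auto].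
    intros t Ht. simpl. unfold kern. rewrite cos_pow_succ by lra.
    rewrite (Ccos_shift (k + 1)), Csin_shift, !Ccos_shift.
    assert (T : RtoC (sin t) * RtoC (sin t) = 1 - RtoC (cos t) * RtoC (cos t)).
    { rewrite <- !RtoC_mult, <- RtoC_minus. f_equal. pose proof (sin2_cos2 t) as E; unfold Rsqr in E; lra. }
    rewrite RtoC_plus. ring [T].
Qed.

Lemma Cmod_cos_pow s t : Cmod (cos_pow s t) = exp (Re s * ln (1 + cos t)).
Proof. unfold cos_pow. rewrite Cmod_Cexp, re_scal_r. reflexivity. Qed.

Lemma at_left_PI_interval (c : R) : (c < PI)%R -> at_left PI (fun b => c < b < PI)%R.
Proof.
  intros Hc. exists (mkposreal (PI - c) ltac:(lra)). intros b Hb Hb'.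
  change (Rabs (b - PI) < PI - c)%R in Hb. apply Rabs_def2 in Hb. lra.
Qed.

Lemma at_left_PI_pos : at_left PI (fun b => 0 <= b < PI)%R.
Proof.
  generalize (at_left_PI_interval 0 PI_RGT_0). apply filter_imp. intros b; lra.
Qed.

Lemma Cis_RInt_gen_intro (f Phi : R -> C) (l : C) :
  (forall b, (0 <= b < PI)%R -> Cis_RInt f 0 b (Phi b)) -> Cconv (at_left PI) Phi l ->
  @is_RInt_gen C_R_NormedModule f (at_point 0%R) (at_left PI) l.
Proof.
  intros H1 H2 P HP. specialize (H2 P HP).
  apply (Filter_prod _ _ _ (fun a => a = 0%R) (fun b => (0 <= b < PI)%R /\ P (Phi b))).
  - reflexivity.
  - apply filter_and; [apply at_left_PI_pos | exact H2].
  - intros a b -> [Hb HPb]. exists (Phi b). split; auto.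
Qed.

Lemma exp_le_mono x y : (x <= y)%R -> (exp x <= exp y)%R.
Proof. intros [H | ->]; [left; apply exp_increasing; auto | lra]. Qed.

Lemma exp_ln_cos_limit eta : (0 < eta)%R ->
  filterlim (fun t => exp (eta * ln (1 + cos t))) (at_left PI) (locally 0%R).
Proof.
  intros He. apply filterlim_locally. intros eps.
  assert (Cc : filterlim (fun t => 1 + cos t)%R (at_left PI) (locally 0%R)).
  { apply (filterlim_filter_le_1 (F := locally PI)); [apply filter_le_within |].
    replace 0%R with (1 + cos PI)%R by (rewrite cos_PI; ring).
    apply (ex_derive_continuous (V := R_NormedModule) (fun t => 1 + cos t)%R). auto_derive; auto. }
  (* The radius is eps^(1 / eta), so that raising to the power eta gives eps. *)
  pose proof (proj1 (filterlim_locally _ _) Cc (mkposreal (exp (ln eps / eta)) (exp_pos _))) as H.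
  generalize (filter_and _ _ at_left_PI_pos H). apply filter_imp. intros t [Ht Hb].
  change (Rabs (1 + cos t - 0) < exp (ln eps / eta))%R in Hb.
  change (Rabs (exp (eta * ln (1 + cos t)) - 0) < eps)%R.
  pose proof (one_plus_cos_pos t Ht) as Hc. rewrite Rminus_0_r, Rabs_pos_eq in * by (try (left; apply exp_pos); lra).
  rewrite <- (exp_ln eps) by apply cond_pos. apply exp_increasing.
  apply ln_increasing in Hb; auto. rewrite ln_exp in Hb.
  apply Rmult_lt_reg_l with (/ eta)%R; [apply Rinv_0_lt_compat; auto |].
  replace (/ eta * (eta * ln (1 + cos t)))%R with (ln (1 + cos t)) by (field; lra). unfold Rdiv in Hb. lra.
Qed.

Lemma Cmod_lin_le (k : C) t : (0 <= t <= PI)%R -> (Cmod (k * RtoC t) <= Cmod k * PI)%R.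
Proof. intros Ht. rewrite Cmod_mult, Cmod_R, Rabs_pos_eq by lra. pose proof (Cmod_ge_0 k). nra. Qed.

(** Near PI the sum of sines is O((1 + cos t)^(1/2)), because |sin t| is of that order. This gain of
    one half in the exponent is what makes Re s > -1/2 sufficient. *)
Lemma kint_bdry_limit s k : (- / 2 < Re s)%R -> Cconv (at_left PI) (kint_bdry s k) (RtoC 0).
Proof.
  intros Hs. set (M := exp (Cmod k * PI)).
  apply (Cconv_squeeze _ _ (fun t => 4 * M * exp ((Re s + / 2) * ln (1 + cos t)))%R).
  - generalize at_left_PI_pos. apply filter_imp. intros t Ht.
    replace (kint_bdry s k t - 0) with (kint_bdry s k t) by ring. unfold kint_bdry.
    pose proof (one_plus_cos_pos t Ht) as Hc. rewrite Csin_shift, Cmod_mult, Cmod_cos_pow.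
    set (c := (1 + cos t)%R) in *. set (L := ln c).
    rewrite Rmult_plus_distr_r, exp_plus.
    set (r := exp (/ 2 * L)).
    assert (Hr : (r * r = c)%R).
    { unfold r. rewrite <- exp_plus. replace (/ 2 * L + / 2 * L)%R with L by field. apply exp_ln; auto. }
    assert (Hr0 : (0 < r)%R) by apply exp_pos.
    assert (Hc2 : (c <= 2)%R) by (unfold c; pose proof (COS_bound t); lra).
    assert (Hsin : (Rabs (sin t) <= 2 * r)%R).
    { apply Rabs_le_between. pose proof (sin2_cos2 t) as E. unfold Rsqr in E. 
      assert (sin t * sin t = c * (2 - c))%R by (unfold c; lra). split; nra. }
    assert (Hr2 : (c <= 2 * r)%R) by nra.
    assert (S1 : (Cmod (Csin (k * RtoC t)) <= M)%R).
    { eapply Rle_trans; [apply Cmod_Csin_le |]. apply exp_le_mono, Cmod_lin_le; lra. }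
    assert (S2 : (Cmod (Ccos (k * RtoC t)) <= M)%R).
    { eapply Rle_trans; [apply Cmod_Ccos_le |]. apply exp_le_mono, Cmod_lin_le; lra. }
    assert (B : (Cmod (RtoC (cos t) * Csin (k * RtoC t) + RtoC (sin t) * Ccos (k * RtoC t) + Csin (k * RtoC t)) <= 4 * M * r)%R).
    { replace (RtoC (cos t) * Csin (k * RtoC t) + RtoC (sin t) * Ccos (k * RtoC t) + Csin (k * RtoC t)) with
        (RtoC c * Csin (k * RtoC t) + RtoC (sin t) * Ccos (k * RtoC t)) by (unfold c; rewrite RtoC_plus; ring).
      eapply Rle_trans; [apply Cmod_triangle |]. rewrite !Cmod_mult, !Cmod_R, (Rabs_pos_eq c) by lra.
      assert (c * Cmod (Csin (k * RtoC t)) <= 2 * r * M)%R by (apply Rmult_le_compat; auto; [lra | apply Cmod_ge_0]).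
      assert (Rabs (sin t) * Cmod (Ccos (k * RtoC t)) <= 2 * r * M)%R by (apply Rmult_le_compat; auto; [apply Rabs_pos | apply Cmod_ge_0]).
      lra. }
    pose proof (exp_pos (Re s * L)). nra.
  - replace 0%R with (4 * M * 0)%R by ring.
    apply (filterlim_comp _ _ _ (fun t => exp ((Re s + / 2) * ln (1 + cos t))) (fun x => 4 * M * x)%R (at_left PI) (locally 0%R)).
    + apply exp_ln_cos_limit. lra.
    + apply (filterlim_scal_r (V := R_NormedModule) (4 * M)%R 0%R).
Qed.

(** * Recurrences for the limits as b tends to PI *)

Definition kint_lim (s k v : C) : Prop := Cconv (at_left PI) (kint s k) v.

Lemma Re_neq_0 (z : C) : Re z <> 0%R -> z <> RtoC 0.
Proof. intros H E. apply H. rewrite E. reflexivity. Qed.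

Lemma kint_lim_up (s k v : C) : (- / 2 < Re s)%R -> s + 1 + k <> RtoC 0 ->
  kint_lim s k v -> kint_lim s (k + 1) ((s - k) / (s + 1 + k) * v).
Proof.
  intros Hs Hn H. unfold kint_lim.
  apply (Cconv_ext_loc (fun b => / (s + 1 + k) * (kint_bdry s k b + (s - k) * kint s k b))).
  - generalize at_left_PI_pos. apply filter_imp. intros b Hb. rewrite <- kint_rec by auto. field. auto.
  - replace ((s - k) / (s + 1 + k) * v) with (/ (s + 1 + k) * (0 + (s - k) * v)) by (field; auto).
    apply Cconv_scal, Cconv_plus; [apply kint_bdry_limit; auto | apply Cconv_scal; exact H].
Qed.

Lemma kint_lim_down (s k v : C) : (- / 2 < Re s)%R -> s - k <> RtoC 0 ->
  kint_lim s (k + 1) v -> kint_lim s k ((s + 1 + k) / (s - k) * v).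
Proof.
  intros Hs Hn H. unfold kint_lim.
  apply (Cconv_ext_loc (fun b => / (s - k) * ((s + 1 + k) * kint s (k + 1) b + - (1) * kint_bdry s k b))).
  - generalize at_left_PI_pos. apply filter_imp. intros b Hb. rewrite <- kint_rec by auto. field. auto.
  - replace ((s + 1 + k) / (s - k) * v) with (/ (s - k) * ((s + 1 + k) * v + - (1) * 0)) by (field; auto).
    apply Cconv_scal, Cconv_plus; apply Cconv_scal; [exact H | apply kint_bdry_limit; auto].
Qed.

(** At k = s the coefficient s - k of the recurrence is zero, so the integral at k = s + 1 is a
    multiple of the boundary term alone; later values of k inherit the limit 0. *)
Lemma kint_lim_zero s n : (- / 2 < Re s)%R -> kint_lim s (s + 1 + RtoC (INR n)) 0.
Proof.
  intros Hs. induction n.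
  - simpl. rewrite Cplus_0_r. unfold kint_lim.
    assert (N : s + 1 + s <> RtoC 0) by (apply Re_neq_0; simpl; unfold Re in *; lra).
    apply (Cconv_ext_loc (fun b => / (s + 1 + s) * kint_bdry s s b)).
    + generalize at_left_PI_pos. apply filter_imp. intros b Hb. rewrite <- kint_rec by auto.
      replace (s - s) with (RtoC 0) by ring. field. auto.
    + replace (RtoC 0) with (/ (s + 1 + s) * RtoC 0) by ring. apply Cconv_scal, kint_bdry_limit; auto.
  - pose proof (kint_lim_up s (s + 1 + RtoC (INR n)) 0 Hs) as H.
    rewrite S_INR, RtoC_plus. replace (s + 1 + (RtoC (INR n) + 1)) with (s + 1 + RtoC (INR n) + 1) by ring.
    rewrite Cmult_0_r in H. apply H; auto.
    apply Re_neq_0. simpl. pose proof (pos_INR n). unfold Re in *; lra.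
Qed.

(** Going down from k = s, step l + 1 multiplies by (2 s - l) / (l + 1); together the steps build up
    binom(2 s, l). *)
Lemma kint_lim_coef s v l : (- / 2 < Re s)%R ->
  kint_lim s s v -> kint_lim s (s - RtoC (INR l)) (v * 2 ^ l * hprod s l / RtoC (INR (fact l))).
Proof.
  intros Hs H. induction l.
  - simpl. replace (s - 0) with s by ring. replace (v * 1 * 1 / 1) with v by field. exact H.
  - replace (s - RtoC (INR l)) with (s - RtoC (INR (S l)) + 1) in IHl by (rewrite S_INR, RtoC_plus; ring).
    apply kint_lim_down in IHl; auto.
    2: { replace (s - (s - RtoC (INR (S l)))) with (RtoC (INR (S l))) by ring. apply INR_S_C_neq_0. }
    replace (v * 2 ^ S l * hprod s (S l) / RtoC (INR (fact (S l)))) with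
      ((s + 1 + (s - RtoC (INR (S l)))) / (s - (s - RtoC (INR (S l)))) * (v * 2 ^ l * hprod s l / RtoC (INR (fact l)))); auto.
    rewrite fact_S_C, Cpow_S. replace (s - (s - RtoC (INR (S l)))) with (RtoC (INR (S l))) by ring.
    simpl hprod. pose proof (INR_S_C_neq_0 l). pose proof (INR_fact_C_neq_0 l).
    replace (s + 1 + (s - RtoC (INR (S l)))) with (2 * (s - RtoC (INR l) / 2)) by (rewrite S_INR, RtoC_plus; field).
    field. auto.
Qed.

(** In [kint_raise] at k = s the integrals with frequencies s + 1 and s + 2 tend to 0, which leaves
    half of the one with frequency s. *)
Lemma kint_lim_raise s v : (- / 2 < Re s)%R -> kint_lim s s v -> kint_lim (s + 1) (s + 1) (v / 2).
Proof.
  intros Hs H. unfold kint_lim.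
  pose proof (kint_lim_zero s 0 Hs) as H1. pose proof (kint_lim_zero s 1 Hs) as H2. simpl in H1, H2. rewrite Cplus_0_r in H1.
  apply (Cconv_ext_loc (fun b => kint s (s + 1) b + (/ 2 * kint s (s + 1 + 1) b + / 2 * kint s s b))).
  - generalize at_left_PI_pos. apply filter_imp. intros b Hb. pose proof (kint_raise s s b Hb) as E.
    transitivity (/ 2 * (2 * kint s (s + 1) b + kint s (s + 1 + 1) b + kint s s b)); [field |]. rewrite <- E. field.
  - replace (v / 2) with (0 + (/ 2 * 0 + / 2 * v)) by field.
    apply Cconv_plus; auto. apply Cconv_plus; apply Cconv_scal; auto.
Qed.

Lemma kint_lim_lower s v : (- / 2 < Re s)%R -> kint_lim (s + 1) (s + 1) v -> kint_lim s s (2 * v).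
Proof.
  intros Hs H. unfold kint_lim.
  pose proof (kint_lim_zero s 0 Hs) as H1. pose proof (kint_lim_zero s 1 Hs) as H2. simpl in H1, H2. rewrite Cplus_0_r in H1.
  apply (Cconv_ext_loc (fun b => 2 * kint (s + 1) (s + 1) b + (- (2) * kint s (s + 1) b + - (1) * kint s (s + 1 + 1) b))).
  - generalize at_left_PI_pos. apply filter_imp. intros b Hb. rewrite (kint_raise s s b Hb). ring.
  - replace (2 * v) with (2 * v + (- (2) * 0 + - (1) * 0)) by ring.
    apply Cconv_plus; [apply Cconv_scal; auto |]. apply Cconv_plus; apply Cconv_scal; auto.
Qed.

(** * The constant of the integrals, by concentration at t = 0 *)

Lemma kern_bound s k t : (0 <= Re s)%R -> (0 <= t < PI)%R ->
  (Cmod (kern s k t) <= exp (Re s * ln 2) * exp (Cmod k * PI))%R.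
Proof.
  intros Hs Ht. unfold kern. rewrite Cmod_mult, Cmod_cos_pow. pose proof (one_plus_cos_pos t Ht) as Hc.
  apply Rmult_le_compat; [left; apply exp_pos | apply Cmod_ge_0 | |].
  - apply exp_le_mono, Rmult_le_compat_l; auto. apply ln_le; auto. pose proof (COS_bound t); lra.
  - eapply Rle_trans; [apply Cmod_Ccos_le |]. apply exp_le_mono, Cmod_lin_le; lra.
Qed.

Lemma Cmod_RInt_le (f : R -> C) (g : R -> R) a b (l : C) m : (a <= b)%R ->
  (forall t, (a <= t <= b)%R -> (Cmod (f t) <= g t)%R) ->
  Cis_RInt f a b l -> is_RInt g a b m -> (Cmod l <= m)%R.
Proof.
  intros Hab H Hf Hg. rewrite Cmod_norm. refine (norm_RInt_le (V := C_R_NormedModule) f g a b l m Hab _ Hf Hg).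
  intros t Ht. rewrite <- Cmod_norm. auto.
Qed.

(** The kernel is bounded, so the Cauchy criterion applies at PI. Existence comes first because the
    value is later deduced from relations satisfied by an unknown limit. *)
Lemma kint_lim_exists s k : (0 <= Re s)%R -> exists v, kint_lim s k v.
Proof.
  intros Hs. set (M := (exp (Re s * ln 2) * exp (Cmod k * PI))%R).
  assert (HM : (0 < M)%R) by (apply Rmult_lt_0_compat; apply exp_pos).
  assert (L : forall b b', (0 <= b <= b')%R -> (b' < PI)%R -> (Cmod (kint s k b' - kint s k b) <= (b' - b) * M)%R).
  { intros b b' Hb Hb'.
    assert (E : exists w : C, Cis_RInt (kern s k) b b' w).
    { apply (ex_RInt_continuous (V := C_R_CompleteNormedModule)). intros t Ht.
      rewrite Rmin_left, Rmax_right in Ht by lra. apply kern_continuous; lra. }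
    destruct E as [w Hw].
    assert (W : kint s k b + w = kint s k b').
    { eapply (Cis_RInt_unique (kern s k) 0 b').
      - eapply (is_RInt_Chasles (V := C_R_NormedModule)); [apply kint_correct; lra | exact Hw].
      - apply kint_correct; lra. }
    replace (kint s k b' - kint s k b) with w by (rewrite <- W; ring).
    apply (Cmod_RInt_le (kern s k) (fun _ => M) b b'); [lra | | exact Hw |].
    - intros t Ht. apply kern_bound; lra.
    - apply (is_RInt_const (V := R_NormedModule)). }
  apply (filterlim_locally_cauchy (U := C_R_CompleteNormedModule) (F := at_left PI) (kint s k)).
  intros eps. pose proof (cond_pos eps) as He. pose proof PI_RGT_0 as Hpi.
  exists (fun b => Rmax 0 (PI - eps / M) < b < PI)%R. split.
  - apply at_left_PI_interval. apply Rmax_lub_lt; auto. assert (0 < eps / M)%R by (apply Rdiv_lt_0_compat; auto). lra.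
  - intros b b' Hb Hb'. apply C_NormedModule_mixin_compat1. change (Cmod (kint s k b' - kint s k b) < eps)%R.
    pose proof (Rmax_l 0 (PI - eps / M)). pose proof (Rmax_r 0 (PI - eps / M)).
    assert (Q : forall x y, (x <= y)%R -> (PI - eps / M < x)%R -> (y < PI)%R -> ((y - x) * M < eps)%R).
    { intros x y Hxy Hx Hy. apply Rmult_lt_reg_r with (/ M)%R; [apply Rinv_0_lt_compat; auto |].
      replace ((y - x) * M * / M)%R with (y - x)%R by (field; lra). unfold Rdiv in Hx. lra. }
    destruct (Rle_dec b b') as [Hle | Hle].
    + eapply Rle_lt_trans; [apply L; lra |]. apply Q; lra.
    + rewrite <- Cmod_opp. replace (- (kint s k b' - kint s k b)) with (kint s k b - kint s k b') by ring.
      eapply Rle_lt_trans; [apply L; lra |]. apply Q; lra.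
Qed.

(** Read backwards, the falling factorial of 2 y is a rising one, the form that Gauss's product can
    absorb. *)
Lemma hprod_rising n : forall y, 2 ^ n * hprod y n = rising (2 * y - RtoC (INR n) + 1) n.
Proof.
  induction n; intros y.
  - simpl. ring.
  - rewrite rising_shift. replace (2 * y - RtoC (INR (S n)) + 1 + 1) with (2 * y - RtoC (INR n) + 1) by (rewrite S_INR, RtoC_plus; ring).
    rewrite <- IHn, Cpow_S, S_INR, RtoC_plus. simpl hprod. field.
Qed.

Lemma cos_pow_add_nat s n t : (0 <= t < PI)%R -> cos_pow (s + RtoC (INR n)) t = RtoC ((1 + cos t) ^ n) * cos_pow s t.
Proof.
  intros Ht. induction n.
  - simpl. rewrite Cplus_0_r. ring.
  - rewrite S_INR, RtoC_plus. replace (s + (RtoC (INR n) + 1)) with (s + RtoC (INR n) + 1) by ring.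
    rewrite cos_pow_succ, IHn by auto. simpl pow. rewrite RtoC_mult. ring.
Qed.

(** From (s, s), n diagonal steps each give a factor 1/2; then n steps lower the frequency from s +
    n back to s. The outcome has a growing exponent and a fixed frequency. *)
Lemma kint_lim_family s v n : (- / 2 < Re s)%R -> kint_lim s s v ->
  kint_lim (s + RtoC (INR n)) s (v * hprod (s + RtoC (INR n)) n / RtoC (INR (fact n))).
Proof.
  intros Hs H.
  assert (K : kint_lim (s + RtoC (INR n)) (s + RtoC (INR n)) (v / 2 ^ n)).
  { induction n.
    - simpl. rewrite Cplus_0_r. replace (v / 1) with v by field. exact H.
    - rewrite S_INR, RtoC_plus. replace (s + (RtoC (INR n) + 1)) with (s + RtoC (INR n) + 1) by ring.
      replace (v / 2 ^ S n) with (v / 2 ^ n / 2).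
      + apply kint_lim_raise; auto. simpl. pose proof (pos_INR n). unfold Re in *. lra.
      + rewrite Cpow_S. assert ((2 : C) ^ n <> RtoC 0) by (apply Cpow_nz, RtoC_neq_0; lra). field. auto. }
  apply kint_lim_coef with (l := n) in K.
  - replace (s + RtoC (INR n) - RtoC (INR n)) with s in K by ring.
    replace (v * hprod (s + RtoC (INR n)) n / RtoC (INR (fact n))) with
      (v / 2 ^ n * 2 ^ n * hprod (s + RtoC (INR n)) n / RtoC (INR (fact n))); auto.
    assert ((2 : C) ^ n <> RtoC 0) by (apply Cpow_nz, RtoC_neq_0; lra). pose proof (INR_fact_C_neq_0 n). field. auto.
  - simpl. pose proof (pos_INR n). unfold Re in *. lra.
Qed.

Lemma kint_lim_0 : kint_lim 0 0 (RtoC PI).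
Proof.
  unfold kint_lim. apply (Cconv_ext_loc (fun b => RtoC b)).
  - generalize at_left_PI_pos. apply filter_imp. intros b Hb.
    apply (Cis_RInt_unique (kern 0 0) 0 b); [| apply kint_correct; auto].
    apply (Cis_RInt_ext (fun _ => RtoC 1)); [lra | |].
    + intros t Ht. unfold kern, cos_pow. rewrite !Cmult_0_l, Cexp_0, Ccos_0. ring.
    + replace (RtoC b) with (@scal R_AbsRing C_R_NormedModule (b - 0)%R (RtoC 1)).
      * apply (is_RInt_const (V := C_R_NormedModule)).
      * rewrite Rminus_0_r. rewrite scal_R_Cmult. apply Cmult_1_r.
  - apply Cconv_RtoC. intros P HP. apply filter_le_within. exact HP.
Qed.

(* The integral of (1 + cos t)^n over [0, PI]. *)
Definition wmass (n : nat) : R := (PI * INR (fact (2 * n)) / (2 ^ n * INR (fact n) ^ 2))%R.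

Lemma wmass_pos n : (0 < wmass n)%R.
Proof.
  unfold wmass. apply Rdiv_lt_0_compat.
  - apply Rmult_lt_0_compat; [apply PI_RGT_0 | apply INR_fact_lt_0].
  - apply Rmult_lt_0_compat; apply pow_lt; [lra | apply INR_fact_lt_0].
Qed.

(** As 1 - cos t = 2 - (1 + cos t), this says that 1 - cos t has mean 1 / (n + 1) against the weight
    (1 + cos t)^n: the concentration at t = 0 in quantitative form. *)
Lemma wmass_succ n : (INR (S n) * wmass (S n) = (2 * INR (S n) - 1) * wmass n)%R.
Proof.
  unfold wmass. replace (2 * S n)%nat with (S (S (2 * n))) by lia. rewrite !fact_simpl, !mult_INR.
  replace (INR (S (S (2 * n)))) with (2 * INR (S n))%R by (rewrite !S_INR, mult_INR; simpl (INR 2); ring).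
  replace (INR (S (2 * n))) with (2 * INR (S n) - 1)%R by (rewrite !S_INR, mult_INR; simpl (INR 2); ring).
  pose proof (INR_fact_neq_0 n). pose proof (not_0_INR (S n) ltac:(lia)). 
  assert (2 ^ n <> 0)%R by (apply pow_nonzero; lra). set (x := INR (S n)) in *. simpl pow. field. auto.
Qed.

(** The case s = 0 of the family, hence the form [0 + ...]; the factorials come from (n + 1)_n = (2
    n)! / n!. *)
Lemma kint_lim_wmass n : kint_lim (0 + RtoC (INR n)) 0 (RtoC (wmass n)).
Proof.
  pose proof (kint_lim_family 0 (RtoC PI) n ltac:(simpl; lra) kint_lim_0) as H.
  replace (RtoC (wmass n)) with (RtoC PI * hprod (0 + RtoC (INR n)) n / RtoC (INR (fact n))); auto.
  pose proof (hprod_rising n (0 + RtoC (INR n))) as E.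
  replace (2 * (0 + RtoC (INR n)) - RtoC (INR n) + 1) with (1 + RtoC (INR n)) in E by ring.
  pose proof (rising_add 1 n n) as E2. rewrite <- E, !rising_1 in E2.
  assert (N1 : (2 : C) ^ n <> RtoC 0) by (apply Cpow_nz, RtoC_neq_0; lra). pose proof (INR_fact_C_neq_0 n) as N2.
  unfold wmass. replace (2 * n)%nat with (n + n)%nat by lia.
  rewrite RtoC_div, !RtoC_mult, !RtoC_pow, E2.
  - field. auto.
  - apply Rmult_integral_contrapositive_currified; apply pow_nonzero; [lra | apply INR_fact_neq_0].
Qed.

(** The value 2^s of the kernel at t = 0 is approached within eps near 0 by continuity; elsewhere a
    multiple of 1 - cos t dominates. Majorants of this shape can be integrated exactly against (1 +
    cos t)^n. *)
Lemma kern_diag_bound s eps : (0 <= Re s)%R -> (0 < eps)%R ->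
  exists K, (0 <= K)%R /\ forall t, (0 <= t < PI)%R ->
    (Cmod (kern s s t - Cexp (s * RtoC (ln 2))) <= eps + K * (1 - cos t))%R.
Proof.
  intros Hs He. pose proof PI_RGT_0 as Hpi.
  assert (E0 : kern s s 0 = Cexp (s * RtoC (ln 2))).
  { unfold kern, cos_pow. rewrite cos_0, Cmult_0_r, Ccos_0. replace (1 + 1)%R with 2%R by ring. ring. }
  pose proof (kern_continuous s s 0 ltac:(lra)) as Hc.
  assert (Hc' : filterlim (fun t => Cmod (kern s s t - kern s s 0)) (locally 0%R) (locally 0%R)).
  { apply Cconv_Cmod; exact Hc. }
  destruct (proj1 (filterlim_locally _ _) Hc' (mkposreal eps He)) as [d Hd].
  set (m := Rmin d 1). assert (Hm : (0 < m <= 1)%R).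
  { unfold m. pose proof (cond_pos d). pose proof (Rmin_r d 1). split; auto. apply Rmin_glb_lt; lra. }
  assert (Hcm : (cos m < 1)%R).
  { rewrite <- cos_0. apply cos_decreasing_1; try lra. pose proof PI2_1; lra. }
  set (M := (exp (Re s * ln 2) * exp (Cmod s * PI) + Cmod (Cexp (s * RtoC (ln 2))))%R).
  assert (HM : (0 <= M)%R).
  { unfold M. pose proof (Cmod_ge_0 (Cexp (s * RtoC (ln 2)))). pose proof (exp_pos (Re s * ln 2)). pose proof (exp_pos (Cmod s * PI)). nra. }
  (* For t >= m one has 1 - cos t >= 1 - cos m, so K (1 - cos t) is at least the crude bound [M]. *)
  exists (M / (1 - cos m))%R. split.
  { apply Rdiv_le_0_compat; lra. }
  intros t Ht. pose proof (COS_bound t).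
  assert (P : (0 <= M / (1 - cos m))%R) by (apply Rdiv_le_0_compat; lra).
  destruct (Rlt_dec t m) as [Htm | Htm].
  - specialize (Hd t). rewrite E0 in Hd.
    assert (B : (Rabs (Cmod (kern s s t - Cexp (s * RtoC (ln 2))) - 0) < eps)%R).
    { apply Hd. change (Rabs (t - 0) < d)%R. rewrite Rminus_0_r, Rabs_pos_eq by lra. pose proof (Rmin_l d 1). fold m in H0. lra. }
    rewrite Rminus_0_r, Rabs_pos_eq in B by apply Cmod_ge_0. nra.
  - assert (cos t <= cos m)%R.
    { destruct (Req_dec t m) as [-> |]; [lra |]. left. apply cos_decreasing_1; try lra. }
    apply Rle_trans with M.
    + eapply Rle_trans; [apply Cmod_triangle |]. rewrite Cmod_opp. apply Rplus_le_compat_r, kern_bound; auto.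
    + apply Rle_trans with (M / (1 - cos m) * (1 - cos m))%R; [right; field; lra |]. 
      assert (M / (1 - cos m) * (1 - cos m) <= M / (1 - cos m) * (1 - cos t))%R by (apply Rmult_le_compat_l; lra). lra.
Qed.

(** Writing K (1 - cos t) as 2 K - K (1 + cos t) and multiplying by the weight, the majorant
    integrates to the truncated masses of orders n and n + 1. *)
Lemma kint_mass_bound s n eps K b : (0 <= b < PI)%R ->
  (forall t, (0 <= t < PI)%R -> (Cmod (kern s s t - Cexp (s * RtoC (ln 2))) <= eps + K * (1 - cos t))%R) ->
  (Cmod (kint (s + RtoC (INR n)) s b + - Cexp (s * RtoC (ln 2)) * kint (0 + RtoC (INR n)) 0 b)
   <= (eps + 2 * K) * Re (kint (0 + RtoC (INR n)) 0 b) - K * Re (kint (0 + RtoC (INR (S n))) 0 b))%R.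
Proof.
  intros Hb H.
  assert (Kr : forall m t, (0 <= t < PI)%R -> kern (0 + RtoC (INR m)) 0 t = RtoC ((1 + cos t) ^ m)).
  { intros m t Ht. unfold kern. rewrite cos_pow_add_nat by auto. unfold cos_pow. rewrite !Cmult_0_l, Cexp_0, Ccos_0. ring. }
  apply (Cmod_RInt_le (fun t => kern (s + RtoC (INR n)) s t + - Cexp (s * RtoC (ln 2)) * kern (0 + RtoC (INR n)) 0 t)
     (fun t => (eps + 2 * K) * Re (kern (0 + RtoC (INR n)) 0 t) - K * Re (kern (0 + RtoC (INR (S n))) 0 t))%R 0 b).
  - lra.
  - intros t Ht. pose proof (one_plus_cos_pos t ltac:(lra)) as Hc. rewrite !Kr by lra. rewrite !re_RtoC.
    unfold kern at 1. rewrite cos_pow_add_nat by lra.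
    replace (RtoC ((1 + cos t) ^ n) * cos_pow s t * Ccos (s * RtoC t) + - Cexp (s * RtoC (ln 2)) * RtoC ((1 + cos t) ^ n)) with
      (RtoC ((1 + cos t) ^ n) * (kern s s t - Cexp (s * RtoC (ln 2)))) by (unfold kern; ring).
    assert (P : (0 <= (1 + cos t) ^ n)%R) by (apply pow_le; lra).
    rewrite Cmod_mult, Cmod_R, Rabs_pos_eq by auto. specialize (H t ltac:(lra)). simpl pow.
    apply Rle_trans with ((1 + cos t) ^ n * (eps + K * (1 - cos t)))%R; [apply Rmult_le_compat_l; auto | right; ring].
  - apply Cis_RInt_plus; [| apply Cis_RInt_scal]; apply kint_correct; auto.
  - apply (is_RInt_minus (V := R_NormedModule)
       (fun t => (eps + 2 * K) * Re (kern (0 + RtoC (INR n)) 0 t))%R (fun t => K * Re (kern (0 + RtoC (INR (S n))) 0 t))%R);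
    apply (is_RInt_scal (V := R_NormedModule)), Cis_RInt_Re, kint_correct; auto.
Qed.

Lemma filterlim_Rmult_l {T : Type} {F : (T -> Prop) -> Prop} {FF : Filter F} (f : T -> R) c l :
  filterlim f F (locally l) -> filterlim (fun x => c * f x)%R F (locally (c * l)%R).
Proof.
  intros H. apply (filterlim_comp _ _ _ f (fun x => c * x)%R F (locally l)); auto.
  apply (filterlim_scal_r (V := R_NormedModule) c l).
Qed.

Lemma kint_lim_mass_bound s v n eps K : (0 <= Re s)%R -> kint_lim s s v ->
  (forall t, (0 <= t < PI)%R -> (Cmod (kern s s t - Cexp (s * RtoC (ln 2))) <= eps + K * (1 - cos t))%R) ->
  (Cmod (v * hprod (s + RtoC (INR n)) n / RtoC (INR (fact n)) + - Cexp (s * RtoC (ln 2)) * RtoC (wmass n))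
   <= (eps + 2 * K) * wmass n - K * wmass (S n))%R.
Proof.
  intros Hs Hv H.
  pose proof (kint_lim_family s v n ltac:(lra) Hv) as HA. pose proof (kint_lim_wmass n) as HW. pose proof (kint_lim_wmass (S n)) as HW'.
  set (A := v * hprod (s + RtoC (INR n)) n / RtoC (INR (fact n))) in *.
  assert (L1 : filterlim (fun b => Cmod (kint (s + RtoC (INR n)) s b + - Cexp (s * RtoC (ln 2)) * kint (0 + RtoC (INR n)) 0 b)) (at_left PI)
     (locally (Cmod (A + - Cexp (s * RtoC (ln 2)) * RtoC (wmass n))))).
  { eapply filterlim_comp; [apply Cconv_plus; [exact HA | apply Cconv_scal; exact HW] |].
    apply (filterlim_norm (V := C_NormedModule)). }
  assert (L2 : filterlim (fun b => (eps + 2 * K) * Re (kint (0 + RtoC (INR n)) 0 b) - K * Re (kint (0 + RtoC (INR (S n))) 0 b))%R (at_left PI)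
     (locally ((eps + 2 * K) * wmass n - K * wmass (S n))%R)).
  { apply Cconv_components in HW, HW'. destruct HW as [HW _], HW' as [HW' _].
    apply (filterlim_comp_2 (G := locally ((eps + 2 * K) * wmass n)%R) (H := locally (- (K * wmass (S n)))%R)
       (fun b => (eps + 2 * K) * Re (kint (0 + RtoC (INR n)) 0 b))%R (fun b => - (K * Re (kint (0 + RtoC (INR (S n))) 0 b)))%R Rplus).
    - apply filterlim_Rmult_l; exact HW.
    - apply (filterlim_ext (fun b => (- K) * Re (kint (0 + RtoC (INR (S n))) 0 b))%R); [intros; ring |].
      replace (- (K * wmass (S n)))%R with (- K * wmass (S n))%R by ring. apply filterlim_Rmult_l; exact HW'.
    - apply (filterlim_plus (V := R_NormedModule)). }
  eapply (filterlim_le (F := at_left PI) _ _ (Finite _) (Finite _) _ L1 L2).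
  Unshelve.
  generalize at_left_PI_pos. apply filter_imp. intros b Hb. apply kint_mass_bound; auto.
Qed.

(** Concentration gives v [q n] / PI -> 2^s, while Gauss's product gives [q n * gauss (2 * s) n] =
    4^s [gauss (2 * s) (2 * n)]. In the limit v 4^s / PI = 2^s after cancelling 1 / Gamma(2 s),
    which is nonzero because Re s > 0. *)
Lemma kint_lim_const_pos s : (0 < Re s)%R -> kint_lim s s (RtoC PI * Cexp (- (s * RtoC (ln 2)))).
Proof.
  intros Hs. destruct (kint_lim_exists s s ltac:(lra)) as [v Hv].
  replace (RtoC PI * Cexp (- (s * RtoC (ln 2)))) with v; auto.
  set (E := Cexp (s * RtoC (ln 2))). pose proof (Cexp_neq_0 (s * RtoC (ln 2))) as HE. fold E in HE.
  assert (Hpi : RtoC PI <> RtoC 0) by (apply RtoC_neq_0; pose proof PI_RGT_0; lra).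
  set (q := fun n => rising (2 * s + RtoC (INR n) + 1) n * RtoC (INR (fact n)) / RtoC (INR (fact (2 * n)))).
  assert (HA : forall n, v * hprod (s + RtoC (INR n)) n / RtoC (INR (fact n)) = v / RtoC PI * q n * RtoC (wmass n)).
  { intros n. unfold q. pose proof (hprod_rising n (s + RtoC (INR n))) as H.
    replace (2 * (s + RtoC (INR n)) - RtoC (INR n) + 1) with (2 * s + RtoC (INR n) + 1) in H by ring.
    rewrite <- H. unfold wmass. 
    assert (N1 : (2 : C) ^ n <> RtoC 0) by (apply Cpow_nz, RtoC_neq_0; lra). pose proof (INR_fact_C_neq_0 n) as N2.
    pose proof (INR_fact_C_neq_0 (2 * n)) as N3.
    rewrite RtoC_div, !RtoC_mult, !RtoC_pow.
    - field. auto.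
    - apply Rmult_integral_contrapositive_currified; apply pow_nonzero; [lra | apply INR_fact_neq_0]. }
  assert (Hlim : Cconv eventually (fun n => v / RtoC PI * q n) E).
  { apply Cconv_Cmod. apply filterlim_locally. intros eps.
    destruct (kern_diag_bound s (eps / 2) ltac:(lra)) as [K [HK HB]].
    { pose proof (cond_pos eps); lra. }
    destruct (nfloor_ex (2 * K / eps)) as [N [_ HN]].
    { apply Rdiv_le_0_compat; [lra | apply cond_pos]. }
    exists N. intros n Hn. change (Rabs (Cmod (v / RtoC PI * q n - E) - 0) < eps)%R.
    rewrite Rminus_0_r, Rabs_pos_eq by apply Cmod_ge_0.
    pose proof (kint_lim_mass_bound s v n _ K ltac:(lra) Hv HB) as B. rewrite HA in B. fold E in B.
    replace (v / RtoC PI * q n * RtoC (wmass n) + - E * RtoC (wmass n)) with ((v / RtoC PI * q n - E) * RtoC (wmass n)) in B by ring.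
    pose proof (wmass_pos n) as Pw. rewrite Cmod_mult, Cmod_R, (Rabs_pos_eq (wmass n)) in B by lra.
    pose proof (wmass_succ n) as Ws. set (x := INR (S n)) in *.
    assert (Hx : (INR N + 1 <= x)%R) by (unfold x; rewrite <- S_INR; apply le_INR; lia).
    assert (Hx0 : (0 < x)%R) by (pose proof (pos_INR N); lra).
    assert (Ws' : (wmass (S n) = (2 - / x) * wmass n)%R).
    { apply Rmult_eq_reg_l with x; [| lra]. rewrite Ws. field. lra. }
    rewrite Ws' in B.
    assert (B' : (Cmod (v / RtoC PI * q n - E) <= eps / 2 + K * / x)%R).
    { apply Rmult_le_reg_r with (wmass n); auto. eapply Rle_trans; [exact B |]. right. ring. }
    pose proof (cond_pos eps) as Pe.
    assert (K * / x < eps / 2)%R.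
    { apply Rmult_lt_reg_r with x; auto. replace (K * / x * x)%R with K by (field; lra).
      assert (2 * K < eps * x)%R; [| lra].
      apply Rmult_lt_reg_r with (/ eps)%R; [apply Rinv_0_lt_compat; auto |].
      replace (eps * x * / eps)%R with x by (field; lra). unfold Rdiv in HN. lra. }
    lra. }
  assert (G : v / RtoC PI * (E * E * rGamma (2 * s)) = E * rGamma (2 * s)).
  { apply (Cconv_unique (F := eventually) (fun n => v / RtoC PI * (E * E * gauss (2 * s) (2 * n)))).
    - apply Cconv_scal, Cconv_scal. eapply filterlim_comp; [| apply (rGamma_limit (2 * s))].
      intros P [N HN]. exists N. intros n Hn. apply HN. lia.
    - apply (Cconv_ext_loc (fun n => v / RtoC PI * q n * gauss (2 * s) n)); [| apply Cconv_mult; [exact Hlim | apply rGamma_limit]].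
      exists 1%nat. intros n Hn. rewrite !gauss_eq by lia. 
      replace (S (2 * n)) with (S n + n)%nat by lia. rewrite (rising_add (2 * s) (S n) n).
      unfold q. replace (2 * s + RtoC (INR (S n))) with (2 * s + RtoC (INR n) + 1) by (rewrite S_INR, RtoC_plus; ring).
      assert (Pn : (0 < INR n)%R) by (apply lt_0_INR; lia).
      rewrite mult_INR. change (INR 2) with 2%R. rewrite ln_mult, RtoC_plus by lra.
      replace (- (2 * s * (RtoC (ln 2) + RtoC (ln (INR n))))) with
        (- (s * RtoC (ln 2)) + - (s * RtoC (ln 2)) + - (2 * s * RtoC (ln (INR n)))) by ring.
      rewrite !Cexp_plus, (Cexp_opp (s * RtoC (ln 2))). fold E.
      pose proof (INR_fact_C_neq_0 n) as N2. pose proof (INR_fact_C_neq_0 (2 * n)) as N3. field. auto. }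
  assert (Hg : rGamma (2 * s) <> RtoC 0).
  { apply rGamma_neq_0. intros k. apply Re_neq_0. simpl. pose proof (pos_INR k). unfold Re in *. lra. }
  rewrite Cexp_opp. fold E. set (g := rGamma (2 * s)) in *.
  transitivity (RtoC PI / (E * E * g) * (v / RtoC PI * (E * E * g))); [field; auto |].
  rewrite G. field. auto.
Qed.

(** One step down from s + 1 reaches the exponents with Re s <= 0, where the kernel may be unbounded
    or 1 / Gamma(2 s) zero. *)
Lemma kint_lim_const s : (- / 2 < Re s)%R -> kint_lim s s (RtoC PI * Cexp (- (s * RtoC (ln 2)))).
Proof.
  intros Hs.
  pose proof (kint_lim_const_pos (s + 1)) as H. pose proof (kint_lim_lower s _ Hs (H ltac:(simpl; unfold Re in *; lra))) as K.
  replace (RtoC PI * Cexp (- (s * RtoC (ln 2)))) with (2 * (RtoC PI * Cexp (- ((s + 1) * RtoC (ln 2))))); auto.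
  replace (- ((s + 1) * RtoC (ln 2))) with (- (s * RtoC (ln 2)) + - RtoC (ln 2)) by ring.
  rewrite Cexp_plus, (Cexp_opp (RtoC (ln 2))), Cexp_RtoC, exp_ln by lra. field.
Qed.

(** * The finite sum and termwise integration *)

(** For l = 0 this is the duplication formula at mu + 1/2. It converts the quotient of Gamma values
    in the finite sum into [bcoef] without dividing by anything. *)
Lemma bcoef_duplication l : forall mu,
  Cexp (2 * mu * RtoC (ln 2)) * RtoC (/ sqrt PI) * rGamma (2 * mu + RtoC (INR l) + 1) * 2 ^ l
  = bcoef mu l * rGamma (mu + RtoC (INR l) + 1 / 2).
Proof.
  induction l; intros mu.
  - rewrite bcoef_0. simpl. rewrite !Cplus_0_r.
    pose proof (rGamma_duplication (mu + 1 / 2)) as H.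
    replace (mu + 1 / 2 + 1 / 2) with (mu + 1) in H by field.
    replace (2 * (mu + 1 / 2) * RtoC (ln 2)) with (2 * mu * RtoC (ln 2) + RtoC (ln 2)) in H by field.
    replace (2 * (mu + 1 / 2)) with (2 * mu + 1) in H by field.
    rewrite Cexp_plus, Cexp_RtoC, exp_ln in H by lra.
    rewrite (Cmult_comm (rGamma (mu + 1))), H.
    replace (RtoC (/ sqrt PI)) with (2 * RtoC (/ (2 * sqrt PI))).
    + ring.
    + rewrite <- RtoC_mult. f_equal. field. apply Rgt_not_eq, sqrt_lt_R0, PI_RGT_0.
  - rewrite bcoef_succ. specialize (IHl (mu + 1)).
    rewrite S_INR, RtoC_plus, Cpow_S.
    replace (mu + (RtoC (INR l) + 1) + 1 / 2) with (mu + 1 + RtoC (INR l) + 1 / 2) by ring.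
    transitivity ((mu + 1 + RtoC (INR l) / 2) * (bcoef (mu + 1) l * rGamma (mu + 1 + RtoC (INR l) + 1 / 2))); [| ring].
    rewrite <- IHl.
    replace (2 * (mu + 1) * RtoC (ln 2)) with (2 * mu * RtoC (ln 2) + RtoC (ln 2) + RtoC (ln 2)) by ring.
    rewrite !Cexp_plus, Cexp_RtoC, exp_ln by lra.
    rewrite (rGamma_rec (2 * mu + (RtoC (INR l) + 1) + 1)).
    replace (2 * mu + (RtoC (INR l) + 1) + 1 + 1) with (2 * (mu + 1) + RtoC (INR l) + 1) by ring. field.
Qed.

Lemma rGamma_half_minus q :
  rGamma (1 / 2 - RtoC (INR q)) = (- (1)) ^ q * RtoC (INR (fact (2 * q))) / (RtoC (INR (fact q)) * 4 ^ q) * RtoC (/ sqrt PI).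
Proof.
  induction q.
  - simpl. replace (1 / 2 - 0) with (1 / 2) by ring. rewrite rGamma_half. field.
  - rewrite rGamma_rec. replace (1 / 2 - RtoC (INR (S q)) + 1) with (1 / 2 - RtoC (INR q)) by (rewrite S_INR, RtoC_plus; ring).
    rewrite IHq. replace (2 * S q)%nat with (S (S (2 * q))) by lia. rewrite !fact_S_C, !Cpow_S.
    replace (RtoC (INR (S (S (2 * q))))) with (2 * RtoC (INR (S q))) by (rewrite <- RtoC_mult; f_equal; rewrite !S_INR, mult_INR; simpl (INR 2); ring).
    replace (RtoC (INR (S (2 * q)))) with (2 * RtoC (INR (S q)) - 1) by (rewrite <- RtoC_mult, <- RtoC_minus; f_equal; rewrite !S_INR, mult_INR; simpl (INR 2); ring).
    pose proof (INR_fact_C_neq_0 q). pose proof (INR_S_C_neq_0 q). 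
    assert ((4 : C) ^ q <> RtoC 0) by (apply Cpow_nz, RtoC_neq_0; lra). field. auto.
Qed.

(** The value at mu = m + 1/2 with m = - (l + 1 + p), where both Gammas of the finite sum have
    poles. It comes from the values of 1 / Gamma at half-integers. *)
Lemma bcoef_half_neg l : forall p,
  bcoef (1 / 2 - RtoC (INR (l + 1 + p))) l =
  2 ^ l * (- (1)) ^ (l + p) * RtoC (INR (fact (l + 2 * p))) / (RtoC (INR (fact p)) * 4 ^ (l + p)) * RtoC (/ sqrt PI).
Proof.
  induction l; intros p.
  - rewrite bcoef_0. replace (1 / 2 - RtoC (INR (0 + 1 + p)) + 1) with (1 / 2 - RtoC (INR p)) by (simpl (0 + 1 + p)%nat; rewrite S_INR, RtoC_plus; ring).
    rewrite rGamma_half_minus. simpl (0 + _)%nat. change (Cpow 2 0) with (RtoC 1). rewrite Cmult_1_l. reflexivity.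
  - rewrite bcoef_succ. replace (1 / 2 - RtoC (INR (S l + 1 + p)) + 1) with (1 / 2 - RtoC (INR (l + 1 + p))).
    2: { change (S l + 1 + p)%nat with (S (l + 1 + p)). rewrite S_INR, RtoC_plus; ring. }
    rewrite IHl. change (S l + p)%nat with (S (l + p)). change (S l + 2 * p)%nat with (S (l + 2 * p)).
    rewrite fact_S_C, !Cpow_S.
    replace (1 / 2 - RtoC (INR (l + 1 + p)) + RtoC (INR l) / 2) with (- (RtoC (INR (S (l + 2 * p))) / 2)).
    2: { rewrite S_INR, !plus_INR, mult_INR. simpl (INR 1). simpl (INR 2). rewrite !RtoC_plus, RtoC_mult, RtoC_plus. field. }
    pose proof (INR_fact_C_neq_0 p). 
    assert ((4 : C) ^ (l + p) <> RtoC 0) by (apply Cpow_nz, RtoC_neq_0; lra). field. auto.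
Qed.

Lemma nearest_spec x n : (IZR n - / 2 < x <= IZR n + / 2)%R -> nearest x = n.
Proof.
  intros H. unfold nearest. apply Zceil_eq. lra.
Qed.

Lemma CGamma_nat n : CGamma (RtoC (INR (S n))) = RtoC (INR (fact n)).
Proof. unfold CGamma. rewrite rGamma_nat. pose proof (INR_fact_C_neq_0 n). field. auto. Qed.

(* Includes the degenerate case mu = m + 1/2, where the limit value of the ratio is
   exactly what the entire form of bcoef gives. *)
Lemma Gamma_ratio_bcoef mu l : (l < Z.to_nat (- nearest (Re mu)))%nat ->
  Gamma_ratio mu (S l) * RtoC (/ sqrt PI) * Cexp (2 * mu * RtoC (ln 2)) * 2 ^ l = bcoef mu l.
Proof.
  intros Hl. unfold Gamma_ratio. set (m := nearest (Re mu)) in *.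
  assert (Hm : (m < 0)%Z) by lia.
  destruct (Ceq_dec mu (RtoC (IZR m) + 1 / 2)) as [E | E].
  - destruct (Z_lt_dec m 0) as [_ | F]; [| contradiction].
    (* The number of terms of the finite sum that follow term l. *)
    set (p := (Z.to_nat (- m) - l - 1)%nat).
    assert (Ep : m = (- Z.of_nat (l + 1 + p))%Z) by lia.
    rewrite Ep.
    replace (- Z.of_nat (S l) - 2 * - Z.of_nat (l + 1 + p))%Z with (Z.of_nat (S (l + 2 * p))) by lia.
    replace (- Z.of_nat (S l) - - Z.of_nat (l + 1 + p) + 1)%Z with (Z.of_nat (S p)) by lia.
    rewrite <- !INR_IZR_INZ, !CGamma_nat.
    replace (- Z.of_nat (l + 1 + p) + 1)%Z with (- Z.of_nat (l + p))%Z by lia.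
    rewrite E, Ep, opp_IZR, <- INR_IZR_INZ, RtoC_opp.
    replace (- RtoC (INR (l + 1 + p)) + 1 / 2) with (1 / 2 - RtoC (INR (l + 1 + p))) by ring.
    rewrite bcoef_half_neg.
    replace (RtoC (powerRZ (-1) (- Z.of_nat (l + p)))) with ((- (1)) ^ (l + p)).
    2: { rewrite powerRZ_neg', <- pow_powerRZ, <- pow_inv, RtoC_pow. f_equal.
         replace (/ -1)%R with (- (1))%R by field. rewrite RtoC_opp. reflexivity. }
    replace (2 * (1 / 2 - RtoC (INR (l + 1 + p))) * RtoC (ln 2)) with (RtoC (ln 2) + - (RtoC (INR (l + 1 + p)) * RtoC (ln 4))).
    2: { replace 4%R with (2 * 2)%R by ring. rewrite ln_mult, RtoC_plus by lra. field. }
    rewrite Cexp_plus, Cexp_opp, Cexp_INR, !Cexp_RtoC, !exp_ln by lra.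
    replace (l + 1 + p)%nat with (S (l + p)) by lia. rewrite Cpow_S.
    pose proof (INR_fact_C_neq_0 p). 
    assert ((4 : C) ^ (l + p) <> RtoC 0) by (apply Cpow_nz, RtoC_neq_0; lra). field. auto.
  - unfold CGamma. pose proof (bcoef_duplication l mu) as H.
    replace (RtoC (INR (S l)) + mu - 1 / 2) with (mu + RtoC (INR l) + 1 / 2) by (rewrite S_INR, RtoC_plus; field).
    replace (RtoC (INR (S l)) + 2 * mu) with (2 * mu + RtoC (INR l) + 1) by (rewrite S_INR, RtoC_plus; ring).
    (* A pole of the numerator would mean mu = - (l + k + 1) + 1/2 for some k. As [nearest] rounds
       halves down, m would then be - (l + k + 1), which is the case excluded by [E]. *)
    assert (N : rGamma (mu + RtoC (INR l) + 1 / 2) <> RtoC 0).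
    { apply rGamma_neq_0. intros k Hk. apply E.
      assert (Emu : mu = RtoC (IZR (- Z.of_nat (l + k + 1))) + 1 / 2).
      { rewrite opp_IZR, <- INR_IZR_INZ, !plus_INR, RtoC_opp, !RtoC_plus. simpl (INR 1).
        transitivity (mu + RtoC (INR l) + 1 / 2 + RtoC (INR k) - RtoC (INR l) - RtoC (INR k) - 1 / 2); [ring |]. rewrite Hk. field. }
      replace m with (- Z.of_nat (l + k + 1))%Z; auto.
      symmetry. apply nearest_spec. rewrite Emu.
      replace (RtoC (IZR (- Z.of_nat (l + k + 1))) + 1 / 2) with (RtoC (IZR (- Z.of_nat (l + k + 1)) + / 2)) by (rewrite RtoC_plus, RtoC_inv by lra; field).
      rewrite re_RtoC. lra. }
    transitivity (/ rGamma (mu + RtoC (INR l) + 1 / 2) * (Cexp (2 * mu * RtoC (ln 2)) * RtoC (/ sqrt PI) * rGamma (2 * mu + RtoC (INR l) + 1) * 2 ^ l)); [ring |].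
    rewrite H. field. auto.
Qed.

(** * Dominated termwise integration up to PI *)

Lemma ex_series_rGamma (a w : C) : ex_series (fun k => Cmod (w ^ k * rGamma (a + RtoC (INR k) + 1))).
Proof.
  destruct (nfloor_ex (Cmod a + 2 * Cmod w)) as [N [_ HN]].
  { pose proof (Cmod_ge_0 a); pose proof (Cmod_ge_0 w); lra. }
  apply (ex_series_ratio_half _ N).
  { intros n. apply Cmod_ge_0. }
  intros n Hn. apply le_INR in Hn.
  rewrite (rGamma_rec (a + RtoC (INR n) + 1)), S_INR, RtoC_plus, Cpow_S.
  replace (a + (RtoC (INR n) + 1) + 1) with (a + RtoC (INR n) + 1 + 1) by ring.
  set (g := rGamma (a + RtoC (INR n) + 1 + 1)). rewrite !Cmod_mult.
  pose proof (Cmod_sub_le (RtoC (INR n + 1)) a) as L. pose proof (pos_INR n).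
  rewrite Cmod_R, Rabs_pos_eq in L by lra.
  replace (RtoC (INR n + 1) + a) with (a + RtoC (INR n) + 1) in L by (rewrite RtoC_plus; ring).
  assert (2 * Cmod w <= Cmod (a + RtoC (INR n) + 1))%R by lra.
  assert (0 <= Cmod (w ^ n) * Cmod g)%R by (apply Rmult_le_pos; apply Cmod_ge_0). nra.
Qed.

Fixpoint rsum (u : nat -> R) (n : nat) : R := match n with O => 0%R | S p => (rsum u p + u p)%R end.

Lemma rsum_limit u : ex_series u -> exists l : R, is_lim_seq (rsum u) l.
Proof.
  intros [l H]. exists l. apply is_lim_seq_incr_1.
  eapply is_lim_seq_ext; [| exact H]. intros n. induction n.
  - rewrite sum_O. simpl. symmetry. apply Rplus_0_l.
  - rewrite sum_Sn, IHn. reflexivity.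
Qed.

Lemma csum_diff_le (u : nat -> C) M n p : (forall k, Cmod (u k) <= M k)%R -> (n <= p)%nat ->
  (Cmod (csum u p - csum u n) <= rsum M p - rsum M n)%R.
Proof.
  intros H0 H. induction H.
  - replace (csum u n - csum u n) with (RtoC 0) by ring. rewrite Cmod_0. lra.
  - simpl. replace (csum u m + u m - csum u n) with (csum u m - csum u n + u m) by ring.
    eapply Rle_trans; [apply Cmod_triangle |]. pose proof (H0 m). lra.
Qed.

Lemma Cconv_Cmod_le (u : nat -> C) (s : C) (B : R) N :
  (forall n, (N <= n)%nat -> (Cmod (u n) <= B)%R) -> Cconv eventually u s -> (Cmod s <= B)%R.
Proof.
  intros HB Hs.
  assert (L : filterlim (fun n => Cmod (u n)) eventually (locally (Cmod s))).
  { eapply filterlim_comp; [exact Hs | apply (filterlim_norm (V := C_NormedModule))]. }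
  apply (is_lim_seq_le_loc (fun n => Cmod (u n)) (fun _ => B) (Cmod s) B); auto.
  - exists N. exact HB.
  - apply is_lim_seq_const.
Qed.

(** The bound depends on the series only through the majorant [M], so it is uniform in any parameter
    of u. *)
Lemma series_tail_le (u : nat -> C) (s : C) M (l : R) n : (forall k, Cmod (u k) <= M k)%R ->
  is_lim_seq (rsum M) l -> Cis_series u s -> (Cmod (s - csum u n) <= l - rsum M n)%R.
Proof.
  intros H0 HM Hs. apply Cis_series_csum in Hs.
  assert (Mpos : forall k, (0 <= M k)%R) by (intros k; eapply Rle_trans; [apply Cmod_ge_0 | apply H0]).
  apply (Cconv_Cmod_le (fun p => csum u p + - csum u n) (s - csum u n) _ n).
  - intros p Hp. eapply Rle_trans; [apply csum_diff_le; eauto |].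
    apply Rplus_le_compat_r. apply (is_lim_seq_incr_compare (rsum M) l HM).
    intros k. simpl. pose proof (Mpos k). lra.
  - apply Cconv_plus; [exact Hs | apply Cconv_const].
Qed.

(** Freezing functions outside [a, b] turns uniform convergence on the interval into uniform
    convergence on the whole line, the form in which [filterlim_RInt] asks for it. *)
Definition clamp (a b t : R) : R := Rmax a (Rmin b t).

Lemma clamp_in a b t : (a <= b)%R -> (a <= clamp a b t <= b)%R.
Proof.
  intros H. unfold clamp. split; [apply Rmax_l |]. apply Rmax_lub; auto. apply Rmin_l.
Qed.

Lemma clamp_id a b t : (a <= t <= b)%R -> clamp a b t = t.
Proof. intros H. unfold clamp. rewrite Rmin_right, Rmax_right; lra. Qed.

Lemma Cis_RInt_uniform_limit (f : nat -> R -> C) (g : R -> C) (h : nat -> C) (e : nat -> R) a b : (a <= b)%R ->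
  (forall n, Cis_RInt (f n) a b (h n)) -> is_lim_seq e 0%R ->
  (forall n t, (a <= t <= b)%R -> (Cmod (f n t - g t) <= e n)%R) ->
  exists I : C, Cconv eventually h I /\ Cis_RInt g a b I.
Proof.
  intros Hab Hf He Hb.
  destruct (filterlim_RInt (V := C_R_CompleteNormedModule) (fun n t => f n (clamp a b t)) a b eventually _
    (fun t => g (clamp a b t)) h) as [I [H1 H2]].
  - intros n. eapply Cis_RInt_ext; [exact Hab | | apply Hf]. intros t Ht. simpl. rewrite clamp_id; [reflexivity | lra].
  - apply filterlim_locally. intros eps.
    destruct (proj2 (is_lim_seq_spec e 0%R) He eps) as [N HN]. exists N. intros n Hn t.
    apply C_NormedModule_mixin_compat1.
    change (Cmod (f n (clamp a b t) - g (clamp a b t)) < eps)%R.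
    eapply Rle_lt_trans; [apply Hb, clamp_in; auto |].
    specialize (HN n Hn). rewrite Rminus_0_r in HN. eapply Rle_lt_trans; [apply Rle_abs | exact HN].
  - exists I. split; [exact H1 |].
    eapply Cis_RInt_ext; [exact Hab | | exact H2]. intros t Ht. simpl. rewrite clamp_id; [reflexivity | lra].
Qed.

Lemma Cis_RInt_csum (g : nat -> R -> C) (G : nat -> C) a b n :
  (forall k, Cis_RInt (g k) a b (G k)) -> Cis_RInt (fun t => csum (fun k => g k t) n) a b (csum G n).
Proof.
  intros H. induction n; simpl.
  - evar_last; [apply (is_RInt_const (V := C_R_NormedModule)) |].
    rewrite scal_R_Cmult. apply Cmult_0_r.
  - apply Cis_RInt_plus; auto.
Qed.

Lemma csum_Cconv {T : Type} {F : (T -> Prop) -> Prop} {FF : Filter F} (G : nat -> T -> C) (L : nat -> C) n :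
  (forall k, Cconv F (G k) (L k)) -> Cconv F (fun b => csum (fun k => G k b) n) (csum L n).
Proof.
  intros H. induction n; simpl; [apply Cconv_const | apply Cconv_plus; auto].
Qed.

(** The majorant acts twice. Uniformly in t, it allows integration over [0, b] term by term;
    uniformly in b, it lets the limit b -> PI pass through the sum, since both [G k b] and [L k] are
    bounded by PI [M k]. *)
Lemma series_RInt_exchange (g : nat -> R -> C) (G : nat -> R -> C) (L : nat -> C) (f : R -> C) (M : nat -> R) :
  (forall k b, (0 <= b < PI)%R -> Cis_RInt (g k) 0 b (G k b)) ->
  (forall k, Cconv (at_left PI) (G k) (L k)) ->
  (forall t, (0 <= t < PI)%R -> Cis_series (fun k => g k t) (f t)) ->
  (forall k t, (0 <= t < PI)%R -> (Cmod (g k t) <= M k)%R) -> ex_series M ->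
  exists (Phi : R -> C) (S : C), (forall b, (0 <= b < PI)%R -> Cis_RInt f 0 b (Phi b)) /\ Cconv (at_left PI) Phi S /\ Cis_series L S.
Proof.
  intros HG HL Hf HM Mex. pose proof PI_RGT_0 as Hpi.
  destruct (rsum_limit M Mex) as [l Hl].
  assert (Htail : is_lim_seq (fun n => l - rsum M n)%R 0%R).
  { replace 0%R with (l - l)%R by ring. apply is_lim_seq_minus'; [apply is_lim_seq_const | exact Hl]. }
  assert (HGb : forall k b, (0 <= b < PI)%R -> (Cmod (G k b) <= PI * M k)%R).
  { intros k b Hb.
    assert (0 <= M k)%R by (eapply Rle_trans; [apply Cmod_ge_0 | apply (HM k b Hb)]).
    apply Rle_trans with ((b - 0) * M k)%R; [| apply Rmult_le_compat_r; lra].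
    apply (Cmod_RInt_le (g k) (fun _ => M k) 0 b); [lra | intros t Ht; apply HM; lra | auto |].
    apply (is_RInt_const (V := R_NormedModule)). }
  assert (HLb : forall k, (Cmod (L k) <= PI * M k)%R).
  { intros k. 
    assert (L1 : filterlim (fun b => Cmod (G k b)) (at_left PI) (locally (Cmod (L k)))).
    { eapply filterlim_comp; [apply HL | apply (filterlim_norm (V := C_NormedModule))]. }
    apply (filterlim_le (F := at_left PI) (fun b => Cmod (G k b)) (fun _ => PI * M k)%R (Finite _) (Finite _)); auto.
    - generalize at_left_PI_pos. apply filter_imp. intros b Hb. auto.
    - apply filterlim_const. }
  assert (Hl' : is_lim_seq (rsum (fun k => PI * M k)%R) (PI * l)%R).
  { apply (is_lim_seq_ext (fun n => PI * rsum M n)%R).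
    - intros n. induction n; simpl; [ring | rewrite <- IHn; ring].
    - apply (is_lim_seq_scal_l _ PI l). exact Hl. }
  destruct (Cex_series_abs L) as [S HS].
  { apply (ex_series_le (V := R_CompleteNormedModule) _ (fun k => PI * M k)%R).
    - intros k. change (norm (Cmod (L k))) with (Rabs (Cmod (L k))). rewrite Rabs_pos_eq by apply Cmod_ge_0. apply HLb.
    - apply (ex_series_scal (V := R_NormedModule) PI M Mex). }
  assert (HPhi : forall b, (0 <= b < PI)%R -> exists I : C, Cis_series (fun k => G k b) I /\ Cis_RInt f 0 b I).
  { intros b Hb.
    destruct (Cis_RInt_uniform_limit (fun n t => csum (fun k => g k t) n) f (fun n => csum (fun k => G k b) n) (fun n => l - rsum M n)%R 0 b) as [I [H1 H2]]; auto.
    - lra.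
    - intros n. apply Cis_RInt_csum. intros k; auto.
    - intros n t Ht. rewrite <- Cmod_opp. replace (- (csum (fun k => g k t) n - f t)) with (f t - csum (fun k => g k t) n) by ring.
      apply series_tail_le; auto; [intros k; apply HM; lra | apply Hf; lra].
    - exists I. split; [apply Cis_series_csum; exact H1 | exact H2]. }
  set (Phi := fun b => @RInt C_R_CompleteNormedModule f 0 b).
  assert (HPhi' : forall b, (0 <= b < PI)%R -> Cis_series (fun k => G k b) (Phi b) /\ Cis_RInt f 0 b (Phi b)).
  { intros b Hb. destruct (HPhi b Hb) as [I [H1 H2]].
    assert (E : Phi b = I) by (apply (is_RInt_unique (V := C_R_CompleteNormedModule)); exact H2).
    rewrite E. auto. }
  exists Phi, S. split; [intros b Hb; apply HPhi'; auto | split; [| exact HS]].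
  apply Cconv_Cmod. apply filterlim_locally. intros eps. pose proof (cond_pos eps) as He.
  destruct (proj2 (is_lim_seq_spec _ 0%R) Htail (mkposreal (eps / (4 * PI)) ltac:(apply Rdiv_lt_0_compat; lra))) as [N HN].
  specialize (HN N (le_n N)). simpl in HN. rewrite Rminus_0_r in HN.
  assert (HN' : (PI * l - rsum (fun k => PI * M k) N < eps / 4)%R).
  { assert (E : rsum (fun k => PI * M k)%R N = (PI * rsum M N)%R).
    { clear. induction N; simpl; [ring | rewrite IHN; ring]. }
    rewrite E. apply Rle_lt_trans with (PI * Rabs (l - rsum M N))%R.
    - pose proof (Rle_abs (l - rsum M N)). nra.
    - apply Rmult_lt_reg_l with (/ PI)%R; [apply Rinv_0_lt_compat; auto |].
      replace (/ PI * (PI * Rabs (l - rsum M N)))%R with (Rabs (l - rsum M N)) by (field; lra).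
      replace (/ PI * (eps / 4))%R with (eps / (4 * PI))%R by (field; lra). exact HN. }
  pose proof (csum_Cconv (F := at_left PI) G L N HL) as HC. apply Cconv_Cmod in HC.
  pose proof (proj1 (filterlim_locally _ _) HC (mkposreal (eps / 2) ltac:(lra))) as HE.
  generalize (filter_and _ _ at_left_PI_pos HE). apply filter_imp. intros b [Hb HbE].
  change (Rabs (Cmod (csum (fun k => G k b) N - csum L N) - 0) < eps / 2)%R in HbE.
  change (Rabs (Cmod (Phi b - S) - 0) < eps)%R.
  rewrite Rminus_0_r, Rabs_pos_eq in * by apply Cmod_ge_0.
  pose proof (series_tail_le _ _ _ _ N (fun k => HGb k b Hb) Hl' (proj1 (HPhi' b Hb))) as T1.
  pose proof (series_tail_le _ _ _ _ N HLb Hl' HS) as T2.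
  (* The two tails are below eps / 4 each, the difference of the finite sums is below eps / 2 for b
     near PI. *)
  replace (Phi b - S) with ((Phi b - csum (fun k => G k b) N) + ((csum (fun k => G k b) N - csum L N) + - (S - csum L N))) by ring.
  eapply Rle_lt_trans; [apply Cmod_triangle |].
  eapply Rle_lt_trans; [apply Rplus_le_compat_l, Cmod_triangle |]. rewrite Cmod_opp. lra.
Qed.

(** * The integral representation *)

Ltac as_eq T := match goal with |- ?x = ?y => change (@eq T x y) end.

Lemma fracpart_eq mu : mu = fracpart mu + RtoC (IZR (nearest (Re mu))).
Proof. unfold fracpart. ring. Qed.

Lemma Re_fracpart mu : (- / 2 < Re (fracpart mu) <= / 2)%R.
Proof.
  unfold fracpart, nearest. pose proof (Zceil_bound (Re mu - 1 / 2)) as H.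
  unfold Cminus. rewrite re_plus, re_opp, re_RtoC. lra.
Qed.

Lemma Re_fracpart_nat mu k : (- / 2 < Re (fracpart mu + RtoC (INR k)))%R.
Proof. rewrite re_plus, re_RtoC. pose proof (Re_fracpart mu). pose proof (pos_INR k). lra. Qed.

(* The integral of [(1 + cos t)^s cos ((s - d) t)] over [0, PI]. *)
Definition cos_integral (s : C) (d : Z) : C :=
  if Z_lt_dec d 0 then 0 else
  RtoC PI * Cexp (- (s * RtoC (ln 2))) * 2 ^ Z.to_nat d * hprod s (Z.to_nat d) / RtoC (INR (fact (Z.to_nat d))).

Lemma kint_lim_cos_integral s d : (- / 2 < Re s)%R -> kint_lim s (s - RtoC (IZR d)) (cos_integral s d).
Proof.
  intros Hs. unfold cos_integral. destruct (Z_lt_dec d 0) as [Hd | Hd].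
  - replace (s - RtoC (IZR d)) with (s + 1 + RtoC (INR (Z.to_nat (- d - 1)))); [apply kint_lim_zero; auto |].
    rewrite INR_IZR_INZ, Z2Nat.id, minus_IZR, opp_IZR, RtoC_minus, RtoC_opp by lia. ring.
  - replace (IZR d) with (INR (Z.to_nat d)) by (rewrite INR_IZR_INZ, Z2Nat.id by lia; reflexivity).
    apply kint_lim_coef, kint_lim_const; auto.
Qed.

(** The 2^(-l) contained in 2^(-s) cancels the 2^l of the binomial coefficient; what is left is the
    l-th coefficient of the confluent series. *)
Lemma rGamma_cos_integral mu l :
  rGamma (mu + RtoC (INR l) + 1) * cos_integral (mu + RtoC (INR l)) (Z.of_nat l)
  = RtoC PI * Cexp (- (mu * RtoC (ln 2))) * (bcoef mu l / RtoC (INR (fact l))).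
Proof.
  unfold cos_integral. destruct (Z_lt_dec (Z.of_nat l) 0) as [H | _]; [lia |]. rewrite Nat2Z.id. unfold bcoef.
  replace (- ((mu + RtoC (INR l)) * RtoC (ln 2))) with (- (mu * RtoC (ln 2)) + - (RtoC (INR l) * RtoC (ln 2))) by ring.
  rewrite Cexp_plus, (Cexp_opp (RtoC (INR l) * RtoC (ln 2))), Cexp_INR, Cexp_RtoC, exp_ln by lra.
  pose proof (INR_fact_C_neq_0 l). assert ((2 : C) ^ l <> RtoC 0) by (apply Cpow_nz, RtoC_neq_0; lra). field. auto.
Qed.

Lemma gammastar_series (a w S : C) : Cis_series (fun k => w ^ k * rGamma (a + RtoC (INR k) + 1)) S ->
  gammastar a w = Cexp (- w) * S.
Proof. intros H. unfold gammastar. rewrite (CSeries_unique _ _ H). reflexivity. Qed.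

(** The factor e^(-w) of [gammastar], with w = - i z (1 + cos t), turns e^(- i z cos t) into the
    constant e^(iz), so no exponential in t remains to be integrated. *)
Lemma integrand_series (mu z : C) t : (0 <= t < PI)%R ->
  Cis_series (fun k => Cexp (Ci * z) * Cexp (- (Ci * RtoC PI * fracpart mu / 2)) * Cpower z (fracpart mu)
      * ((- Ci * z) ^ k * rGamma (fracpart mu + RtoC (INR k) + 1)) * kern (fracpart mu + RtoC (INR k)) mu t)
    (integrand mu z t).
Proof.
  intros Ht. set (a := fracpart mu). set (w := - Ci * RtoC (1 + cos t) * z).
  pose proof (one_plus_cos_pos t Ht) as Hc.
  destruct (Cex_series_abs _ (ex_series_rGamma a w)) as [S HS].
  assert (E : integrand mu z t = Cexp (Ci * z) * Cexp (- (Ci * RtoC PI * a / 2)) * Cpower z a * kern a mu t * S).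
  { unfold integrand. fold a. unfold Pgamma_mi. fold w. rewrite (gammastar_series a w S HS).
    unfold power_mi, kern, cos_pow. rewrite (Cpower_pos _ a Hc).
    replace (Cexp (Ci * z)) with (Cexp (- (Ci * z * RtoC (cos t))) * Cexp (- w)).
    - ring.
    - rewrite <- Cexp_plus. f_equal. unfold w. rewrite RtoC_plus. ring. }
  rewrite E. eapply (is_series_ext (V := C_NormedModule)); [| apply Cis_series_scal; exact HS].
  intros k. simpl. unfold kern. rewrite (cos_pow_add_nat a k t Ht), RtoC_pow. unfold w.
  replace (- Ci * RtoC (1 + cos t) * z) with (- Ci * z * RtoC (1 + cos t)) by ring. rewrite (Cpow_mult_l (- Ci * z)). 
  set (q := Cpow (RtoC (1 + cos t)) k).
  as_eq C. ring.
Qed.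

(** The bound 2^(Re a + k) for the power merges with |z|^k, which leads to the series of
    [ex_series_rGamma] at - 2 i z. The index starts at 1 because [kern_bound] asks for a nonnegative
    real part. *)
Lemma ex_series_exchange_bound (a mu z c : C) :
  ex_series (fun k => Cmod (c * ((- Ci * z) ^ S k * rGamma (a + RtoC (INR (S k)) + 1)))
     * (exp (Re (a + RtoC (INR (S k))) * ln 2) * exp (Cmod mu * PI)))%R.
Proof.
  apply (ex_series_ext (fun k => Cmod c * exp (Re a * ln 2) * exp (Cmod mu * PI) *
     Cmod ((2 * (- Ci * z)) ^ S k * rGamma (a + RtoC (INR (S k)) + 1)))%R).
  - intros k. rewrite re_plus, re_RtoC, Rmult_plus_distr_r, exp_plus.
    replace (exp (INR (S k) * ln 2)) with (2 ^ S k)%R.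
    + rewrite (Cpow_mult_l 2), !Cmod_mult, (Cmod_pow 2), Cmod_R, Rabs_pos_eq by lra. as_eq R. ring.
    + rewrite <- Rpower_pow by lra. reflexivity.
  - apply (ex_series_scal (V := R_NormedModule)).
    apply (ex_series_incr_1 (fun k => Cmod ((2 * (- Ci * z)) ^ k * rGamma (a + RtoC (INR k) + 1)))).
    apply ex_series_rGamma.
Qed.

Definition integral_const (mu z : C) : C :=
  Cexp (Ci * z) * Cexp (- (Ci * RtoC PI * fracpart mu / 2)) * Cpower z (fracpart mu).

Definition integral_term (mu z : C) (k : nat) : C :=
  (- Ci * z) ^ k * (rGamma (fracpart mu + RtoC (INR k) + 1)
    * cos_integral (fracpart mu + RtoC (INR k)) (Z.of_nat k - nearest (Re mu))).

(** The term k = 0, possibly unbounded at PI, is subtracted before the exchange and added back with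
    its own limit from [kint_lim]. *)
Lemma integrand_RInt_gen (mu z : C) : z <> 0 -> exists S : C,
  Cis_series (integral_term mu z) S /\
  @is_RInt_gen C_R_NormedModule (integrand mu z) (at_point 0%R) (at_left PI) (integral_const mu z * S).
Proof.
  intros Hz. set (a := fracpart mu). set (D := integral_const mu z).
  (* The series [integral_term] is recovered from the integrated one by dividing by [D]. *)
  assert (HD0 : D <> 0).
  { unfold D, integral_const. apply Cmult_neq_0; [apply Cmult_neq_0; apply Cexp_neq_0 | apply Cpower_neq_0; auto]. }
  set (L := fun k => cos_integral (a + RtoC (INR k)) (Z.of_nat k - nearest (Re mu))).
  assert (HL : forall k, kint_lim (a + RtoC (INR k)) mu (L k)).
  { intros k. pose proof (Re_fracpart_nat mu k) as Hs. fold a in Hs.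
    pose proof (kint_lim_cos_integral _ (Z.of_nat k - nearest (Re mu)) Hs) as H. fold (L k) in H.
    replace (a + RtoC (INR k) - RtoC (IZR (Z.of_nat k - nearest (Re mu)))) with mu in H; auto.
    rewrite minus_IZR, <- INR_IZR_INZ, RtoC_minus. unfold a, fracpart. ring. }
  set (u := fun k => (- Ci * z) ^ k * rGamma (a + RtoC (INR k) + 1)).
  set (g := fun k t => D * u k * kern (a + RtoC (INR k)) mu t).
  destruct (series_RInt_exchange (fun k => g (S k)) (fun k b => D * u (S k) * kint (a + RtoC (INR (S k))) mu b)
     (fun k => D * u (S k) * L (S k)) (fun t => integrand mu z t + - (1) * g O t)
     (fun k => Cmod (D * u (S k)) * (exp (Re (a + RtoC (INR (S k))) * ln 2) * exp (Cmod mu * PI)))%R)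
    as [Phi [T [H1 [H2 H3]]]].
  - intros k b Hb. apply Cis_RInt_scal, kint_correct; auto.
  - intros k. apply Cconv_scal. apply HL.
  - intros t Ht. apply (Cis_series_shift (fun k => g k t) 1).
    replace (csum (fun k => g k t) 1 + (integrand mu z t + - (1) * g O t)) with (integrand mu z t) by (simpl; ring).
    apply integrand_series; auto.
  - intros k t Ht. unfold g. rewrite (Cmod_mult (D * u (S k))). apply Rmult_le_compat_l; [apply Cmod_ge_0 |].
    apply kern_bound; auto. rewrite re_plus, re_RtoC, S_INR. pose proof (Re_fracpart mu). pose proof (pos_INR k). fold a in H. lra.
  - apply ex_series_exchange_bound.
  - exists (/ D * (D * u O * L O + T)). split.
    + apply (is_series_ext (V := C_NormedModule) (fun k => / D * (D * u k * L k))).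
      * intros k. unfold integral_term. fold a. fold (L k). unfold u. as_eq C. field; auto.
      * apply Cis_series_scal.
        replace (D * u O * L O + T) with (csum (fun k => D * u k * L k) 1 + T) by (simpl; ring).
        apply (Cis_series_shift (fun k => D * u k * L k) 1). exact H3.
    + replace (D * (/ D * (D * u O * L O + T))) with (D * u O * L O + T) by (field; auto).
      apply (Cis_RInt_gen_intro _ (fun b => D * u O * kint (a + RtoC (INR 0)) mu b + Phi b)).
      * intros b Hb. eapply Cis_RInt_ext; [lra | | apply Cis_RInt_plus; [apply Cis_RInt_scal, kint_correct; auto | apply H1; auto]].
        intros t Ht. simpl. unfold g. simpl. ring.
      * apply Cconv_plus; [apply Cconv_scal, HL | exact H2].
Qed.

Lemma Bessel_series (mu z T : C) :
  Cis_series (fun l => (- Ci * z) ^ l * bcoef mu l / RtoC (INR (fact l))) T ->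
  BesselJ mu z = Cpower (z / 2) mu * (Cexp (Ci * z) * T).
Proof.
  intros HT. unfold BesselJ. f_equal. apply CSeries_unique.
  replace (RtoC (-1)) with (- (1)) by (rewrite <- RtoC_opp; reflexivity).
  exact (Kummer mu z T HT).
Qed.

Lemma Cexp_half_pi : Cexp (- (Ci * RtoC PI / 2)) = - Ci.
Proof.
  replace (- (Ci * RtoC PI / 2)) with (Ci * RtoC (- (PI / 2))).
  - rewrite Cexp_Ci, cos_neg, sin_neg, cos_PI2, sin_PI2. apply C_ext; simpl; ring.
  - rewrite RtoC_opp, RtoC_div by lra. field.
Qed.

(* The integer mu - a has either sign, hence its encoding as p - q. *)
Lemma power_transfer (mu a z : C) (p q : nat) : z <> 0 -> mu + RtoC (INR q) = a + RtoC (INR p) ->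
  Cexp (Ci * RtoC PI * mu / 2) * (Cexp (- (Ci * RtoC PI * a / 2)) * Cpower z a) * (- Ci * z) ^ p
  = Cpower z mu * (- Ci * z) ^ q.
Proof.
  intros Hz E.
  assert (W : forall n, (- Ci * z) ^ n = Cexp (- (Ci * RtoC PI * RtoC (INR n) / 2)) * Cpower z (RtoC (INR n))).
  { intros n. rewrite Cpow_mult_l, Cpower_INR by auto. f_equal. rewrite <- Cexp_half_pi, <- Cexp_INR. f_equal. field. }
  rewrite !W. set (P := RtoC (INR p)) in *. set (Q := RtoC (INR q)) in *.
  replace (Cexp (Ci * RtoC PI * mu / 2)) with (Cexp (Ci * RtoC PI * a / 2) * Cexp (Ci * RtoC PI * P / 2) * Cexp (- (Ci * RtoC PI * Q / 2))).
  2: { rewrite <- !Cexp_plus. f_equal. replace mu with (a + P - Q) by (rewrite <- E; ring). field. }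
  transitivity (Cexp (- (Ci * RtoC PI * Q / 2)) * Cpower z (a + P)).
  - rewrite Cpower_plus, !Cexp_opp by auto. 
    pose proof (Cexp_neq_0 (Ci * RtoC PI * a / 2)). pose proof (Cexp_neq_0 (Ci * RtoC PI * P / 2)).
    pose proof (Cexp_neq_0 (Ci * RtoC PI * Q / 2)). field. auto.
  - rewrite <- E, Cpower_plus by auto. ring.
Qed.

(** The terms k < p vanish because d < 0 there; afterwards term p + j of the integrated series is a
    constant times term q + j of the complete one. At least one of p and q is 0, so one formula
    covers both signs of [nearest (Re mu)]. *)
Lemma integral_sum (mu z S T : C) : z <> 0 ->
  Cis_series (integral_term mu z) S ->
  Cis_series (fun l => (- Ci * z) ^ l * bcoef mu l / RtoC (INR (fact l))) T ->
  Cexp (Ci * RtoC PI * mu / 2) / RtoC PI * (integral_const mu z * S)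
  = Cpower z mu * Cexp (- (mu * RtoC (ln 2))) * Cexp (Ci * z)
    * (T - csum (fun l => (- Ci * z) ^ l * bcoef mu l / RtoC (INR (fact l))) (Z.to_nat (- nearest (Re mu)))).
Proof.
  intros Hz HS HT. set (w := - Ci * z) in *. set (m := nearest (Re mu)) in *.
  set (p := Z.to_nat m). set (q := Z.to_nat (- m)).
  set (b := fun l => w ^ l * bcoef mu l / RtoC (INR (fact l))) in *.
  assert (Hw : w <> 0) by (unfold w; apply Cmult_neq_0; auto; replace (- Ci) with (- (1) * Ci) by ring; apply Cmult_neq_0; [intros E; apply (f_equal Re) in E; simpl in E; lra | apply Ci_nz]).
  assert (Hpi : RtoC PI <> 0) by (apply RtoC_neq_0; pose proof PI_RGT_0; lra).
  assert (Emu : mu + RtoC (INR q) = fracpart mu + RtoC (INR p)).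
  { rewrite (fracpart_eq mu) at 1. fold m. replace (IZR m) with (INR p - INR q)%R; [rewrite RtoC_minus; ring |].
    rewrite !INR_IZR_INZ, <- minus_IZR. f_equal. unfold p, q. lia. }
  assert (Hlow : csum (integral_term mu z) p = 0).
  { rewrite <- (csum_0 p). apply csum_ext. intros k Hk. unfold integral_term, cos_integral. fold m.
    destruct (Z_lt_dec (Z.of_nat k - m) 0) as [_ | H]; [ring | unfold p in Hk; lia]. }
  assert (Hterm : forall j, integral_term mu z (p + j) = RtoC PI * Cexp (- (mu * RtoC (ln 2))) * (w ^ p / w ^ q) * b (q + j)%nat).
  { intros j. unfold integral_term. fold m. fold w.
    replace (fracpart mu + RtoC (INR (p + j))) with (mu + RtoC (INR (q + j))).
    2: { rewrite !plus_INR, !RtoC_plus. transitivity (mu + RtoC (INR q) + RtoC (INR j)); [ring | rewrite Emu; ring]. }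
    replace (Z.of_nat (p + j) - m)%Z with (Z.of_nat (q + j)) by (unfold p, q; lia).
    rewrite rGamma_cos_integral. unfold b. rewrite !Cpow_add_r.
    pose proof (Cpow_nz w q Hw). pose proof (INR_fact_C_neq_0 (q + j)). field. auto. }
  assert (HS' : Cis_series (fun j => RtoC PI * Cexp (- (mu * RtoC (ln 2))) * (w ^ p / w ^ q) * b (q + j)%nat) S).
  { eapply (is_series_ext (V := C_NormedModule)); [exact Hterm |].
    apply (Cis_series_shift (integral_term mu z) p). rewrite Hlow, Cplus_0_l. exact HS. }
  assert (HT' : Cis_series (fun j => b (q + j)%nat) (T - csum b q)).
  { apply (Cis_series_shift b q). replace (csum b q + (T - csum b q)) with T by ring. exact HT. }
  apply (Cis_series_scal (RtoC PI * Cexp (- (mu * RtoC (ln 2))) * (w ^ p / w ^ q))) in HT'.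
  rewrite (Cis_series_unique _ _ _ HS' HT').
  pose proof (power_transfer mu (fracpart mu) z p q Hz Emu) as E. fold w in E.
  unfold integral_const. pose proof (Cpow_nz w q Hw).
  transitivity (Cexp (Ci * RtoC PI * mu / 2) * (Cexp (- (Ci * RtoC PI * fracpart mu / 2)) * Cpower z (fracpart mu)) * w ^ p
     * (Cexp (Ci * z) * Cexp (- (mu * RtoC (ln 2))) / w ^ q * (T - csum b q))).
  - field. auto.
  - rewrite E. field. auto.
Qed.

(** With j = l + 1 the terms agree one by one: the 2^mu in (- 2 i z)^(mu + l) against the 4^mu of
    [Gamma_ratio_bcoef] leaves the 2^(-mu) of (z/2)^mu. *)
Lemma finite_sum (mu z : C) : z <> 0 ->
  Cexp (Ci * RtoC PI * mu / 2) / RtoC (sqrt PI) * Cexp (Ci * z)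
      * @sum_n_m C_AbelianMonoid
          (fun j : nat =>
             Gamma_ratio mu j / CGamma (RtoC (INR j))
             * power_mi 2 z (RtoC (INR j) + mu - 1))
          1 (Z.to_nat (- nearest (Re mu)))
  = Cpower z mu * Cexp (- (mu * RtoC (ln 2))) * Cexp (Ci * z)
    * csum (fun l => (- Ci * z) ^ l * bcoef mu l / RtoC (INR (fact l))) (Z.to_nat (- nearest (Re mu))).
Proof.
  intros Hz. rewrite csum_sum_n_m, <- !csum_scal. apply csum_ext. intros l Hl.
  rewrite <- (Gamma_ratio_bcoef mu l Hl), CGamma_nat.
  assert (Hs : sqrt PI <> 0%R) by (apply Rgt_not_eq, sqrt_lt_R0, PI_RGT_0).
  replace (RtoC (INR (S l)) + mu - 1) with (mu + RtoC (INR l)) by (rewrite S_INR, RtoC_plus; ring).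
  pose proof (power_transfer (mu + RtoC (INR l)) mu z l 0 Hz ltac:(simpl; ring)) as E. simpl in E.
  unfold power_mi. rewrite (Cpower_pos 2) by lra.
  replace ((mu + RtoC (INR l)) * RtoC (ln 2)) with (mu * RtoC (ln 2) + RtoC (INR l) * RtoC (ln 2)) by ring.
  replace (2 * mu * RtoC (ln 2)) with (mu * RtoC (ln 2) + mu * RtoC (ln 2)) by ring.
  rewrite !Cexp_plus, Cexp_INR, Cexp_RtoC, exp_ln, (Cexp_opp (mu * RtoC (ln 2))) by lra.
  rewrite RtoC_inv by auto.
  replace (- (Ci * RtoC PI * (mu + RtoC (INR l)) / 2)) with (- (Ci * RtoC PI * mu / 2) + RtoC (INR l) * - (Ci * RtoC PI / 2)) by field.
  rewrite Cexp_plus, (Cexp_INR l (- (Ci * RtoC PI / 2))), Cexp_half_pi, Cpower_plus, Cpower_INR, Cpow_mult_l by auto.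
  rewrite Cexp_opp.
  pose proof (Cexp_neq_0 (Ci * RtoC PI * mu / 2)). pose proof (Cexp_neq_0 (mu * RtoC (ln 2))).
  pose proof (INR_fact_C_neq_0 l). pose proof (RtoC_neq_0 _ Hs). field. auto.
Qed.

Lemma Bessel_representation_nonzero (mu z : C) : z <> 0 ->
  @ex_RInt_gen C_R_NormedModule (integrand mu z) (at_point 0%R) (at_left PI) /\
  BesselJ mu z =
    Cexp (Ci * RtoC PI * mu / 2) / RtoC PI
    * @RInt_gen C_R_CompleteNormedModule
        (integrand mu z) (at_point 0%R) (at_left PI)
    + Cexp (Ci * RtoC PI * mu / 2) / RtoC (sqrt PI) * Cexp (Ci * z)
      * @sum_n_m C_AbelianMonoid
          (fun j : nat =>
             Gamma_ratio mu j / CGamma (RtoC (INR j))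
             * power_mi 2 z (RtoC (INR j) + mu - 1))
          1 (Z.to_nat (- nearest (Re mu))).
Proof.
  intros Hz. destruct (integrand_RInt_gen mu z Hz) as [S [HS HI]].
  destruct (Cex_series_abs _ (ex_series_bcoef mu (- Ci * z))) as [T HT].
  split; [exists (integral_const mu z * S); exact HI |].
  rewrite (is_RInt_gen_unique (V := C_R_CompleteNormedModule) _ _ HI).
  rewrite (finite_sum mu z Hz), (Bessel_series mu z T HT).
  rewrite (integral_sum mu z S T Hz HS HT).
  replace (z / 2) with (RtoC (/ 2) * z) by (rewrite RtoC_inv by lra; field).
  rewrite Cpower_scale, Cpower_pos, ln_Rinv, RtoC_opp by (auto; lra).
  replace (mu * - RtoC (ln 2)) with (- (mu * RtoC (ln 2))) by ring. ring.
Qed.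

(** At z = 0 the power law for [Cpower] fails, so both sides are evaluated directly: [fracpart mu] =
    0 makes the incomplete gamma factor 1, and the integral of cos (n t) as well as J_n(0) vanish
    unless n = 0. *)
Lemma Bessel_representation_zero (mu : C) : is_integer mu ->
  @ex_RInt_gen C_R_NormedModule (integrand mu 0) (at_point 0%R) (at_left PI) /\
  BesselJ mu 0 =
    Cexp (Ci * RtoC PI * mu / 2) / RtoC PI
    * @RInt_gen C_R_CompleteNormedModule
        (integrand mu 0) (at_point 0%R) (at_left PI)
    + Cexp (Ci * RtoC PI * mu / 2) / RtoC (sqrt PI) * Cexp (Ci * 0)
      * @sum_n_m C_AbelianMonoid
          (fun j : nat =>
             Gamma_ratio mu j / CGamma (RtoC (INR j))
             * power_mi 2 0 (RtoC (INR j) + mu - 1))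
          1 (Z.to_nat (- nearest (Re mu))).
Proof.
  intros [n Hn].
  assert (Em : nearest (Re mu) = n) by (rewrite Hn, re_RtoC; apply nearest_spec; lra).
  assert (Ea : fracpart mu = 0) by (unfold fracpart; rewrite Em, Hn; ring).
  (* The exponent j + n is negative in this range, hence never the one at which the power of 0 is
     1. *)
  assert (Hsum : forall j, (j < Z.to_nat (- n))%nat -> Cpower 0 (RtoC (INR (S j)) + mu - 1) = 0).
  { intros j Hj. unfold Cpower. destruct (Ceq_dec 0 0) as [_ | E]; [| contradiction].
    destruct (Ceq_dec (RtoC (INR (S j)) + mu - 1) 0) as [E | _]; auto. exfalso.
    rewrite Hn, S_INR, RtoC_plus in E. replace (RtoC (INR j) + 1 + RtoC (IZR n) - 1) with (RtoC (IZR (Z.of_nat j + n))) in E.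
    - apply RtoC_inj, eq_IZR in E. lia.
    - rewrite plus_IZR, <- INR_IZR_INZ, RtoC_plus. ring. }
  assert (Hser : Cis_series (fun k : nat => 0 ^ k * rGamma (0 + RtoC (INR k) + 1)) (RtoC 1)).
  { set (f := fun k : nat => 0 ^ k * rGamma (0 + RtoC (INR k) + 1)).
    assert (E1 : csum f 1 + 0 = 1).
    { unfold f. simpl. replace (0 + 0 + 1) with (RtoC 1) by ring. rewrite rGamma_1. ring. }
    rewrite <- E1. apply (Cis_series_shift f 1).
    apply Cis_series_csum. apply (Cconv_ext (fun _ => RtoC 0)); [| apply Cconv_const].
    intros p. symmetry. rewrite <- (csum_0 p). apply csum_ext. intros k _. unfold f. simpl. ring. }
  assert (Hint : forall t, (0 <= t < PI)%R -> kern 0 mu t = integrand mu 0 t).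
  { intros t Ht. unfold kern, integrand, Pgamma_mi. rewrite Ea. unfold cos_pow, power_mi.
    replace (- Ci * RtoC (1 + cos t) * 0) with (RtoC 0) by ring. rewrite (gammastar_series 0 0 1 Hser).
    rewrite !Cpower_0_r. replace (- (Ci * RtoC PI * 0 / 2)) with (RtoC 0) by field.
    replace (- (Ci * 0 * RtoC (cos t))) with (RtoC 0) by ring. replace (- 0) with (RtoC 0) by ring.
    rewrite Cmult_0_l, Cexp_0. ring. }
  assert (HI : @is_RInt_gen C_R_NormedModule (integrand mu 0) (at_point 0%R) (at_left PI) (cos_integral 0 (- n))).
  { apply (Cis_RInt_gen_intro _ (kint 0 mu)).
    - intros b Hb. eapply Cis_RInt_ext; [lra | | apply kint_correct; auto]. intros t Ht. apply Hint. lra.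
    - pose proof (kint_lim_cos_integral 0 (- n) ltac:(simpl; lra)) as H.
      replace (0 - RtoC (IZR (- n))) with mu in H by (rewrite Hn, opp_IZR, RtoC_opp; ring). exact H. }
  split; [eexists; exact HI |].
  rewrite (is_RInt_gen_unique (V := C_R_CompleteNormedModule) _ _ HI).
  rewrite csum_sum_n_m, Em.
  rewrite (csum_ext _ (fun _ => 0)).
  2: { intros j Hj. unfold power_mi. rewrite Hsum by auto. ring. }
  rewrite csum_0, Cmult_0_r, Cplus_0_r.
  assert (Hpi : RtoC PI <> 0) by (apply RtoC_neq_0; pose proof PI_RGT_0; lra).
  unfold BesselJ. replace (0 / 2) with (RtoC 0) by field.
  destruct (Z.eq_dec n 0) as [En | En].
  - rewrite Hn, En, Cpower_0_r. unfold cos_integral. simpl.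
    rewrite Cmult_0_l, !Cmult_0_r. replace (0 / 2) with (RtoC 0) by field. replace (- 0) with (RtoC 0) by ring. rewrite Cexp_0.
    rewrite (CSeries_unique _ (RtoC 1)).
    + field. auto.
    + eapply (is_series_ext (V := C_NormedModule)); [| exact Hser].
      intros k. as_eq C. destruct k; simpl; [field; apply C1_nz | ring].
  - assert (E0 : mu <> 0) by (rewrite Hn; intros E; apply RtoC_inj, eq_IZR in E; auto).
    unfold Cpower. destruct (Ceq_dec 0 0) as [_ | E]; [| contradiction]. destruct (Ceq_dec mu 0) as [E | _]; [contradiction |].
    replace (cos_integral 0 (- n)) with (RtoC 0); [ring |].
    unfold cos_integral. destruct (Z_lt_dec (- n) 0) as [_ | H]; auto.
    destruct (Z.to_nat (- n)) as [| l] eqn:El; [lia |].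
    (* The first factor of the product is y = 0. *)
    replace (hprod 0 (S l)) with (RtoC 0); [unfold Cdiv; ring |].
    clear. induction l; simpl in *; [field | rewrite <- IHl; ring].
Qed.

(* For Re (fracpart mu) < 0 the integrand is unbounded at theta = PI, so the
   integral is improper at that end point. *)
Theorem theorem2p1 (mu z : C) (hz : ~ is_integer mu -> ~ on_cut z) :
  @ex_RInt_gen C_R_NormedModule (integrand mu z) (at_point 0%R) (at_left PI) /\
  BesselJ mu z =
    Cexp (Ci * RtoC PI * mu / 2) / RtoC PI
    * @RInt_gen C_R_CompleteNormedModule
        (integrand mu z) (at_point 0%R) (at_left PI)
    + Cexp (Ci * RtoC PI * mu / 2) / RtoC (sqrt PI) * Cexp (Ci * z)
      * @sum_n_m C_AbelianMonoid
          (fun j : nat =>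
             Gamma_ratio mu j / CGamma (RtoC (INR j))
             * power_mi 2 z (RtoC (INR j) + mu - 1))
          1 (Z.to_nat (- nearest (Re mu))).
Proof.
  destruct (Ceq_dec z 0) as [-> | Hz].
  (* The point 0 lies on the cut, so the hypothesis makes mu an integer. *)
  - apply Bessel_representation_zero. apply NNPP. intros H. apply (hz H). split; simpl; lra.
  - apply Bessel_representation_nonzero; auto.
Qed.
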